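(* Let $\nu$ be a supernatural number and let $\mathscr{K}(\nu)$ be the class of all pairs $\langle C([0,1],\mathbb{M}_n), \tau\rangle$, where $n$ is a natural number formally dividing $\nu$ and $\tau$ is a faithful trace on $C([0,1],\mathbb{M}_n)$. Then $\mathscr{K}(\nu)$ is a Fraïssé class.
   Context: A supernatural number is a formal product $\nu=\prod_{p\text{ prime}}p^{n_p}$ with each $n_p\in\{0,1,2,\dots\}\cup\{\infty\}$ and $\sum_p n_p=\infty$. A natural number $n$ formally divides $\nu$ if for each prime $p$ the exponent of $p$ in $n$ is at most $n_p$. Traces are normalized (tracial states). The structures considered are pairs $\langle A,\tau\rangle$ with $A$ a unital C*-algebra and $\tau$ a trace on $A$, viewed as metric structures in the language $L$ with predicate symbols $d$ (interpreted as $d(a,b)=\|a-b\|$) and $\mathrm{tr}$ (interpreted as $\tau$), and function symbols for addition, multiplication, multiplication by each $\lambda\in\mathbb{C}$, the involution $*$, and the constants $0,1$. An embedding (also called a morphism) is an injective unital trace-preserving $*$-homomorphism. A structure is finitely generated if its C*-algebra is generated, as a unital C*-algebra, by a finite tuple. A class $\mathscr{K}$ of finitely generated structures is a Fraïssé class if it satisfies the following. (JEP) For any $A,B\in\mathscr{K}$ there is $C\in\mathscr{K}$ into which both $A$ and $B$ embed. (NAP) For any $A,B_1,B_2\in\mathscr{K}$, embeddings $\varphi_i\colon A\to B_i$, finite $G\subseteq A$ and $\varepsilon>0$, there are $C\in\mathscr{K}$ and embeddings $\psi_i\colon B_i\to C$ with $d(\psi_1\varphi_1(a),\psi_2\varphi_2(a))<\varepsilon$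 for all $a\in G$. (WPP) Let $\mathscr{K}_n$ be the class of pairs $(A,\vec a)$ with $A\in\mathscr{K}$ and $\vec a\in A^n$ generating $A$, with the pseudometric $d^{\mathscr{K}}((A,\vec a),(B,\vec b))=\inf\max_i d(f(a_i),g(b_i))$, the infimum being over all embeddings $f,g$ of $A,B$ into a common $C\in\mathscr{K}$ (this is a pseudometric given JEP and NAP). Then $\mathscr{K}_n$ is separable for every $n$. (CCP) For every $n$-ary predicate symbol $P$, the map $(A,(\vec a,\vec b))\mapsto P^A(\vec a)$ from $\mathscr{K}_{n+m}$ to $\mathbb{R}$ sends Cauchy sequences to Cauchy sequences, and for every $n$-ary function symbol $f$, the map $(A,(\vec a,\vec b))\mapsto (A,(\vec a,\vec b,f^A(\vec a)))$ from $\mathscr{K}_{n+m}$ to $\mathscr{K}_{n+m+1}$ sends Cauchy sequences to Cauchy sequences. *)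

(* Defs.v *)
From HB Require Import structures.
From mathcomp Require Import all_boot all_order all_algebra.
From mathcomp Require Import complex.
From mathcomp Require Import all_classical all_reals all_analysis.
From mathcomp Require Import ring lra.

Set Implicit Arguments.
Unset Strict Implicit.
Unset Printing Implicit Defensive.

Import Order.TTheory GRing.Theory Num.Theory.
Import numFieldNormedType.Exports.

Local Open Scope classical_set_scope.
Local Open Scope ring_scope.

(* The complex numbers, named at the level of [numClosedFieldType] because the
   canonical topology of [numFieldNormedType] is keyed on that structure and is
   not found on the bare type [R[i]]. *)
Definition Cx (R : realType) : numClosedFieldType := R[i].

(* The modulus as an element of [R]; the norm of [Cx R] takes values in [Cx R]. *)
Definition modulus (R : realType) (z : Cx R) : R := Normc.normc z.

Section modulus_lemmas.
Variable R : realType.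
Implicit Types z w : Cx R.

Lemma normCxE z : `|z| = ((modulus z)%:C)%C :> R[i].
Proof. by case: z. Qed.

Lemma modulus_ge0 z : 0 <= modulus z.
Proof. by case: z => a b; exact: sqrtr_ge0. Qed.

Lemma modulus0 : modulus (0 : Cx R) = 0.
Proof. exact: Normc.normc0. Qed.

Lemma modulus1 : modulus (1 : Cx R) = 1.
Proof. exact: Normc.normc1. Qed.

Lemma modulus0_eq0 z : modulus z = 0 -> z = 0.
Proof. exact: Normc.eq0_normc. Qed.

Lemma modulusM z w : modulus (z * w) = modulus z * modulus w.
Proof. exact: Normc.normcM. Qed.

Lemma modulusD z w : modulus (z + w) <= modulus z + modulus w.
Proof. exact: le_normcD. Qed.

Lemma modulusN z : modulus (- z) = modulus z.
Proof. exact: normcN. Qed.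

Lemma modulusC z : modulus (z^*) = modulus z.
Proof.
apply: (@complexI R); rewrite -!normCxE.
exact: (@norm_conjC (Cx R)).
Qed.

Lemma modulus_sum (I : Type) (r : seq I) (P : pred I) (F : I -> Cx R) :
  modulus (\sum_(i <- r | P i) F i) <= \sum_(i <- r | P i) modulus (F i).
Proof.
elim/big_ind2 : _ => //; first by rewrite modulus0.
move=> x a y b xa yb; apply: (le_trans (modulusD _ _)); exact: lerD.
Qed.

Lemma sqr_modulus z : z^* * z = (((modulus z) ^+ 2)%:C)%C :> R[i].
Proof.
have -> : z^* * z = `|z| ^+ 2 by rewrite normCK mulrC.
by rewrite rmorphXn /= -normCxE.
Qed.

Lemma modulus_real (r : R) : modulus (r%:C)%C = `|r|.
Proof. by rewrite /modulus /= expr0n/= addr0 sqrtr_sqr. Qed.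

Lemma modulus_Re z : `|complex.Re z| <= modulus z.
Proof.
case: z => a b; rewrite /modulus /= -sqrtr_sqr ler_sqrt ?lerDl ?sqr_ge0//.
by rewrite addr_ge0 ?sqr_ge0.
Qed.

Lemma modulus_Im z : `|complex.Im z| <= modulus z.
Proof.
case: z => a b; rewrite /modulus /= -sqrtr_sqr ler_sqrt ?lerDr ?sqr_ge0//.
by rewrite addr_ge0 ?sqr_ge0.
Qed.

Lemma modulus_le z : modulus z <= `|complex.Re z| + `|complex.Im z|.
Proof.
case: z => a b; rewrite /modulus /=.
rewrite -(ler_pXn2r (ltn0Sn 1)) ?nnegrE ?sqrtr_ge0 ?addr_ge0//.
rewrite sqr_sqrtr ?addr_ge0 ?sqr_ge0// -(real_normK (num_real a)).
rewrite -(real_normK (num_real b)).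
have := normr_ge0 a; have := normr_ge0 b; nra.
Qed.

End modulus_lemmas.

Definition vnorm (R : realType) (n : nat) (v : 'cV[Cx R]_n.+1) : R :=
  Num.sqrt (\sum_i modulus (v i 0) ^+ 2).

HB.lock Definition opnorm (R : realType) (n : nat) (A : 'M[Cx R]_n.+1) : R :=
  sup [set vnorm (A *m v) | v in [set v : 'cV[Cx R]_n.+1 | vnorm v <= 1]].

Section operator_norm.
Variables (R : realType) (n : nat).
Implicit Types (u v w : 'cV[Cx R]_n.+1) (A B : 'M[Cx R]_n.+1).

Definition adjoint A : 'M[Cx R]_n.+1 := map_mx Num.conj A^T.

Lemma vnorm_ge0 v : 0 <= vnorm v.
Proof. exact: sqrtr_ge0. Qed.

Lemma vnorm_sqr v : vnorm v ^+ 2 = \sum_i modulus (v i 0) ^+ 2.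
Proof. by rewrite sqr_sqrtr// sumr_ge0// => i _; rewrite sqr_ge0. Qed.

Lemma vnorm0 : vnorm (0 : 'cV[Cx R]_n.+1) = 0.
Proof.
rewrite /vnorm big1 ?sqrtr0// => i _.
by rewrite mxE modulus0 expr0n.
Qed.

Lemma modulus_le_vnorm v i : modulus (v i 0) <= vnorm v.
Proof.
rewrite -(ler_pXn2r (ltn0Sn 1)) ?nnegrE ?vnorm_ge0 ?modulus_ge0// vnorm_sqr.
by rewrite (bigD1 i)//= lerDl sumr_ge0// => j _; rewrite sqr_ge0.
Qed.

Lemma vnorm0_eq0 v : vnorm v = 0 -> v = 0.
Proof.
move=> v0; apply/matrixP => i j; rewrite ord1 mxE; apply: modulus0_eq0.
by apply/eqP; rewrite eq_le modulus_ge0 -v0 modulus_le_vnorm.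
Qed.

Lemma vnormZ (c : Cx R) v : vnorm (c *: v) = modulus c * vnorm v.
Proof.
rewrite /vnorm -[X in X * _]ger0_norm ?modulus_ge0// -sqrtr_sqr.
rewrite -sqrtrM ?sqr_ge0// mulr_sumr; congr Num.sqrt.
by apply: eq_bigr => i _; rewrite mxE modulusM exprMn.
Qed.

Lemma real_CauchySchwarz (a b : 'I_n.+1 -> R) :
  (\sum_i a i * b i) ^+ 2 <= (\sum_i a i ^+ 2) * (\sum_i b i ^+ 2).
Proof.
set x := \sum_i a i ^+ 2; set y := \sum_i b i ^+ 2; set z := \sum_i _.
have y0 : 0 <= y by apply: sumr_ge0 => i _; rewrite sqr_ge0.
have : 0 <= \sum_i (y * a i - z * b i) ^+ 2.
  by apply: sumr_ge0 => i _; rewrite sqr_ge0.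
have -> : \sum_i (y * a i - z * b i) ^+ 2 = y * (x * y - z ^+ 2).
  transitivity (\sum_i (y ^+ 2 * a i ^+ 2 - (2 * y * z) * (a i * b i)
                        + z ^+ 2 * b i ^+ 2)).
    by apply: eq_bigr => i _; ring.
  by rewrite !big_split/= sumrN -!mulr_sumr -/x -/y -/z; ring.
have [y_gt0|] := ltP 0 y; first by rewrite pmulr_rge0// subr_ge0.
move=> y_le0 _; have {y_le0 y0} y0 : y = 0 by apply/eqP; rewrite eq_le y_le0.
have b0 i : b i = 0.
  apply/eqP; rewrite -sqrf_eq0; move/eqP: y0.
  by rewrite psumr_eq0 => [/allP/(_ i)|j _]; rewrite ?sqr_ge0// mem_index_enum; apply.
by rewrite /z big1 ?expr0n ?y0 ?mulr0// => i _; rewrite b0 mulr0.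
Qed.

Lemma vnormD u v : vnorm (u + v) <= vnorm u + vnorm v.
Proof.
rewrite -(ler_pXn2r (ltn0Sn 1)) ?nnegrE ?addr_ge0 ?vnorm_ge0//.
rewrite sqrrD !vnorm_sqr.
set s := \sum_i modulus (u i 0) * modulus (v i 0).
have s_le : s <= vnorm u * vnorm v.
  rewrite -(ler_pXn2r (ltn0Sn 1)) ?nnegrE ?mulr_ge0 ?vnorm_ge0//; last first.
    by apply: sumr_ge0 => i _; rewrite mulr_ge0 ?modulus_ge0.
  by rewrite exprMn !vnorm_sqr; exact: real_CauchySchwarz.
apply: (@le_trans _ _ (\sum_i modulus (u i 0) ^+ 2 + s *+ 2 +
                       \sum_i modulus (v i 0) ^+ 2)); last first.
  by rewrite lerD2r lerD2l lerMn2r.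
rewrite -mulr_natl mulr_sumr -!big_split/=; apply: ler_sum => i _.
rewrite mxE.
have := modulusD (u i 0) (v i 0); have := modulus_ge0 (u i 0 + v i 0).
by have := modulus_ge0 (u i 0); have := modulus_ge0 (v i 0); nra.
Qed.

Definition inner u v : Cx R := \sum_i (u i 0)^* * v i 0.

Lemma inner_vnorm u : inner u u = ((vnorm u ^+ 2)%:C)%C.
Proof.
rewrite vnorm_sqr rmorph_sum; apply: eq_bigr => i _; exact: sqr_modulus.
Qed.

Lemma CauchySchwarz_vnorm u v : modulus (inner u v) <= vnorm u * vnorm v.
Proof.
apply: (le_trans (modulus_sum _ _ _)).
rewrite -(ler_pXn2r (ltn0Sn 1)) ?nnegrE ?mulr_ge0 ?vnorm_ge0//; last first.
  by apply: sumr_ge0 => i _; rewrite modulus_ge0.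
rewrite exprMn !vnorm_sqr; under eq_bigr do rewrite modulusM modulusC.
exact: real_CauchySchwarz.
Qed.

Lemma inner_adjoint A u v : inner (A *m u) v = inner u (adjoint A *m v).
Proof.
rewrite /inner; under eq_bigr => i _ do rewrite mxE rmorph_sum mulr_suml.
rewrite exchange_big/=; apply: eq_bigr => j _.
rewrite !mxE mulr_sumr; apply: eq_bigr => i _.
by rewrite !mxE rmorphM mulrAC mulrC mulrA mulrAC mulrC mulrA.
Qed.

Lemma adjointK A : adjoint (adjoint A) = A.
Proof. by apply/matrixP => i j; rewrite !mxE conjCK. Qed.

Lemma adjointD A B : adjoint (A + B) = adjoint A + adjoint B.
Proof. by apply/matrixP => i j; rewrite !mxE rmorphD. Qed.

Lemma adjointZ (c : Cx R) A : adjoint (c *: A) = c^* *: adjoint A.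
Proof. by apply/matrixP => i j; rewrite !mxE rmorphM. Qed.

Lemma adjointM A B : adjoint (A *m B) = adjoint B *m adjoint A.
Proof. by rewrite /adjoint trmx_mul map_mxM. Qed.

Lemma vnorm_mulmx A v :
  vnorm (A *m v) <= (\sum_i \sum_j modulus (A i j)) * vnorm v.
Proof.
apply: (@le_trans _ _ (\sum_i modulus ((A *m v) i 0))).
  rewrite -(ler_pXn2r (ltn0Sn 1)) ?nnegrE ?vnorm_ge0//; last first.
    by apply: sumr_ge0 => i _; rewrite modulus_ge0.
  rewrite vnorm_sqr expr2 mulr_suml; apply: ler_sum => i _.
  rewrite expr2 ler_wpM2l ?modulus_ge0//.
  by rewrite (bigD1 i)//= lerDl sumr_ge0// => j _; rewrite modulus_ge0.
rewrite mulr_suml; apply: ler_sum => i _; rewrite mxE.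
apply: (le_trans (modulus_sum _ _ _)); rewrite mulr_suml.
apply: ler_sum => j _; rewrite modulusM ler_wpM2l ?modulus_ge0//.
exact: modulus_le_vnorm.
Qed.

Lemma opnorm_has_sup A :
  has_sup [set vnorm (A *m v) | v in [set v | vnorm v <= 1]].
Proof.
split; first by exists (vnorm (A *m 0)), 0 => //=; rewrite vnorm0 ler01.
exists (\sum_i \sum_j modulus (A i j)) => _ [v /= v1 <-].
apply: (le_trans (vnorm_mulmx A v)); rewrite ler_piMr//.
by do 2 (apply: sumr_ge0 => ? _); rewrite modulus_ge0.
Qed.

Lemma opnorm_ge0 A : 0 <= opnorm A.
Proof.
rewrite unlock (_ : 0 = vnorm (A *m 0)); last by rewrite mulmx0 vnorm0.
apply: sup_upper_bound; first exact: opnorm_has_sup.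
by exists 0 => //=; rewrite vnorm0 ler01.
Qed.

Lemma le_opnorm A v : vnorm (A *m v) <= opnorm A * vnorm v.
Proof.
have [v0|v0] := eqVneq (vnorm v) 0.
  by rewrite (vnorm0_eq0 v0) mulmx0 vnorm0 mulr0.
have v_gt0 : 0 < vnorm v by rewrite lt_def v0 vnorm_ge0.
rewrite -ler_pdivrMr// mulrC.
have mV : modulus ((vnorm v)^-1%:C)%C = (vnorm v)^-1.
  by rewrite modulus_real ger0_norm// invr_ge0 vnorm_ge0.
rewrite -mV -vnormZ scalemxAr unlock; apply: sup_upper_bound.
  exact: opnorm_has_sup.
by exists (((vnorm v)^-1%:C)%C *: v) => //=; rewrite vnormZ mV mulVf.
Qed.

Lemma opnorm_le A (c : R) : 0 <= c ->
  (forall v, vnorm (A *m v) <= c * vnorm v) -> opnorm A <= c.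
Proof.
move=> c0 Ac; rewrite unlock; apply: ge_sup; first by have [] := opnorm_has_sup A.
by move=> _ [v /= v1 <-]; apply: (le_trans (Ac v)); rewrite ler_piMr.
Qed.

Lemma modulus_le_opnorm A i j : modulus (A i j) <= opnorm A.
Proof.
have -> : A i j = (A *m (delta_mx j 0 : 'cV[Cx R]_n.+1)) i 0 by rewrite -colE mxE.
apply: (le_trans (modulus_le_vnorm _ _)); apply: (le_trans (le_opnorm _ _)).
suff -> : vnorm (delta_mx j 0 : 'cV[Cx R]_n.+1) = 1 by rewrite mulr1.
rewrite /vnorm (bigD1 j)//= mxE !eqxx modulus1 expr1n big1 ?addr0 ?sqrtr1//.
by move=> k kj; rewrite mxE (negbTE kj) modulus0 expr0n.
Qed.

Lemma opnorm_le_sum A : opnorm A <= \sum_i \sum_j modulus (A i j).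
Proof.
apply: opnorm_le => [|v]; last exact: vnorm_mulmx.
by do 2 (apply: sumr_ge0 => ? _); rewrite modulus_ge0.
Qed.

Lemma opnorm0_eq0 A : opnorm A = 0 -> A = 0.
Proof.
move=> A0; apply/matrixP => i j; rewrite mxE; apply: modulus0_eq0.
by apply/eqP; rewrite eq_le modulus_ge0 -A0 modulus_le_opnorm.
Qed.

Lemma opnormD A B : opnorm (A + B) <= opnorm A + opnorm B.
Proof.
apply: opnorm_le => [|v]; first by rewrite addr_ge0 ?opnorm_ge0.
rewrite mulmxDl mulrDl; apply: (le_trans (vnormD _ _)).
by rewrite lerD ?le_opnorm.
Qed.

Lemma opnormM A B : opnorm (A *m B) <= opnorm A * opnorm B.
Proof.
apply: opnorm_le => [|v]; first by rewrite mulr_ge0 ?opnorm_ge0.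
rewrite -mulmxA; apply: (le_trans (le_opnorm _ _)).
by rewrite -mulrA ler_wpM2l ?opnorm_ge0 ?le_opnorm.
Qed.

Lemma opnormZ_le (c : Cx R) A : opnorm (c *: A) <= modulus c * opnorm A.
Proof.
apply: opnorm_le => [|v]; first by rewrite mulr_ge0 ?opnorm_ge0 ?modulus_ge0.
by rewrite -scalemxAl vnormZ -mulrA ler_wpM2l ?modulus_ge0 ?le_opnorm.
Qed.

Lemma opnormZ (c : Cx R) A : opnorm (c *: A) = modulus c * opnorm A.
Proof.
apply/eqP; rewrite eq_le opnormZ_le/=.
have [->|c0] := eqVneq c 0; first by rewrite modulus0 mul0r opnorm_ge0.
have mc : 0 < modulus c.
  by rewrite lt_def modulus_ge0 andbT; apply: contra_neq c0 => /modulus0_eq0.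
rewrite -ler_pdivlMl//.
have -> : (modulus c)^-1 = modulus c^-1.
  by apply: (mulfI (lt0r_neq0 mc)); rewrite divff ?lt0r_neq0// -modulusM divff// modulus1.
by apply: le_trans (opnormZ_le _ _); rewrite scalerA mulVf// scale1r.
Qed.

Lemma sqr_opnorm_le A : opnorm A ^+ 2 <= opnorm (adjoint A *m A).
Proof.
have ge0 := opnorm_ge0 (adjoint A *m A).
rewrite -[X in _ <= X]sqr_sqrtr// ler_pXn2r ?nnegrE ?opnorm_ge0 ?sqrtr_ge0//.
apply: opnorm_le => [|v]; first exact: sqrtr_ge0.
rewrite -(ler_pXn2r (ltn0Sn 1)) ?nnegrE ?mulr_ge0 ?vnorm_ge0 ?sqrtr_ge0//.
rewrite exprMn (sqr_sqrtr ge0).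
have -> : vnorm (A *m v) ^+ 2 = modulus (inner (A *m v) (A *m v)).
  by rewrite inner_vnorm modulus_real ger0_norm// sqr_ge0.
rewrite inner_adjoint; apply: (le_trans (CauchySchwarz_vnorm _ _)).
by rewrite expr2 mulrA mulrC ler_wpM2r ?vnorm_ge0// mulmxA le_opnorm.
Qed.

Lemma opnorm_adjoint A : opnorm (adjoint A) = opnorm A.
Proof.
have le B : opnorm B <= opnorm (adjoint B).
  have [->|B0] := eqVneq (opnorm B) 0; first exact: opnorm_ge0.
  have Bgt0 : 0 < opnorm B by rewrite lt_def B0 opnorm_ge0.
  by rewrite -(ler_pM2r Bgt0) -expr2 (le_trans (sqr_opnorm_le B))// opnormM.
by apply/eqP; rewrite eq_le le andbT; have := le (adjoint A); rewrite adjointK.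
Qed.

Lemma opnorm_adjoint_mul A : opnorm (adjoint A *m A) = opnorm A ^+ 2.
Proof.
apply/eqP; rewrite eq_le sqr_opnorm_le andbT (le_trans (opnormM _ _))//.
by rewrite opnorm_adjoint expr2.
Qed.

Lemma opnormN A : opnorm (- A) = opnorm A.
Proof. by rewrite -scaleN1r opnormZ modulusN modulus1 mul1r. Qed.

End operator_norm.

HB.mixin Record isCStar (R : realType) A of GRing.Algebra (Cx R) A := {
  star : A -> A;
  cnorm : A -> R;
  starK : involutive star;
  starD : {morph star : a b / a + b};
  starZ : forall (c : Cx R) (a : A), star (c *: a) = c^* *: star a;
  starM : forall a b, star (a * b) = star b * star a;
  cnorm0_eq0 : forall a, cnorm a = 0 -> a = 0;
  cnormD : forall a b, cnorm (a + b) <= cnorm a + cnorm b;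
  cnormZ : forall (c : Cx R) (a : A), cnorm (c *: a) = modulus c * cnorm a;
  cnormM : forall a b, cnorm (a * b) <= cnorm a * cnorm b;
  cnorm_star_mul : forall a, cnorm (star a * a) = cnorm a ^+ 2;
  cnorm_complete : forall u : nat -> A,
    (forall e : R, 0 < e -> exists N, forall i j, (N <= i)%N -> (N <= j)%N ->
       cnorm (u i - u j) < e) ->
    exists l, forall e : R, 0 < e -> exists N, forall i, (N <= i)%N ->
       cnorm (u i - l) < e
}.

#[short(type="cstarAlgType")]
HB.structure Definition CStarAlgebra (R : realType) :=
  {A of GRing.Algebra (Cx R) A & isCStar R A}.

Definition I01 (R : realType) : pseudoMetricType R :=
  set_type (`[0%R, 1%R] : set R).

Section continuous_opnorm.
Variables (R : realType) (n : nat).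
Implicit Types f g : I01 R -> 'M[Cx R]_n.+1.

Lemma continuous_opnormP f : continuous f <->
  forall t (e : R), 0 < e -> exists2 d : R, 0 < d &
    forall s, `|set_val s - set_val t| < d -> opnorm (f s - f t) < e.
Proof.
split=> [cf t e e0|cf t U].
  pose e' := e / (n.+1 * n.+1 * 2)%:R.
  have e'0 : 0 < e' by rewrite divr_gt0// ltr0n.
  have e'C : 0 < ((e')%:C)%C :> Cx R by rewrite ltcR.
  have := cf t (ball (f t) ((e')%:C)%C) (nbhsx_ballx _ _ e'C).
  rewrite nbhs_simpl/= => /nbhs_ballP[d /= d0 dU]; exists d => // s st.
  have /dU/= fts : ball t d s by rewrite -initial_ballE /= /ball/= distrC.
  apply: (le_lt_trans (opnorm_le_sum _)).
  apply: (@le_lt_trans _ _ (\sum_(i < n.+1) \sum_(j < n.+1) e')); last first.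
    rewrite !sumr_const !card_ord -!mulrnA -mulr_natr /e' natrM invfM mulrA.
    by rewrite mulrAC divfK ?pnatr_eq0// ltr_pdivrMr// mulr_natr mulr2n ltrDl.
  apply: ler_sum => i _; apply: ler_sum => j _; rewrite !mxE -lecR -normCxE distrC ltW//.
  exact: (fts.2 i j).
move=> /nbhs_ballP[e /= e0 eU].
have eE : e = ((complex.Re e)%:C)%C by rewrite RRe_real// gtr0_real.
have [|d d0 dU] := cf t (complex.Re e); first by rewrite -ltcR -eE.
apply/nbhs_ballP; exists d => //= s ts; apply: eU; split=> // i j.
rewrite /ball/= eE [ltRHS]/= -[`|_|]/(`|_ : R[i]|) normCxE ltcR.
rewrite -opprB modulusN; have /(le_lt_trans _) : opnorm (f s - f t) < complex.Re e.
  by apply: dU; move: ts; rewrite -initial_ballE /= /ball/= distrC.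
by apply; have := modulus_le_opnorm (f s - f t) i j; rewrite !mxE.
Qed.

Lemma opnorm_bounded f : continuous f ->
  has_sup [set opnorm (f t) | t in [set: I01 R]].
Proof.
move=> /continuous_opnormP cf.
have I0x (x : R) : Num.min 1 (Num.max 0 x) \in (`[0%R, 1%R]%classic : set R).
  by rewrite inE/= in_itv/= le_min ge_min le_max !lexx ler01.
pose clamp x : I01 R := exist (fun y => y \in _) _ (I0x x).
have clampE x : set_val (clamp x) = Num.min 1 (Num.max 0 x) by [].
have Lip (x y : R) :
    Num.min 1 (Num.max 0 y) - Num.min 1 (Num.max 0 x) <= `|y - x|.
  have := ler_norm (y - x); have := normr_ge0 (y - x).
  by case: (leP 0 x) => ?; case: (leP 0 y) => ?;
    do ?[case: (leP 1 _) => ?]; lra.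
pose G x := opnorm (f (clamp x)).
have cG : continuous G.
  move=> x; apply/cvgrPdist_lt => e e0.
  have [d d0 dU] := cf (clamp x) e e0.
  near=> y.
  have /dU : `|set_val (clamp y) - set_val (clamp x)| < d.
    rewrite !clampE; apply: (@le_lt_trans _ _ `|y - x|); last first.
      rewrite distrC; near: y; exact: cvgr_dist_lt.
    by rewrite ler_norml lerNl opprB Lip andbT distrC Lip.
  apply: le_lt_trans; rewrite /G.
  have := opnormD (f (clamp y)) (f (clamp x) - f (clamp y)).
  have := opnormD (f (clamp x)) (f (clamp y) - f (clamp x)).
  rewrite !subrKC -(opnormN (f (clamp x) - _)) opprB => h1 h2.
  by rewrite ler_norml lerNl opprB; apply/andP; split; rewrite lerBlDl.
have [c _ cmax] := EVT_max (@ler01 R) (continuous_subspaceT cG).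
split; first by exists (opnorm (f (clamp 0))), (clamp 0).
exists (G c) => _ [t _ <-].
have tI : set_val t \in `[0%R, 1%R] by have := set_valP t; rewrite /=.
rewrite (_ : f t = f (clamp (set_val t))); first exact: cmax.
congr f; apply: val_inj => /=.
by move: tI; rewrite in_itv/= => /andP[t0 t1]; rewrite max_r// min_r.
Unshelve. all: by end_near. Qed.

End continuous_opnorm.

Lemma I01_0_subproof (R : realType) : (0 : R) \in `[0%R, 1%R]%classic.
Proof. by rewrite inE/= in_itv/= lexx ler01. Qed.

Definition I01_0 (R : realType) : I01 R :=
  exist (fun x => x \in _) 0 (I01_0_subproof R).

Definition continuous_mx (R : realType) (n : nat) :
    {pred I01 R -> 'M[Cx R]_n.+1} :=
  fun f => `[< continuous f >].

Section continuous_mx_closed.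
Variables (R : realType) (n : nat).
Local Notation cmx := (@continuous_mx R n).

Lemma continuous_mxP (f : I01 R -> 'M[Cx R]_n.+1) :
  reflect (continuous f) (f \in cmx).
Proof. exact: asboolP. Qed.

Lemma continuous_mxB : {in cmx &, forall f g, f - g \in cmx}.
Proof.
move=> f g /continuous_mxP/continuous_opnormP cf.
move=> /continuous_mxP/continuous_opnormP cg.
apply/continuous_mxP/continuous_opnormP => t e e0.
have e2 : 0 < e / 2 by rewrite divr_gt0.
have [d1 d10 fd] := cf t _ e2; have [d2 d20 gd] := cg t _ e2.
exists (Num.min d1 d2) => [|s]; first by rewrite lt_min d10.
rewrite lt_min => /andP[/fd sf /gd sg].
rewrite (splitr e) (_ : _ - _ = f s - f t + - (g s - g t)); last first.
  by rewrite !fctE !opprD !opprK addrACA.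
by apply: (le_lt_trans (opnormD _ _)); rewrite opnormN ltrD.
Qed.

Lemma continuous_mxM : {in cmx &, forall f g, f * g \in cmx}.
Proof.
move=> f g /continuous_mxP/continuous_opnormP cf.
move=> /continuous_mxP/continuous_opnormP cg.
apply/continuous_mxP/continuous_opnormP => t e e0.
have e2 : 0 < e / 2 by rewrite divr_gt0.
have a0 := opnorm_ge0 (f t); have b0 := opnorm_ge0 (g t).
have a1 : 0 < opnorm (f t) + 1 by rewrite ltr_wpDl.
have b1 : 0 < opnorm (g t) + 1 by rewrite ltr_wpDl.
have [d1 d10 fd] := cf t _ (divr_gt0 e2 b1).
have [d2 d20 gd] := cg t _ (divr_gt0 e2 a1).
have [d3 d30 gd1] := cg t _ (@ltr01 R).
exists (Num.min d1 (Num.min d2 d3)) => [|s]; first by rewrite !lt_min d10 d20.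
rewrite !lt_min => /and3P[/fd sf /gd sg /gd1 sg1].
rewrite (splitr e).
rewrite (_ : _ - _ = (f s - f t) *m g s + f t *m (g s - g t)); last first.
  by rewrite mulmxBl mulmxBr subrKA.
apply: (le_lt_trans (opnormD _ _)); rewrite ltrD//.
  apply: (le_lt_trans (opnormM _ _)).
  apply: (@le_lt_trans _ _ (opnorm (f s - f t) * (opnorm (g t) + 1))).
    rewrite ler_wpM2l ?opnorm_ge0// -[X in opnorm X <= _](subrK (g t)).
    by apply: (le_trans (opnormD _ _)); rewrite addrC lerD2l ltW.
  by rewrite -ltr_pdivlMr.
apply: (le_lt_trans (opnormM _ _)).
apply: (@le_lt_trans _ _ ((opnorm (f t) + 1) * opnorm (g s - g t))).
  by rewrite ler_wpM2r ?opnorm_ge0// lerDl.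
by rewrite mulrC -ltr_pdivlMr.
Qed.

Lemma continuous_mx_cst (A : 'M[Cx R]_n.+1) : cst A \in cmx.
Proof. by apply/continuous_mxP; exact: cst_continuous. Qed.

Lemma continuous_mx_subring : subring_closed cmx.
Proof.
by split; [exact: continuous_mx_cst|exact: continuous_mxB|
           exact: continuous_mxM].
Qed.

HB.instance Definition _ :=
  GRing.isSubringClosed.Build (I01 R -> 'M[Cx R]_n.+1) cmx continuous_mx_subring.

Lemma continuous_mxZ : GRing.scaler_closed cmx.
Proof.
move=> c f cf; rewrite (_ : c *: f = cst c%:M * f).
  exact: (continuous_mxM (continuous_mx_cst _) cf).
by apply/funext => t; exact/esym/mul_scalar_mx.
Qed.

HB.instance Definition _ :=
  GRing.isScaleClosed.Build (Cx R) (I01 R -> 'M[Cx R]_n.+1) cmx continuous_mxZ.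

Lemma continuous_mx_adjoint (f : I01 R -> 'M[Cx R]_n.+1) :
  f \in cmx -> (fun t => adjoint (f t)) \in cmx.
Proof.
move=> /continuous_mxP/continuous_opnormP cf.
apply/continuous_mxP/continuous_opnormP => t e /(cf t)[d d0 fd].
exists d => // s /fd; rewrite -opnorm_adjoint; congr (opnorm _ < _).
by rewrite -scaleN1r !adjointD adjointZ rmorphN1 scaleN1r.
Qed.

End continuous_mx_closed.

(* The algebra C([0,1], M_{n+1}). *)
Record contMx (R : realType) (n : nat) := ContMx {
  contMx_fun :> I01 R -> 'M[Cx R]_n.+1;
  contMx_cont : contMx_fun \in @continuous_mx R n }.

Section contMx_algebra.
Variables (R : realType) (n : nat).
Local Notation CM := (contMx R n).

HB.instance Definition _ := [isSub for @contMx_fun R n].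
HB.instance Definition _ := [Choice of CM by <:].
HB.instance Definition _ := GRing.SubChoice_isSubPzRing.Build _ _ CM (subringClosedP _).
HB.instance Definition _ := [SubZmodule_isSubLmodule of CM by <:].

Lemma contMx_oner_neq0 : (1 : CM) != 0.
Proof.
apply/eqP => /(congr1 val)/(congr1 (@^~ (I01_0 R))) /= /matrixP/(_ 0 0)/eqP.
by rewrite !mxE oner_eq0.
Qed.

HB.instance Definition _ := GRing.PzSemiRing_isNonZero.Build CM contMx_oner_neq0.

Lemma contMx_scalerAl (c : Cx R) (f g : CM) : c *: (f * g) = (c *: f) * g.
Proof. by apply: val_inj; apply/funext => t; exact: (scalemxAl c (f t) (g t)). Qed.

HB.instance Definition _ :=
  GRing.LSemiModule_isLSemiAlgebra.Build (Cx R) CM contMx_scalerAl.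

Lemma contMx_scalerAr (c : Cx R) (f g : CM) : c *: (f * g) = f * (c *: g).
Proof. by apply: val_inj; apply/funext => t; exact: (scalemxAr c (f t) (g t)). Qed.

HB.instance Definition _ :=
  GRing.LSemiAlgebra_isSemiAlgebra.Build (Cx R) CM contMx_scalerAr.

End contMx_algebra.

Section contMx_cstar.
Variables (R : realType) (n : nat).
Local Notation CM := (contMx R n).
Implicit Types f g : CM.

Definition cm_star f : CM := ContMx (continuous_mx_adjoint (contMx_cont f)).

Definition cm_norm f : R := sup [set opnorm (f t) | t in [set: I01 R]].

Lemma contMxP f g : (forall t, f t = g t) -> f = g.
Proof. by move=> fg; apply: val_inj; apply/funext. Qed.

Lemma contMx_continuous f : continuous f.
Proof. by apply/continuous_mxP; exact: contMx_cont. Qed.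

Lemma contMxD f g t : (f + g) t = f t + g t. Proof. by []. Qed.
Lemma contMxM f g t : (f * g) t = f t *m g t. Proof. by []. Qed.
Lemma contMxZ (c : Cx R) f t : (c *: f) t = c *: f t. Proof. by []. Qed.
Lemma cm_starE f t : cm_star f t = adjoint (f t). Proof. by []. Qed.

Lemma opnorm_le_cm_norm f t : opnorm (f t) <= cm_norm f.
Proof.
apply: sup_upper_bound; last by exists t.
exact/opnorm_bounded/contMx_continuous.
Qed.

Lemma cm_norm_le f (c : R) : (forall t, opnorm (f t) <= c) -> cm_norm f <= c.
Proof.
move=> fc; apply: ge_sup; first by exists (opnorm (f (I01_0 R))), (I01_0 R).
by move=> _ [t _ <-].
Qed.

Lemma cm_norm_ge0 f : 0 <= cm_norm f.
Proof. exact: le_trans (opnorm_ge0 _) (opnorm_le_cm_norm f (I01_0 R)). Qed.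

Lemma cm_starK : involutive cm_star.
Proof. by move=> f; apply: contMxP => t; exact: adjointK. Qed.

Lemma cm_starD : {morph cm_star : f g / f + g}.
Proof. by move=> f g; apply: contMxP => t; exact: adjointD. Qed.

Lemma cm_starZ (c : Cx R) f : cm_star (c *: f) = c^* *: cm_star f.
Proof. by apply: contMxP => t; exact: adjointZ. Qed.

Lemma cm_starM f g : cm_star (f * g) = cm_star g * cm_star f.
Proof. by apply: contMxP => t; exact: (adjointM (f t) (g t)). Qed.

Lemma cm_norm0_eq0 f : cm_norm f = 0 -> f = 0.
Proof.
move=> f0; apply: contMxP => t; apply: opnorm0_eq0; apply/eqP.
by rewrite eq_le opnorm_ge0 -f0 opnorm_le_cm_norm.
Qed.

Lemma cm_normD f g : cm_norm (f + g) <= cm_norm f + cm_norm g.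
Proof.
apply: cm_norm_le => t; rewrite contMxD; apply: (le_trans (opnormD _ _)).
by rewrite lerD ?opnorm_le_cm_norm.
Qed.

Lemma cm_normM f g : cm_norm (f * g) <= cm_norm f * cm_norm g.
Proof.
apply: cm_norm_le => t; rewrite contMxM; apply: (le_trans (opnormM _ _)).
by rewrite ler_pM ?opnorm_ge0 ?opnorm_le_cm_norm.
Qed.

Lemma cm_normZ (c : Cx R) f : cm_norm (c *: f) = modulus c * cm_norm f.
Proof.
have le (d : Cx R) g : cm_norm (d *: g) <= modulus d * cm_norm g.
  apply: cm_norm_le => t; rewrite contMxZ opnormZ.
  by rewrite ler_wpM2l ?modulus_ge0 ?opnorm_le_cm_norm.
apply/eqP; rewrite eq_le le/=.
have [->|c0] := eqVneq c 0; first by rewrite modulus0 mul0r cm_norm_ge0.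
have mc : 0 < modulus c.
  by rewrite lt_def modulus_ge0 andbT; apply: contra_neq c0 => /modulus0_eq0.
rewrite -ler_pdivlMl//.
have -> : (modulus c)^-1 = modulus c^-1.
  apply: (mulfI (lt0r_neq0 mc)).
  by rewrite divff ?lt0r_neq0// -modulusM divff// modulus1.
by apply: le_trans (le _ _); rewrite scalerA mulVf// scale1r.
Qed.

Lemma cm_norm_star_mul f : cm_norm (cm_star f * f) = cm_norm f ^+ 2.
Proof.
apply/eqP; rewrite eq_le; apply/andP; split.
  apply: cm_norm_le => t; rewrite contMxM cm_starE opnorm_adjoint_mul.
  by rewrite ler_pXn2r ?nnegrE ?opnorm_ge0 ?cm_norm_ge0// opnorm_le_cm_norm.
have N0 := cm_norm_ge0 (cm_star f * f).
rewrite -[leRHS]sqr_sqrtr// ler_pXn2r ?nnegrE ?cm_norm_ge0 ?sqrtr_ge0//.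
apply: cm_norm_le => t.
rewrite -(ler_pXn2r (ltn0Sn 1)) ?nnegrE ?opnorm_ge0 ?sqrtr_ge0//.
rewrite (sqr_sqrtr N0) -opnorm_adjoint_mul.
exact: (opnorm_le_cm_norm (cm_star f * f) t).
Qed.

Lemma real_cauchy_cvg (u : nat -> R) :
  (forall e : R, 0 < e -> exists N, forall i j, (N <= i)%N -> (N <= j)%N ->
     `|u i - u j| < e) ->
  exists l, forall e : R, 0 < e -> \forall i \near \oo, `|u i - l| < e.
Proof.
move=> cu; have : cvg (u @ \oo).
  apply: cauchy_cvg; apply: cauchy_exP => e /cu[N uN]; exists (u N).
  by exists N => // i /= Ni; apply: uN.
move=> /cvg_ex[l ul]; exists l => e e0.
by have /cvgrPdistC_lt/(_ e e0) := ul.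
Qed.

Lemma Cx_cauchy_cvg (u : nat -> Cx R) :
  (forall e : R, 0 < e -> exists N, forall i j, (N <= i)%N -> (N <= j)%N ->
     modulus (u i - u j) < e) ->
  exists l : Cx R, forall e : R, 0 < e ->
    \forall i \near \oo, modulus (u i - l) < e.
Proof.
move=> cu.
have [e e0|a ua] := @real_cauchy_cvg (fun k => complex.Re (u k)).
  have [N uN] := cu e e0; exists N => i j Ni Nj.
  apply: le_lt_trans (uN i j Ni Nj); apply: le_trans (modulus_Re _).
  by case: (u i) => ? ?; case: (u j) => ? ?.
have [e e0|b ub] := @real_cauchy_cvg (fun k => complex.Im (u k)).
  have [N uN] := cu e e0; exists N => i j Ni Nj.
  apply: le_lt_trans (uN i j Ni Nj); apply: le_trans (modulus_Im _).
  by case: (u i) => ? ?; case: (u j) => ? ?.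
exists (a +i* b)%C => e e0; have e2 : 0 < e / 2 by rewrite divr_gt0.
near=> i; apply: (le_lt_trans (modulus_le _)); rewrite (splitr e) ltrD//.
  apply: (@le_lt_trans _ _ `|complex.Re (u i) - a|); last by near: i; exact: ua.
  by case: (u i).
apply: (@le_lt_trans _ _ `|complex.Im (u i) - b|); last by near: i; exact: ub.
by case: (u i).
Unshelve. all: by end_near. Qed.

Lemma mx_cauchy_cvg (u : nat -> 'M[Cx R]_n.+1) :
  (forall e : R, 0 < e -> exists N, forall i j, (N <= i)%N -> (N <= j)%N ->
     opnorm (u i - u j) < e) ->
  exists l : 'M[Cx R]_n.+1, forall e : R, 0 < e ->
    \forall i \near \oo, opnorm (u i - l) < e.
Proof.
move=> cu.
have entry (p : 'I_n.+1 * 'I_n.+1) : exists l : Cx R, forall e : R, 0 < e ->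
    \forall k \near \oo, modulus (u k p.1 p.2 - l) < e.
  apply: Cx_cauchy_cvg => e /cu[N uN]; exists N => i j Ni Nj.
  apply: le_lt_trans (uN i j Ni Nj).
  by have := modulus_le_opnorm (u i - u j) p.1 p.2; rewrite !mxE.
have [l ul] := choice entry.
exists (\matrix_(i, j) l (i, j)) => e e0.
pose e' := e / (n.+1 * n.+1 * 2)%:R.
have e'0 : 0 < e' by rewrite divr_gt0// ltr0n.
near=> k.
have uk : forall p, modulus (u k p.1 p.2 - l p) < e'.
  by near: k; apply: filter_forall => p; exact: ul.
apply: (le_lt_trans (opnorm_le_sum _)).
apply: (@le_lt_trans _ _ (\sum_(i < n.+1) \sum_(j < n.+1) e')); last first.
  rewrite !sumr_const !card_ord -!mulrnA -mulr_natr /e' natrM invfM mulrA.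
  by rewrite mulrAC divfK ?pnatr_eq0// ltr_pdivrMr// mulr_natr mulr2n ltrDl.
apply: ler_sum => i _; apply: ler_sum => j _; rewrite !mxE ltW//.
exact: (uk (i, j)).
Unshelve. all: by end_near. Qed.

Lemma cm_norm_complete (u : nat -> CM) :
  (forall e : R, 0 < e -> exists N, forall i j, (N <= i)%N -> (N <= j)%N ->
     cm_norm (u i - u j) < e) ->
  exists l : CM, forall e : R, 0 < e -> exists N, forall i, (N <= i)%N ->
     cm_norm (u i - l) < e.
Proof.
move=> cu.
have pt (t : I01 R) : exists l : 'M[Cx R]_n.+1, forall e : R, 0 < e ->
    \forall i \near \oo, opnorm (u i t - l) < e.
  apply: mx_cauchy_cvg => e /cu[N uN]; exists N => i j Ni Nj.
  apply: le_lt_trans (uN i j Ni Nj).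
  exact: (opnorm_le_cm_norm (u i - u j) t).
have [l ul] := choice pt.
have unif (e : R) : 0 < e -> exists N, forall i, (N <= i)%N ->
    forall t, opnorm (u i t - l t) <= e.
  move=> e0; have [N uN] := cu e e0; exists N => i Ni t.
  apply/ler_addgt0Pr => d d0; have [K _ uK] := ul t d d0.
  pose k := maxn N K.
  rewrite -(subrK (u k t) (u i t)) -addrA.
  apply: (le_trans (opnormD _ _)); apply: lerD; apply/ltW.
    apply: le_lt_trans (uN i k Ni (leq_maxl _ _)).
    exact: (opnorm_le_cm_norm (u i - u k) t).
  exact: uK (leq_maxr _ _).
have cl : l \in @continuous_mx R n.
  apply/continuous_mxP/continuous_opnormP => t e e0.
  have e3 : 0 < e / 3 by rewrite divr_gt0.
  have [N /(_ N (leqnn _)) uN] := unif _ e3.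
  have /continuous_opnormP/(_ t _ e3)[d d0 ud] := @contMx_continuous (u N).
  exists d => // s /ud uNs.
  rewrite (_ : l s - l t = - (u N s - l s) + (u N s - u N t) + (u N t - l t)).
    apply: (le_lt_trans (opnormD _ _)).
    rewrite (_ : e = e / 3 + e / 3 + e / 3); last by field.
    apply: ltr_leD (uN t); apply: (le_lt_trans (opnormD _ _)).
    by rewrite opnormN; exact: ler_ltD (uN s) uNs.
  by rewrite opprB !subrKA.
exists (ContMx cl) => e e0; have e2 : 0 < e / 2 by rewrite divr_gt0.
have [N uN] := unif _ e2; exists N => i Ni.
apply: (@le_lt_trans _ _ (e / 2)).
  by apply: cm_norm_le => t; exact: (uN i Ni t).
by rewrite ltr_pdivrMr// mulr_natr mulr2n ltrDl.
Qed.

HB.instance Definition _ := isCStar.Build R CM cm_starK cm_starD cm_starZ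
  cm_starM cm_norm0_eq0 cm_normD cm_normZ cm_normM cm_norm_star_mul
  cm_norm_complete.

End contMx_cstar.

(* Tracial states.  Since [algType] is built on nontrivial rings, the zero
   algebra is not a [cstarAlgType]; it carries no normalized trace anyway. *)
Record is_trace (R : realType) (A : cstarAlgType R) (tau : {scalar A}) : Prop :=
  IsTrace {
    trace_ge0 : forall a : A, 0 <= tau (star a * a);
    trace1 : tau 1 = 1;
    trace_mulC : forall a b : A, tau (a * b) = tau (b * a) }.

Definition faithful (R : realType) (A : cstarAlgType R) (tau : {scalar A}) :=
  forall a : A, tau (star a * a) = 0 -> a = 0.

Record tracialAlg (R : realType) := TracialAlg {
  tr_alg :> cstarAlgType R;
  tr : {scalar tr_alg};
  tr_trace : is_trace tr }.

Record embedding (R : realType) (X Y : tracialAlg R) := Embedding {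
  emb_fun :> {lrmorphism X -> Y};
  emb_star : forall a, emb_fun (star a) = star (emb_fun a);
  emb_tr : forall a, tr Y (emb_fun a) = tr X a;
  emb_inj : injective emb_fun }.

Record cstar_subalgebra (R : realType) (A : cstarAlgType R) (S : set A) : Prop :=
  CStarSubalgebra {
    csub1 : S 1;
    csubD : forall a b, S a -> S b -> S (a + b);
    csubZ : forall (c : Cx R) a, S a -> S (c *: a);
    csubM : forall a b, S a -> S b -> S (a * b);
    csub_star : forall a, S a -> S (star a);
    csub_closed : forall a,
      (forall e : R, 0 < e -> exists2 b, S b & cnorm (a - b) < e) -> S a }.

Definition generates (R : realType) (A : cstarAlgType R) (n : nat)
    (a : n.-tuple A) : Prop :=
  smallest (@cstar_subalgebra R A) [set x | x \in a] = setT.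

(* The language of tracial C*-algebras.  As the trace is complex valued, so are
   the interpretations of the predicate symbols. *)
Variant pred_symbol := Pdist | Ptr.

Definition pred_arity (P : pred_symbol) : nat :=
  match P with Pdist => 2 | Ptr => 1 end.

Definition pred_interp (R : realType) (X : tracialAlg R) (P : pred_symbol) :
    (pred_arity P).-tuple X -> Cx R :=
  match P with
  | Pdist => fun a => ((cnorm (tnth a ord0 - tnth a ord_max))%:C)%C
  | Ptr => fun a => tr X (tnth a ord0)
  end.

Variant fun_symbol (R : realType) :=
  Fadd | Fmul | Fscale of Cx R | Fstar | Fzero | Fone.
Arguments Fadd {R}.
Arguments Fmul {R}.
Arguments Fstar {R}.
Arguments Fzero {R}.
Arguments Fone {R}.

Definition fun_arity (R : realType) (F : fun_symbol R) : nat :=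
  match F with
  | Fadd | Fmul => 2
  | Fscale _ | Fstar => 1
  | Fzero | Fone => 0
  end.

Definition fun_interp (R : realType) (X : tracialAlg R) (F : fun_symbol R) :
    (fun_arity F).-tuple X -> X :=
  match F with
  | Fadd => fun a => tnth a ord0 + tnth a ord_max
  | Fmul => fun a => tnth a ord0 * tnth a ord_max
  | Fscale c => fun a => c *: tnth a ord0
  | Fstar => fun a => star (tnth a ord0)
  | Fzero => fun=> 0
  | Fone => fun=> 1
  end.

Record pointed (R : realType) (n : nat) := Pointed {
  pt_alg :> tracialAlg R;
  pt_tuple : n.-tuple pt_alg }.

(* Classes of structures are plain predicates: [set] lives in a universe too
   small to be applied to [tracialAlg R].  For the same reason a countable
   subset of [pointed_class n] is given below by an enumeration with values in
   an option type (so that the empty subset is allowed). *)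
Section Fraisse.
Variables (R : realType) (K : tracialAlg R -> Prop).

Definition pointed_class (n : nat) (x : pointed R n) : Prop :=
  K x /\ generates (pt_tuple x).

(* [inf set0 = 0] by convention, but under the joint embedding property the set
   below is nonempty. *)
Definition dist_class (n : nat) (x y : pointed R n) : R :=
  inf [set r | exists (Z : tracialAlg R) (f : embedding x Z) (g : embedding y Z),
    K Z /\ r = \big[Num.max/0]_(i < n)
                 cnorm (f (tnth (pt_tuple x) i) - g (tnth (pt_tuple y) i))].

Definition cauchy_class (n : nat) (u : nat -> pointed R n) : Prop :=
  forall e : R, 0 < e -> exists N, forall i j, (N <= i)%N -> (N <= j)%N ->
    dist_class (u i) (u j) < e.

Definition first_block (n m : nat) (x : pointed R (n + m)) : n.-tuple x :=
  [tuple tnth (pt_tuple x) (lshift m i) | i < n].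

Definition append_fun (F : fun_symbol R) (m : nat)
    (x : pointed R (fun_arity F + m)) : pointed R (fun_arity F + m).+1 :=
  Pointed [tuple of rcons (pt_tuple x) (fun_interp (first_block x))].

Definition JEP : Prop := forall A B, K A -> K B ->
  exists C, [/\ K C, inhabited (embedding A C) & inhabited (embedding B C)].

Definition NAP : Prop := forall A B1 B2, K A -> K B1 -> K B2 ->
  forall (phi1 : embedding A B1) (phi2 : embedding A B2)
    (G : set A) (e : R), finite_set G -> 0 < e ->
  exists (C : tracialAlg R) (psi1 : embedding B1 C) (psi2 : embedding B2 C),
    K C /\ forall a, G a -> cnorm (psi1 (phi1 a) - psi2 (phi2 a)) < e.

Definition WPP : Prop := forall n, exists D : nat -> option (pointed R n),
  (forall k y, D k = Some y -> pointed_class y) /\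
  forall x, pointed_class x -> forall e : R, 0 < e ->
    exists k y, D k = Some y /\ dist_class x y < e.

Definition CCP_pred : Prop := forall (P : pred_symbol) (m : nat)
    (u : nat -> pointed R (pred_arity P + m)),
  (forall k, pointed_class (u k)) -> cauchy_class u ->
  forall e : R, 0 < e -> exists N, forall i j, (N <= i)%N -> (N <= j)%N ->
    modulus (pred_interp (first_block (u i)) -
             pred_interp (first_block (u j))) < e.

Definition CCP_fun : Prop := forall (F : fun_symbol R) (m : nat)
    (u : nat -> pointed R (fun_arity F + m)),
  (forall k, pointed_class (u k)) -> cauchy_class u ->
  cauchy_class (fun k => append_fun (u k)).

Definition finitely_generated (X : tracialAlg R) : Prop :=
  exists (n : nat) (a : n.-tuple X), generates a.

Definition Fraisse_class : Prop :=
  [/\ forall X, K X -> finitely_generated X, JEP, NAP, WPP & CCP_pred /\ CCP_fun].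

End Fraisse.

(* Exponents of a formal product of primes; [None] stands for infinity. *)
Definition exponents : Type := {p : nat | prime p} -> option nat.

Definition supernatural (R : realType) (nu : exponents) : Prop :=
  (\esum_(p in [set: {p : nat | prime p}])
     (if nu p is Some k then k%:R%:E else +oo) = +oo :> \bar R)%E.

Definition formally_divides (n : nat) (nu : exponents) : Prop :=
  forall p : {p : nat | prime p},
    if nu p is Some k then (logn (val p) n <= k)%N else true.

(* The matrix size [n.+1] below ranges over the positive natural numbers. *)
Definition class_nu (R : realType) (nu : exponents) (X : tracialAlg R) : Prop :=
  exists (n : nat) (tau : {scalar contMx R n}) (htau : is_trace tau),
    [/\ formally_divides n.+1 nu, faithful tau & X = TracialAlg htau].

(* Main.v *)
From HB Require Import structures.
Require Import Defs.
From mathcomp Require Import all_boot all_order all_algebra.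
From mathcomp Require Import complex perm.
From mathcomp Require Import all_classical all_reals all_analysis.
From mathcomp Require Import ring lra.

(** A faithful trace on C([0,1], M_n) is a faithful positive functional on C([0,1])
    tensored with the normalized trace of M_n.  The quantile map of that functional
    is continuous because the functional is faithful, so it pulls the functional
    back to the Lebesgue mean.  Cutting [0,1] into M intervals and placing the M
    pieces on the diagonal then embeds C([0,1], M_n) into C([0,1], M_L), with the
    Lebesgue trace, for every L = M n; this gives JEP.  For large M each piece has
    small oscillation, so on finitely many elements the embedding is close to a
    representation on constant matrices.  NAP follows because two representations
    into M_L with nearly equal traces are approximately unitarily equivalent: their
    eigenvalue lists are matched in increasing order.  Embeddings are isometric, as a
    faithful trace determines the norm through the moments of a^* a; hence CCP.
    Bernstein polynomials give finite generation.  For WPP, generating tuples are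
    moved into the countably many algebras with Lebesgue trace and sampled there. *)

Set Implicit Arguments.
Unset Strict Implicit.
Unset Printing Implicit Defensive.

Import Order.TTheory GRing.Theory Num.Theory.
Import numFieldNormedType.Exports.

Local Open Scope classical_set_scope.
Local Open Scope ring_scope.

(** * Positive functionals on C([0,1]) and quantiles *)

(** The embeddings in an amalgamation problem are arbitrary, so nothing can be read off from their
    form. They are only composed with the block representations on M_L: the composites are two
    representations of the smaller algebra on one matrix algebra, with traces close to the given one
    on a prescribed finite set. Up to unitary equivalence such a representation is a finite list of
    points of [0,1], the eigenvalues of the coordinate compressed to the corner of the matrix unit
    [e_00], and the trace counts these points. One fact is exact rather than approximate: the corner
    has the same rank in both representations, because 1 is mapped to the identity. This allows the
    matrix units to be intertwined without error. The divergence of the exponents of nu supplies the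
    size L: a single L must be a multiple of both matrix sizes and leave enough blocks on each side
    to make all oscillations small. Taking the Lebesgue trace on every target also leaves only
    countably many targets, indexed by L. *)

Section means.
Variable R : realType.
Implicit Types (x y : R) (f g h q : R -> R) (mu nu : (R -> R) -> R).

(** Positive unital functionals on C([0,1]), written on functions of the real line to avoid a
    function space over a subtype. Positivity is tested on [0,1] alone, which makes the values of a
    continuous function elsewhere irrelevant ([mean_ext]). *)
Record mean mu : Prop := Mean {
  meanD : forall f g, continuous f -> continuous g ->
    mu (fun x => f x + g x) = mu f + mu g;
  meanZ : forall c f, continuous f -> mu (fun x => c * f x) = c * mu f;
  mean_ge0 : forall f, continuous f -> (forall x : R, 0 <= x <= 1 -> 0 <= f x) ->
    0 <= mu f;
  mean1 : mu (fun=> 1) = 1 }.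

Definition faithful_mean mu := forall f, continuous f ->
  (forall x : R, 0 <= x <= 1 -> 0 <= f x) -> mu f = 0 ->
  forall x : R, 0 <= x <= 1 -> f x = 0.

Lemma continuous_add f g :
  continuous f -> continuous g -> continuous (fun x => f x + g x).
Proof. by move=> cf cg x; apply: continuousD; [exact: cf|exact: cg]. Qed.

Lemma continuous_scale (c : R) f : continuous f -> continuous (fun x => c * f x).
Proof. by move=> cf x; apply: continuousM; [exact: cst_continuous|exact: cf]. Qed.

Lemma continuous_sum (I : Type) (r : seq I) (F : I -> R -> R) :
  (forall i, continuous (F i)) -> continuous (fun x => \sum_(i <- r) F i x).
Proof.
move=> cF; elim: r => [|i r IH].
  by under eq_fun do rewrite big_nil; exact: cst_continuous.
by under eq_fun do rewrite big_cons; exact: continuous_add.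
Qed.

Lemma continuous_sub f g :
  continuous f -> continuous g -> continuous (fun x => f x - g x).
Proof. by move=> cf cg x; apply: continuousB; [exact: cf|exact: cg]. Qed.

Lemma continuous_sqr f : continuous f -> continuous (fun x => f x ^+ 2).
Proof.
move=> cf x; under eq_fun do rewrite expr2.
by apply: (@continuousM R R f f x); exact: cf.
Qed.

Section mean_theory.
Variables (mu : (R -> R) -> R) (mmu : mean mu).

Lemma meanB f g : continuous f -> continuous g ->
  mu (fun x => f x - g x) = mu f - mu g.
Proof.
move=> cf cg; rewrite -mulN1r -(meanZ mmu)// -(meanD mmu)//; last exact: continuous_scale.
by congr mu; apply/funext => x; rewrite mulN1r.
Qed.

Lemma mean_lincomb (a b : R) f g h :
  continuous f -> continuous g -> continuous h ->
  mu (fun x => a * f x + b * g x + h x) = a * mu f + b * mu g + mu h.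
Proof.
move=> cf cg ch; have ca := continuous_scale (c := a) cf; have cb := continuous_scale (c := b) cg.
by rewrite (meanD mmu (continuous_add ca cb) ch) (meanD mmu ca cb) !(meanZ mmu).
Qed.

Lemma mean_le f g : continuous f -> continuous g ->
  (forall x : R, 0 <= x <= 1 -> f x <= g x) -> mu f <= mu g.
Proof.
move=> cf cg fg; rewrite -subr_ge0 -meanB//; apply: (mean_ge0 mmu).
  exact: continuous_sub.
by move=> x x01; rewrite subr_ge0 fg.
Qed.

Lemma mean_cst (c : R) : mu (fun=> c) = c.
Proof.
rewrite -[RHS]mulr1 -(mean1 mmu) -(meanZ mmu); last exact: cst_continuous.
by congr mu; apply/funext => x; rewrite mulr1.
Qed.

Lemma mean_ext f g : continuous f -> continuous g ->
  (forall x : R, 0 <= x <= 1 -> f x = g x) -> mu f = mu g.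
Proof.
by move=> cf cg fg; apply/eqP; rewrite eq_le !mean_le// => x x01; rewrite fg.
Qed.

Lemma mean_near f g (e : R) : continuous f -> continuous g ->
  (forall x : R, 0 <= x <= 1 -> `|f x - g x| <= e) -> `|mu f - mu g| <= e.
Proof.
move=> cf cg fg; have cfg := continuous_sub cf cg.
rewrite -meanB// ler_norml -{1}(mean_cst (- e)) -{2}(mean_cst e).
by rewrite !mean_le//; try exact: cst_continuous; move=> x /fg; rewrite ler_norml => /andP[].
Qed.

Lemma mean_sum (I : Type) (r : seq I) (F : I -> R -> R) :
  (forall i, continuous (F i)) ->
  mu (fun x => \sum_(i <- r) F i x) = \sum_(i <- r) mu (F i).
Proof.
move=> cF; elim: r => [|i r IH].
  by rewrite big_nil; under eq_fun do rewrite big_nil; exact: mean_cst.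
rewrite big_cons -IH -(meanD mmu)//; last exact: continuous_sum.
by under eq_fun do rewrite big_cons.
Qed.

End mean_theory.

Lemma mean_comp mu q : mean mu -> continuous q ->
  (forall x, 0 <= x <= 1 -> 0 <= q x <= 1) -> mean (fun h => mu (h \o q)).
Proof.
move=> mmu cq q01.
have cc h : continuous h -> continuous (h \o q).
  by move=> ch x; apply: continuous_comp; [exact: cq|exact: ch].
split => [f g cf cg|c f cf|f cf f0|]; last exact: (mean1 mmu).
- by rewrite -(meanD mmu); [|exact: cc|exact: cc].
- by rewrite -(meanZ mmu)//; exact: cc.
- by apply: (mean_ge0 mmu) => [|x x01]; [exact: cc|exact/f0/q01].
Qed.

Definition antiderivative (f G : R -> R) :=
  forall x : R, 0 <= x <= 1 -> is_derive x (1 : R) G (f x).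

(** The lower limit -1, like the window [-1, 2] in [primitiveP], makes 0 and 1 interior points,
    where the fundamental theorem of calculus gives two-sided derivatives. *)
Definition primitive f : R -> R :=
  fun x => \int[lebesgue_measure]_(t in `[-1, x]) f t.

Lemma primitiveP f : continuous f -> antiderivative f (primitive f).
Proof.
move=> cf x /andP[x0 x1].
have iF : (@lebesgue_measure R).-integrable `[-1, 2] (EFin \o f).
  by apply: continuous_compact_integrable; [exact: segment_compact|exact: continuous_subspaceT].
have x2 : x < 2 by apply: le_lt_trans x1 _; rewrite ltr1n.
have [|dF F'] := @continuous_FTC1 R f (BLeft (-1)) x 2 x2 iF _ (cf x).
  by rewrite lte_fin (lt_le_trans _ x0)// ltrN10.
by apply: DeriveDef; [exact: dF|rewrite -derive1E].
Qed.

Lemma antiderivative_le f g F G (a b : R) : 0 <= a -> a <= b -> b <= 1 ->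
  antiderivative f F -> antiderivative g G ->
  (forall x, a <= x <= b -> f x <= g x) -> F b - F a <= G b - G a.
Proof.
move=> a0 ab b1 dF dG fg.
have d x : a <= x <= b -> is_derive x (1 : R) (G - F) (g x - f x).
  move=> /andP[ax xb].
  have x01 : 0 <= x <= 1 by rewrite (le_trans a0 ax) (le_trans xb b1).
  by have := dF x x01; have := dG x x01 => ? ?; exact: is_deriveB.
have [x||c cab] := MVT_segment ab (f := G - F) (df := g \- f).
- by rewrite in_itv/= => /andP[ax xb]; apply: d; rewrite !ltW.
- apply: derivable_within_continuous => x; rewrite in_itv/= => xab.
  by have := d x xab => ?; exact: ex_derive.
rewrite -subr_ge0 (_ : G b - G a - (F b - F a) = (G - F) b - (G - F) a); last first.
  by rewrite !fctE; ring.
move=> ->; rewrite mulr_ge0 ?subr_ge0// fg//.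
Qed.

(** The Lebesgue mean over [0,1]. As an increment of a primitive it is accessible to the mean value
    theorem, and [lamE] lets any other antiderivative compute it. *)
Definition lam f : R := primitive f 1 - primitive f 0.

Lemma lamE f G : continuous f -> antiderivative f G -> lam f = G 1 - G 0.
Proof.
move=> cf fG; have fP := primitiveP cf.
by apply/eqP; rewrite eq_le !(antiderivative_le _ _ _ fP fG, antiderivative_le _ _ _ fG fP).
Qed.

Lemma lam_mean : mean lam.
Proof.
split.
- move=> f g cf cg; rewrite (@lamE _ (primitive f + primitive g)); last 2 first.
  + exact: continuous_add.
  + by move=> x x01; have := primitiveP cf x01; have := primitiveP cg x01 => ? ?; exact: is_deriveD.
  by rewrite /lam !fctE; ring.
- move=> c f cf; rewrite (@lamE _ (c \*: primitive f)); last 2 first.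
  + exact: continuous_scale.
  + by move=> x x01; have := primitiveP cf x01 => ?; exact: is_deriveZ.
  by rewrite /lam /= !/(_ *: _)/=; ring.
- move=> f cf f0; have fP := primitiveP cf.
  have d0 : antiderivative (fun=> 0) (cst 0) by move=> x _; exact: is_derive_cst.
  rewrite -(subrr 0); apply: (antiderivative_le (lexx 0) ler01 (lexx 1) d0 fP).
  by move=> x; exact: f0.
- rewrite (@lamE _ id) ?subr0//; first exact: cst_continuous.
  by move=> x _; exact: is_derive_id.
Qed.

Lemma lam_ge_itv f (a b c : R) : 0 <= a -> a <= b -> b <= 1 -> continuous f ->
  (forall x : R, 0 <= x <= 1 -> 0 <= f x) -> (forall x, a <= x <= b -> c <= f x) ->
  c * (b - a) <= lam f.
Proof.
move=> a0 ab b1 cf f0 fc; have fP := primitiveP cf.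
have d0 : antiderivative (fun=> 0) (cst 0) by move=> x _; exact: is_derive_cst.
have dc : antiderivative (fun=> c) (c \*: id).
  by move=> x _; rewrite -[c in is_derive _ _ _ c]mulr1; exact: is_deriveZ.
have := antiderivative_le a0 ab b1 dc fP fc.
have b01 := le_trans a0 ab.
have /= := antiderivative_le b01 b1 (lexx 1) d0 fP.
have /= := antiderivative_le (lexx 0) a0 (le_trans ab b1) d0 fP.
rewrite !/(_ *: _)/= subrr /lam => h1 h2 h3.
have : 0 <= primitive f a - primitive f 0.
  by apply: h1 => x /andP[x0 xa]; rewrite f0// x0 (le_trans xa)// (le_trans ab).
have : 0 <= primitive f 1 - primitive f b.
  by apply: h2 => x /andP[xb x1]; rewrite f0// x1 (le_trans _ xb).
by lra.
Qed.

Lemma lam_faithful : faithful_mean lam.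
Proof.
move=> f cf f0 lf x x01; apply/eqP; rewrite eq_le f0// andbT leNgt; apply/negP => fx.
have := cf x; move=> /cvgrPdist_lt/(_ (f x / 2)) -/(_ (divr_gt0 fx (ltr0Sn _ 1))).
move=> /nbhs_ballP[d /= d0 dU].
have fd y : `|x - y| < d -> f x / 2 <= f y.
  by move=> /dU /=; rewrite ltr_norml => /andP[_]; lra.
pose a := Num.max 0 (x - d / 2); pose b := Num.min 1 (x + d / 2).
have ab : a < b by rewrite gt_max !lt_min; move: x01; lra.
have a0 : 0 <= a by rewrite le_max lexx.
have b1 : b <= 1 by rewrite ge_min lexx.
have := lam_ge_itv a0 (ltW ab) b1 cf f0 (c := f x / 2); rewrite lf.
have : 0 < f x / 2 * (b - a) by rewrite mulr_gt0 ?subr_gt0// divr_gt0.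
move=> h1 h2; move: h1; rewrite ltNge h2// => y /andP[].
rewrite ge_max le_min => /andP[_ h3] /andP[_ h4]; apply: fd.
by rewrite ltr_norml; lra.
Qed.

(** The substitution x = (m + s) / (M + 1) on each piece, followed by telescoping. This identity is
    why placing the pieces on the diagonal preserves the trace. *)
Lemma lam_split (M : nat) f : continuous f ->
  lam f = M.+1%:R^-1 * \sum_(m < M.+1) lam (fun s => f ((m%:R + s) / M.+1%:R)).
Proof.
move=> cf; have fP := primitiveP cf; pose N : R := M.+1%:R.
have N0 : 0 < N by rewrite ltr0n.
have step (m : 'I_M.+1) : lam (fun s => f ((m%:R + s) / N)) =
    N * (primitive f (m.+1%:R / N) - primitive f (m%:R / N)).
  pose q (s : R) := (m%:R + s) / N.
  have q01 (x : R) : 0 <= x <= 1 -> 0 <= q x <= 1.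
    move=> /andP[x0 x1]; apply/andP; split; first by rewrite /q divr_ge0 ?addr_ge0// ltW.
    rewrite /q ler_pdivrMr// mul1r.
    by rewrite (@le_trans _ _ (m%:R + 1))// ?lerD2l// natr1 ler_nat.
  have cq : continuous q.
    by move=> x; apply: continuousM; [apply: continuousD => //; exact: cst_continuous|exact: cst_continuous].
  rewrite (@lamE _ (N \*: (primitive f \o q))) /=.
  - by rewrite /q addr0 natr1 !/(_ *: _)/= -mulrBr.
  - by move=> x; apply: continuous_comp; [exact: cq|exact: cf].
  - move=> x x01; have := fP _ (q01 x x01) => ?.
    have dq : is_derive x (1 : R) q (N^-1).
      rewrite (_ : q = cst (m%:R / N) \+ (N^-1 \*: id)); last first.
        by apply/funext => y; rewrite /q /= /(_ *: _)/= mulrDl [y * _]mulrC.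
      rewrite -[X in is_derive _ _ _ X]add0r -[X in 0 + X]mulr1.
      by apply: is_deriveD.
    have := @is_derive1_comp R (primitive f) q x (f (q x)) N^-1 _ _ => d.
    rewrite (_ : f _ = N *: (f (q x) * N^-1)); last by rewrite /(_ *: _)/= mulrCA divff ?mulr1 ?gt_eqF.
    exact: is_deriveZ.
under eq_bigr do rewrite step.
rewrite -mulr_sumr mulrA mulVf ?gt_eqF// mul1r.
have -> : \sum_(m < M.+1) (primitive f (m.+1%:R / N) - primitive f (m%:R / N)) =
    \sum_(0 <= m < M.+1) (primitive f (m.+1%:R / N) - primitive f (m%:R / N)).
  by rewrite big_mkord.
by rewrite telescope_sumr// /lam mul0r divff// gt_eqF.
Qed.

End means.

Section quantile.
Variable R : realType.
Implicit Types (a b c d s t x y e : R) (h : R -> R) (mu nu : (R -> R) -> R).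

(** For a < b, a continuous stand-in for the indicator of (-oo, a]; means are compared through their
    values on such functions. *)
Definition ramp a b : R -> R := fun x => Num.min 1 (Num.max 0 ((b - x) / (b - a))).

Lemma continuous_clamp (f : R -> R) :
  continuous f -> continuous (fun x => Num.min 1 (Num.max 0 (f x))).
Proof.
move=> cf x; apply: (@continuous_min R R (fun=> 1) (fun x => Num.max 0 (f x))).
  exact: cst_continuous.
by apply: (@continuous_max R R (fun=> 0) f); [exact: cst_continuous|exact: cf].
Qed.

Lemma ramp_continuous a b : continuous (ramp a b).
Proof.
have cf : continuous (fun x => (b - x) / (b - a)).
  under eq_fun do rewrite mulrC; apply: continuous_scale.
  apply: continuous_sub => [|x]; [exact: cst_continuous|exact: cvg_id].
exact: continuous_clamp cf.
Qed.

Lemma ramp_ge0 a b x : 0 <= ramp a b x.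
Proof. by rewrite /ramp le_min ler01 le_max lexx. Qed.

Lemma ramp_le1 a b x : ramp a b x <= 1.
Proof. by rewrite /ramp ge_min lexx. Qed.

Lemma ramp1 a b x : a < b -> x <= a -> ramp a b x = 1.
Proof.
move=> ab xa; rewrite /ramp min_l// le_max ler_pdivlMr ?subr_gt0// mul1r.
by rewrite lerD2l lerN2 xa orbT.
Qed.

Lemma ramp0 a b x : a < b -> b <= x -> ramp a b x = 0.
Proof.
move=> ab bx; rewrite /ramp max_l ?min_r//.
by rewrite ler_pdivrMr ?subr_gt0// mul0r subr_le0.
Qed.

Lemma ramp_le a b c d x : a < b -> b <= c -> c < d -> ramp a b x <= ramp c d x.
Proof.
move=> ab bc cd; have [xc|cx] := leP x c; first by rewrite (ramp1 cd)// ramp_le1.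
by rewrite (ramp0 ab) ?ramp_ge0// (le_trans bc)// ltW.
Qed.

(** Piecewise linear interpolation at the nodes i / (N + 1), put by Abel summation into the form of
    a combination of ramps. *)
Definition interp (N : nat) h : R -> R := fun x =>
  h 1 + \sum_(i < N.+1) (h (i%:R / N.+1%:R) - h (i.+1%:R / N.+1%:R)) *
                      ramp (i%:R / N.+1%:R) (i.+1%:R / N.+1%:R) x.

Lemma node_lt (N i j : nat) : (i < j)%N -> i%:R / N.+1%:R < j%:R / N.+1%:R :> R.
Proof. by move=> ij; rewrite ltr_pM2r ?invr_gt0 ?ltr0n// ltr_nat. Qed.

Lemma node_le (N i j : nat) : (i <= j)%N -> i%:R / N.+1%:R <= j%:R / N.+1%:R :> R.
Proof. by move=> ij; rewrite ler_pM2r ?invr_gt0 ?ltr0n// ler_nat. Qed.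

Lemma node_itv (N i : nat) : (i <= N.+1)%N -> 0 <= (i%:R / N.+1%:R : R) <= 1.
Proof. by move=> iN; rewrite divr_ge0//= ler_pdivrMr ?ltr0n// mul1r ler_nat. Qed.

Lemma interp_continuous N h : continuous (interp N h).
Proof.
apply: continuous_add; first exact: cst_continuous.
apply: continuous_sum => i; apply: continuous_scale; exact: ramp_continuous.
Qed.

(** Only the ramp of the cell containing x can lie strictly between 0 and 1: earlier ones vanish,
    later ones equal 1 and telescope. What remains is a convex combination of the values at the two
    ends of the cell. *)
Lemma interp_near N h (e : R) x : 0 <= x <= 1 ->
  (forall s t, 0 <= s <= 1 -> 0 <= t <= 1 -> `|s - t| <= 2 / N.+1%:R -> `|h s - h t| <= e) ->
  `|h x - interp N h x| <= e.
Proof.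
move=> /andP[x0 x1] he; have N0 : 0 < N.+1%:R :> R by rewrite ltr0n.
pose k := `|Num.floor (x * N.+1%:R)|%N.
have xN0 : 0 <= x * N.+1%:R by rewrite mulr_ge0.
have kx : k%:R <= x * N.+1%:R < k.+1%:R.
  have := floor_itv (x * N.+1%:R).
  have : (0 <= Num.floor (x * N.+1%:R))%R by rewrite floor_ge0.
  rewrite /k; case: Num.floor => // m _.
  by rewrite intrD => /andP[h1 h2]; apply/andP; split; [exact: h1|rewrite -[`|Posz m|%N.+1%:R]natr1; exact: h2].
have kN : (k <= N.+1)%N.
  rewrite -(ler_nat R); move: kx => /andP[h1 _]; apply: (le_trans h1).
  by rewrite ler_piMl.
pose F i := h (i%:R / N.+1%:R); pose r i := ramp (i%:R / N.+1%:R) (i.+1%:R / N.+1%:R) x.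
have rN i : (k < i)%N -> r i = 1.
  move=> ki; rewrite /r ramp1 ?node_lt// ler_pdivlMr//.
  by case/andP: kx => _ /ltW/le_trans; apply; rewrite ler_nat.
have r0 i : (i < k)%N -> r i = 0.
  move=> ki; rewrite /r ramp0 ?node_lt// ler_pdivrMr//.
  by case/andP: kx => + _; apply: le_trans; rewrite ler_nat.
have -> : interp N h x = F N.+1 + \sum_(0 <= i < N.+1) (F i - F i.+1) * r i.
  by rewrite /interp big_mkord /F divff ?gt_eqF.
have tele (a b : nat) : (a <= b)%N -> \sum_(a <= i < b) (F i - F i.+1) = F a - F b.
  move=> ab; rewrite -[RHS]opprB -telescope_sumr// -sumrN.
  by apply: eq_bigr => i _; rewrite opprB.
have dF j : (k <= j <= k.+1)%N -> (j <= N.+1)%N -> `|h x - F j| <= e.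
  move=> kj jN; apply: he; rewrite ?x0 ?x1 ?node_itv//.
  rewrite -{1}[x](mulfK (lt0r_neq0 N0)) -mulrBl normrM normfV (gtr0_norm N0).
  rewrite ler_pM2r ?invr_gt0//.
  have : k%:R <= (j%:R : R) <= k.+1%:R by rewrite !ler_nat.
  by move: kx; rewrite -[k.+1%:R]natr1 ler_norml; lra.
have [kN1|Nk] := leqP k.+1 N.+1; last first.
  (* This is the endpoint x = 1, where all ramps have vanished. *)
  have kE : k = N.+1 by apply/eqP; rewrite eqn_leq kN.
  rewrite big_nat big1 ?addr0 -?kE ?dF ?leqnn ?leqnSn//.
  by move=> i /andP[_ ik]; rewrite r0// mulr0.
rewrite (big_cat_nat (n := k)) ?leq0n//= big_nat big1 ?add0r; last first.
  by move=> i /andP[_ ik]; rewrite r0// mulr0.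
rewrite big_ltn// big_nat (eq_bigr (fun i => F i - F i.+1)); last first.
  by move=> i /andP[ki _]; rewrite rN// mulr1.
rewrite -big_nat tele//.
have rk : 0 <= r k <= 1 by rewrite ramp_ge0 ramp_le1.
have := dF k; rewrite leqnn leqnSn kN => /(_ isT isT).
have := dF k.+1; rewrite leqnn leqnSn kN1 => /(_ isT isT).
rewrite !ler_norml; nra.
Qed.

(** Stated for an abstract pseudodistance, so that one compactness argument serves real functions,
    matrix-valued functions and their composites with a path. *)
Lemma uniform_pdist (D : R -> R -> R) :
  (forall s t, D s t = D t s) -> (forall s t u, D s u <= D s t + D t u) ->
  (forall s e, 0 < e -> \forall t \near s, D s t <= e) ->
  forall e, 0 < e -> exists2 d : R, 0 < d &
    forall s t, 0 <= s <= 1 -> 0 <= t <= 1 -> `|s - t| <= d -> D s t <= e.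
Proof.
move=> Dsym Dtri cD e e0; have /compact_near_coveringP K := @segment_compact R 0 1.
have [x _|d /= d0 dU] := K R (0 : R)^'+ (fun d t => forall s, `|s - t| <= d -> D s t <= e) _.
  have /nbhs_ballP[d /= d0 dU] := cD x (e / 2) (divr_gt0 e0 (ltr0Sn _ _)).
  near=> y i => s sy.
  have i2 : i < d / 2.
    by near: i; apply: nbhs_right_lt; rewrite divr_gt0.
  have xy : `|x - y| < d / 2 by near: y; apply: cvgr_dist_lt; rewrite ?divr_gt0.
  have h1 : D x s <= e / 2.
    by apply: dU; rewrite -ball_normE /=; move: sy xy; rewrite /= !ltr_norml ler_norml; lra.
  have h2 : D x y <= e / 2.
    by apply: dU; rewrite -ball_normE /= (lt_trans xy)//; lra.
  have := Dtri s x y; rewrite (Dsym s x); move: h1 h2 => /=; lra.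
exists (d / 2); first by rewrite divr_gt0.
move=> s t _ t01 st; apply: (dU (d / 2)) => //=.
- by rewrite sub0r normrN gtr0_norm ?divr_gt0//; lra.
- by rewrite divr_gt0.
Unshelve. all: by end_near. Qed.

Lemma uniform_cont h : continuous h -> forall e : R, 0 < e ->
  exists2 d : R, 0 < d & forall s t, 0 <= s <= 1 -> 0 <= t <= 1 -> `|s - t| <= d -> `|h s - h t| <= e.
Proof.
move=> ch; apply: (uniform_pdist (D := fun s t => `|h s - h t|)).
- by move=> s t; rewrite distrC.
- by move=> s t u; exact: ler_distD.
- by move=> s e e0; have /cvgrPdist_le/(_ e e0) := ch s.
Qed.

Lemma archi_inv (e : R) : 0 < e -> exists N : nat, forall M : nat, (N <= M)%N -> M.+1%:R^-1 <= e.
Proof.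
move=> e0; exists (Num.trunc e^-1) => M NM.
rewrite invf_ple ?posrE ?ltr0n//; apply: (le_trans (ltW (truncnS_gt _))).
by rewrite ler_nat.
Qed.

(* Approximate by piecewise linear interpolation: the differences of the values
   on the ramps are at most the increments of a bounded monotone sequence. *)
Lemma mean_eq mu nu : mean mu -> mean nu ->
  (forall a b c, 0 <= a -> a < b -> b < c -> b <= 1 -> mu (ramp a b) <= nu (ramp b c)) ->
  (forall a b c, 0 <= a -> a < b -> b < c -> b <= 1 -> nu (ramp a b) <= mu (ramp b c)) ->
  forall h, continuous h -> mu h = nu h.
Proof.
move=> mmu mnu mn nm h ch; apply/eqP; rewrite -subr_eq0 -normr_le0.
apply/ler_addgt0Pr => e e0; rewrite add0r.
have e4 : 0 < e / 4 by rewrite divr_gt0.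
have [d d0 dh] := uniform_cont ch e4.
have [N /(_ N (leqnn _)) Nd] := archi_inv (divr_gt0 d0 (ltr0Sn R 1)).
have he s t : 0 <= s <= 1 -> 0 <= t <= 1 -> `|s - t| <= 2 / N.+1%:R -> `|h s - h t| <= e / 4.
  by move=> s01 t01 st; apply: dh => //; apply: (le_trans st); move: Nd; move: (_^-1) => w; lra.
pose r i := ramp (i%:R / N.+1%:R) (i.+1%:R / N.+1%:R).
have interpE m : mean m -> m (interp N h) =
    h 1 + \sum_(i < N.+1) (h (i%:R / N.+1%:R) - h (i.+1%:R / N.+1%:R)) * m (r i).
  move=> mm; rewrite /interp (meanD mm); last 2 first.
  - exact: cst_continuous.
  - by apply: continuous_sum => i; apply: continuous_scale; exact: ramp_continuous.
  rewrite mean_cst//; congr (_ + _).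
  rewrite (mean_sum mm _ (F := fun (i : 'I_N.+1) x => _ * r i x)); last first.
    by move=> i; apply: continuous_scale; exact: ramp_continuous.
  by apply: eq_bigr => i _; rewrite (meanZ mm)//; exact: ramp_continuous.
have near m : mean m -> `|m h - m (interp N h)| <= e / 4.
  by move=> mm; apply: mean_near => //; [exact: interp_continuous|move=> x x01; exact: interp_near].
have rlt i : i%:R / N.+1%:R < i.+1%:R / N.+1%:R :> R by rewrite node_lt.
have rmono m i : mean m -> m (r i) <= m (r i.+1).
  move=> mm; apply: mean_le => //; [exact: ramp_continuous|exact: ramp_continuous|].
  by move=> x _; apply: ramp_le; rewrite ?rlt.
(* The values of [mu] on the ramps, shifted by one index. Both [mu (r i)] and [nu (r i)] lie between
   [rho i] and [rho i.+2], and these differences telescope to at most 2. *)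
pose rho i : R := if i is j.+1 then mu (r j) else 0.
have node0 i : 0 <= i%:R / N.+1%:R :> R by rewrite divr_ge0.
have mu01 i : 0 <= mu (r i) <= 1.
  apply/andP; split.
    by apply: (mean_ge0 mmu) => [|x _]; [exact: ramp_continuous|exact: ramp_ge0].
  rewrite -[leRHS](mean1 mmu); apply: mean_le => //; [exact: ramp_continuous|exact: cst_continuous|].
  by move=> x _; exact: ramp_le1.
have nu0 i : 0 <= nu (r i).
  by apply: (mean_ge0 mnu) => [|x _]; [exact: ramp_continuous|exact: ramp_ge0].
have rhomono i : rho i <= rho i.+1.
  by case: i => [|i] /=; [have /andP[] := mu01 0%N|exact: rmono].
have mundiff i : (i < N.+1)%N -> `|mu (r i) - nu (r i)| <= rho i.+2 - rho i.
  move=> iN.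
  have i1 : i.+1%:R / N.+1%:R <= 1 :> R by rewrite ler_pdivrMr ?ltr0n// mul1r ler_nat.
  have h1 : nu (r i) <= rho i.+2 by apply: nm.
  have h2 : rho i <= nu (r i).
    case: i iN i1 {h1} => [//|i] iN i1 /=; apply: mn => //.
    by apply: le_trans i1; rewrite node_le.
  have h3 : rho i <= mu (r i) by exact: rhomono.
  have h4 : mu (r i) <= rho i.+2 by exact: (rhomono i.+1).
  by rewrite ler_norml; lra.
have : `|mu (interp N h) - nu (interp N h)| <= e / 4 * 2.
  rewrite !interpE// opprD addrACA subrr add0r -sumrB.
  apply: (le_trans (ler_norm_sum _ _ _)).
  apply: (@le_trans _ _ (\sum_(i < N.+1) e / 4 * (rho i.+2 - rho i))).
    apply: ler_sum => i _; rewrite -mulrBr normrM ler_pM ?normr_ge0 ?mundiff//.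
    apply: he; rewrite ?node_itv ?(ltnW (ltn_ord i))//.
    rewrite -mulrBl -natr1 opprD addrA subrr sub0r mulN1r normrN gtr0_norm ?invr_gt0 ?ltr0n//.
    by rewrite ler_peMl ?invr_ge0// ler1n.
  rewrite -mulr_sumr ler_wpM2l ?(ltW e4)//.
  have -> : \sum_(i < N.+1) (rho i.+2 - rho i) = \sum_(0 <= i < N.+1) ((rho i.+2 + rho i.+1) - (rho i.+1 + rho i)).
    by rewrite big_mkord; apply: eq_bigr => i _; ring.
  rewrite telescope_sumr//=.
  by have := mu01 0%N; have := mu01 N.+1; have := mu01 N; lra.
have := near _ mmu; have := near _ mnu.
by rewrite !ler_norml; lra.
Qed.

End quantile.

(** * The quantile map of a faithful mean *)

Section quantile_map.
Variables (R : realType) (mu : (R -> R) -> R).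
Hypotheses (mmu : mean mu) (fmu : faithful_mean mu).
Implicit Types (a b c d s t x : R).

(** The distribution function of the measure behind [mu], obtained without that measure as an
    infimum over continuous majorants of the indicator of (-oo, a]. *)
Definition cdf a : R := inf [set mu (ramp a (a + d)) | d in [set d | 0 < d]].

Lemma cdf_le_ramp a b : a < b -> cdf a <= mu (ramp a b).
Proof.
move=> ab; apply: ge_inf; last by exists (b - a); rewrite /= ?subr_gt0// subrKC.
exists 0 => _ [d /= d0 <-]; apply: (mean_ge0 mmu) => [|x _]; first exact: ramp_continuous.
exact: ramp_ge0.
Qed.

Lemma ramp_le_cdf a b : a < b -> mu (ramp a b) <= cdf b.
Proof.
move=> ab; apply: lb_le_inf; first by exists (mu (ramp b (b + 1))), 1 => //=.
move=> _ [d /= d0 <-]; apply: mean_le => //; [exact: ramp_continuous|exact: ramp_continuous|].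
by move=> x _; apply: ramp_le => //; rewrite ltrDl.
Qed.

(** With c the midpoint, [ramp c b - ramp a c] is nonnegative and equals 1 at c, so a faithful mean
    is positive on it. *)
Lemma cdf_lt a b : 0 <= a -> a < b -> b <= 1 -> cdf a < cdf b.
Proof.
move=> a0 ab b1; pose c := (a + b) / 2.
have ac : a < c by rewrite /c; lra.
have cb : c < b by rewrite /c; lra.
apply: (le_lt_trans (cdf_le_ramp ac)); apply: lt_le_trans (ramp_le_cdf cb).
have c1 := @ramp_continuous R c b; have c2 := @ramp_continuous R a c.
rewrite lt_neqAle mean_le ?andbT//; last by move=> x _; exact: ramp_le.
apply/eqP => E; have := fmu (continuous_sub c1 c2) _ _ (x := c).
rewrite meanB// E subrr ramp1// ramp0// subr0 => h.
have : 1 = 0 :> R; last by move/eqP; rewrite oner_eq0.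
apply: h => //; first by move=> x _; rewrite subr_ge0 ramp_le.
by rewrite (le_trans a0) ?(le_trans _ b1)// ltW.
Qed.

Lemma cdf_itv a : 0 <= cdf a <= 1.
Proof.
apply/andP; split.
  apply: lb_le_inf; first by exists (mu (ramp a (a + 1))), 1 => //=.
  move=> _ [d /= d0 <-]; apply: (mean_ge0 mmu) => [|x _]; first exact: ramp_continuous.
  exact: ramp_ge0.
have a1 : a < a + 1 by rewrite ltrDl.
apply: (le_trans (cdf_le_ramp a1)); rewrite -[leRHS](mean1 mmu).
apply: mean_le => //; [exact: ramp_continuous|exact: cst_continuous|].
by move=> x _; exact: ramp_le1.
Qed.

(** The alternative [t = 0] keeps the set nonempty when s is below [cdf 0], for instance when [mu]
    has an atom at 0. *)
Let below s := [set t | 0 <= t <= 1 /\ (t = 0 \/ cdf t <= s)].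

Definition quantile s : R := sup (below s).

Let below_has_sup s : has_sup (below s).
Proof.
split; first by exists 0; split; [rewrite lexx ler01|left].
by exists 1 => t [/andP[]].
Qed.

Lemma quantile_ge s t : 0 <= t <= 1 -> cdf t <= s -> t <= quantile s.
Proof.
by move=> t01 ts; apply: sup_upper_bound; [exact: below_has_sup|split => //; right].
Qed.

Lemma quantile_le s t : 0 <= t -> s <= cdf t -> quantile s <= t.
Proof.
move=> t0 st; apply: ge_sup; first by have [] := below_has_sup s.
move=> u [/andP[u0 u1] [->//|us]]; rewrite leNgt; apply/negP => tu.
by have := cdf_lt t0 tu u1; rewrite ltNge (le_trans us).
Qed.

Lemma quantile_itv s : 0 <= quantile s <= 1.
Proof.
apply/andP; split.
  by apply: sup_upper_bound; [exact: below_has_sup|split; [rewrite lexx ler01|left]].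
by apply: ge_sup; [have [] := below_has_sup s|move=> t [/andP[]]].
Qed.

(** A jump of the quantile would be a flat piece of [cdf], which strict monotonicity excludes; atoms
    of [mu] only produce flat pieces of the quantile. *)
Lemma quantile_continuous : continuous quantile.
Proof.
move=> s0; apply/cvgrPdist_le => e e0.
have /andP[Q0 Q1] := quantile_itv s0.
have up : \forall s \near s0, quantile s <= quantile s0 + e.
  have [h|h] := leP 1 (quantile s0 + e).
    by near=> s; apply: le_trans h; have /andP[] := quantile_itv s.
  have h0 : 0 <= quantile s0 + e by rewrite addr_ge0// ltW.
  have lt : s0 < cdf (quantile s0 + e).
    rewrite ltNge; apply/negP => /quantile_ge; rewrite h0 (ltW h) => /(_ isT).
    by rewrite gerDl leNgt e0.
  near=> s; apply: quantile_le => //; apply: ltW.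
  by near: s; apply: (cvgr_lt s0) => //; exact: cvg_id.
have dn : \forall s \near s0, quantile s0 - e <= quantile s.
  have [h|h] := leP (quantile s0 - e) 0.
    by near=> s; apply: (le_trans h); have /andP[] := quantile_itv s.
  have [t [/andP[t0 t1] [tE|ts]] tQ] := sup_adherent e0 (below_has_sup s0).
    by move: tQ; rewrite -/(quantile s0) tE ltNge ltW.
  have lt : cdf (quantile s0 - e) < s0.
    by apply: lt_le_trans ts; apply: cdf_lt => //; exact: ltW.
  near=> s; apply: quantile_ge; first by rewrite ltW//= (le_trans _ Q1)// gerBl ltW.
  by apply: ltW; near: s; apply: (cvgr_gt s0) => //; exact: cvg_id.
near=> s; rewrite ler_norml.
have : quantile s <= quantile s0 + e by near: s.
have : quantile s0 - e <= quantile s by near: s.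
by lra.
Unshelve. all: by end_near. Qed.

(** Both means are compared with [cdf b]: [lo] and [hi] bound the pulled-back ramps ending or
    starting at b, [ramp_le_cdf] and [cdf_le_ramp] those of [mu]. This interleaving is what
    [mean_eq] asks for. *)
Lemma lam_quantile (h : R -> R) : continuous h -> lam (h \o quantile) = mu h.
Proof.
have cc (f : R -> R) : continuous f -> continuous (f \o quantile).
  by move=> cf x; apply: continuous_comp; [exact: quantile_continuous|exact: cf].
have mnu : mean (fun f => lam (f \o quantile)).
  by apply: mean_comp; [exact: lam_mean|exact: quantile_continuous|move=> x _; exact: quantile_itv].
have hi b c : 0 <= b -> b < c -> cdf b <= lam (ramp b c \o quantile).
  move=> b0 bc; have /andP[F0 F1] := cdf_itv b.
  rewrite -[leLHS]mul1r -[cdf b]subr0; apply: lam_ge_itv => //.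
  - exact/cc/ramp_continuous.
  - by move=> x _; exact: ramp_ge0.
  - by move=> x /andP[_ xb]; rewrite /= ramp1//; exact: quantile_le.
have lo a b : a < b -> 0 <= b <= 1 -> lam (ramp a b \o quantile) <= cdf b.
  move=> ab b01; have /andP[F0 F1] := cdf_itv b.
  have c1 := cc _ (@ramp_continuous R a b).
  have c0 : continuous (fun _ : R => (1 : R)) by exact: cst_continuous.
  suff : 1 * (1 - cdf b) <= lam (fun x => 1 - (ramp a b \o quantile) x).
    by rewrite (meanB (lam_mean R))// (mean1 (lam_mean R)); lra.
  apply: lam_ge_itv => //; first exact: continuous_sub.
  - by move=> x _; rewrite subr_ge0 ramp_le1.
  - by move=> x /andP[bx _]; rewrite /= ramp0 ?subr0//; exact: quantile_ge.
apply: (mean_eq mnu mmu) => a b c a0 ab bc b1; have b0 := le_trans a0 (ltW ab).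
  by apply: (le_trans (lo _ _ ab _)); rewrite ?b0//; exact: cdf_le_ramp.
by apply: (le_trans (ramp_le_cdf ab)); exact: hi.
Qed.

End quantile_map.

(** * Traces on C([0,1], M_n) *)

(** A total constructor with default value 0, so that elements can be written down before their
    continuity is proved. *)
HB.lock Definition cm_of (R : realType) (n : nat) (F : I01 R -> 'M[Cx R]_n.+1) : contMx R n :=
  if pselect (F \in @continuous_mx R n) is left cF then ContMx cF else 0.

Lemma node_near (R : realType) (N : nat) (t : R) : 0 <= t <= 1 ->
  exists j : 'I_N.+2, `|t - j%:R / N.+1%:R| <= N.+1%:R^-1.
Proof.
move=> /andP[t0 t1]; have N0 : 0 < N.+1%:R :> R by rewrite ltr0n.
have tN : 0 <= t * N.+1%:R by rewrite mulr_ge0.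
have /andP[h1 h2] := truncn_itv tN.
have jN : (Num.trunc (t * N.+1%:R) < N.+2)%N.
  rewrite ltnS -(ler_nat R); apply: (le_trans h1).
  by rewrite ler_piMl.
exists (Ordinal jN) => /=.
rewrite -{1}[t](mulfK (lt0r_neq0 N0)) -mulrBl normrM normfV (gtr0_norm N0).
rewrite -[leRHS]mul1r ler_pM2r ?invr_gt0// ger0_norm ?subr_ge0//.
by move: h2; rewrite -[(Num.trunc _).+1%:R]natr1; lra.
Qed.

HB.lock Definition ntr (R : realType) (n : nat) (A : 'M[Cx R]_n.+1) : Cx R :=
  n.+1%:R^-1 * \tr A.

Section cm_elements.
Variable R : realType.
Implicit Types (x y : R) (h : R -> R) (t s : I01 R).

Lemma I01_itv t : 0 <= (set_val t : R) <= 1.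
Proof. by have := set_valP t; rewrite /= in_itv. Qed.

Lemma clamp_subproof x : Num.min 1 (Num.max 0 x) \in (`[0%R, 1%R]%classic : set R).
Proof. by rewrite inE/= in_itv/= le_min ge_min le_max !lexx ler01. Qed.

Definition clamp x : I01 R := exist (fun y => y \in _) _ (clamp_subproof x).

Lemma clampE x : 0 <= x <= 1 -> set_val (clamp x) = x.
Proof.
move=> /andP[x0 x1]; transitivity (Num.min 1 (Num.max 0 x)) => //.
by rewrite max_r// min_r.
Qed.

Lemma clampK t : clamp (set_val t) = t.
Proof. by apply: val_inj; exact: (clampE (I01_itv t)). Qed.

Lemma clamp_lip x y : `|set_val (clamp x) - set_val (clamp y) : R| <= `|x - y|.
Proof.
have Lip (a b : R) :
    Num.min 1 (Num.max 0 b) - Num.min 1 (Num.max 0 a) <= `|b - a|.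
  have := ler_norm (b - a); have := normr_ge0 (b - a).
  by case: (leP 0 a) => ?; case: (leP 0 b) => ?;
    do ?[case: (leP 1 _) => ?]; lra.
by rewrite ler_norml lerNl opprB Lip distrC Lip.
Qed.

Variable n : nat.
Local Notation M := 'M[Cx R]_n.+1.
Local Notation CM := (contMx R n).
Implicit Types (A B : M) (f g : CM) (F : I01 R -> M).

Lemma opnorm1_le : opnorm (1%:M : M) <= 1.
Proof. by apply: opnorm_le => // v; rewrite mul1mx mul1r. Qed.

Lemma opnorm_scalar_le (c : Cx R) : opnorm (c%:M : M) <= modulus c.
Proof.
rewrite -scalemx1 opnormZ -[leRHS]mulr1 ler_wpM2l ?modulus_ge0//.
exact: opnorm1_le.
Qed.

Lemma cm_ofE F : F \in @continuous_mx R n -> forall t, cm_of F t = F t.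
Proof. by rewrite unlock; case: pselect. Qed.

Definition cmat A : CM := ContMx (continuous_mx_cst A).

Lemma cmatE A t : cmat A t = A. Proof. by []. Qed.

Definition scal h : CM := cm_of (fun t => ((h (set_val t))%:C)%C%:M).

Lemma scalE h : continuous h -> forall t, scal h t = ((h (set_val t))%:C)%C%:M.
Proof.
move=> ch; apply: cm_ofE; apply/continuous_mxP/continuous_opnormP => t e e0.
have /cvgrPdist_lt/(_ e e0)/nbhs_ballP[d /= d0 dU] := ch (set_val t).
exists d => // s st; rewrite -raddfB -rmorphB /=.
apply: (le_lt_trans (opnorm_scalar_le _)); rewrite modulus_real distrC.
by apply: dU; rewrite -ball_normE /= distrC.
Qed.

(** One criterion for all scalar readings of an element along [0,1]: parts of the trace, the
    operator norm, the modulus of an entry. *)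
Lemma cm_lip_continuous f (phi : M -> R) (C : R) : 0 < C ->
  (forall A B, `|phi A - phi B| <= C * opnorm (A - B)) ->
  continuous (fun x => phi (f (clamp x))).
Proof.
move=> C0 lip x; apply/cvgrPdist_lt => e e0.
have /continuous_opnormP/(_ (clamp x) _ (divr_gt0 e0 C0))[d d0 fd] := @contMx_continuous _ _ f.
near=> y; rewrite distrC; apply: (le_lt_trans (lip _ _)).
rewrite mulrC -ltr_pdivlMr//; apply: fd; apply: (le_lt_trans (clamp_lip _ _)).
rewrite distrC; near: y; exact: cvgr_dist_lt.
Unshelve. all: by end_near. Qed.

Lemma ntrD A B : ntr (A + B) = ntr A + ntr B.
Proof. by rewrite unlock linearD/= mulrDr. Qed.

Lemma ntrZ (c : Cx R) A : ntr (c *: A) = c * ntr A.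
Proof. by rewrite unlock linearZ/= mulrCA. Qed.

Lemma ntrB A B : ntr (A - B) = ntr A - ntr B.
Proof. by rewrite ntrD -scaleN1r ntrZ mulN1r. Qed.

Lemma ntr_scalar (c : Cx R) : ntr (c%:M : M) = c.
Proof. by rewrite unlock mxtrace_scalar -[c *+ _]mulr_natl mulKf// pnatr_eq0. Qed.

Lemma ntr_mulC A B : ntr (A *m B) = ntr (B *m A).
Proof. by rewrite unlock mxtrace_mulC. Qed.

Lemma modulus_natV (k : nat) : modulus (k.+1%:R^-1 : Cx R) = k.+1%:R^-1.
Proof.
have -> : (k.+1%:R^-1 : Cx R) = ((k.+1%:R^-1)%:C)%C by rewrite fmorphV rmorph_nat.
by rewrite modulus_real ger0_norm ?invr_ge0.
Qed.

Lemma modulus_ntr A : modulus (ntr A) <= opnorm A.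
Proof.
rewrite unlock modulusM modulus_natV mulrC ler_pdivrMr ?ltr0n//.
apply: (le_trans (modulus_sum _ _ _)).
apply: (@le_trans _ _ (\sum_(i < n.+1) opnorm A)).
  by apply: ler_sum => i _; exact: modulus_le_opnorm.
by rewrite sumr_const card_ord mulr_natr.
Qed.

Lemma cm_uniform f (e : R) : 0 < e -> exists2 d : R, 0 < d &
  forall s t, `|set_val s - set_val t : R| <= d -> opnorm (f s - f t) <= e.
Proof.
move=> e0.
have [| | |d d0 dU] := @uniform_pdist R (fun x y => opnorm (f (clamp x) - f (clamp y))) _ _ _ e e0.
- by move=> x y; rewrite -opnormN opprB.
- by move=> x y z; rewrite -(subrKA (f (clamp y))) opnormD.
- move=> x r r0.
  have /continuous_opnormP/(_ (clamp x) r r0)[d d0 fd] := @contMx_continuous _ _ f.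
  near=> y; rewrite -opnormN opprB; apply: ltW; apply: fd.
  apply: (le_lt_trans (clamp_lip _ _)).
  by rewrite distrC; near: y; exact: cvgr_dist_lt.
exists d => // s t st; have := dU (set_val s) (set_val t) (I01_itv s) (I01_itv t) st.
by rewrite !clampK.
Unshelve. all: by end_near. Qed.

(** The squared normalized Hilbert-Schmidt norm. It expresses the trace of [adjoint A *m A] as a
    real number, to which a mean can be applied. *)
Definition hs A : R := n.+1%:R^-1 * \sum_i \sum_j modulus (A i j) ^+ 2.

Lemma ntr_adjoint_mul A : ntr (adjoint A *m A) = ((hs A)%:C)%C.
Proof.
rewrite unlock /hs rmorphM fmorphV rmorph_nat; congr (_ * _).
rewrite exchange_big rmorph_sum; apply: eq_bigr => i _.
rewrite mxE rmorph_sum; apply: eq_bigr => j _.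
by rewrite !mxE; exact: sqr_modulus.
Qed.

Lemma hs_ge0 A : 0 <= hs A.
Proof.
rewrite /hs mulr_ge0 ?invr_ge0//.
by do 2 (apply: sumr_ge0 => ? _); rewrite sqr_ge0.
Qed.

Lemma opnorm_hs A : opnorm A ^+ 2 <= n.+1%:R * hs A.
Proof.
rewrite /hs mulrA divff ?mul1r ?pnatr_eq0//.
set S := \sum_i _; have S0 : 0 <= S.
  by do 2 (apply: sumr_ge0 => ? _); rewrite sqr_ge0.
rewrite -[leRHS]sqr_sqrtr// ler_pXn2r ?nnegrE ?opnorm_ge0 ?sqrtr_ge0//.
apply: opnorm_le => [|v]; first exact: sqrtr_ge0.
rewrite -(ler_pXn2r (ltn0Sn 1)) ?nnegrE ?mulr_ge0 ?vnorm_ge0 ?sqrtr_ge0//.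
rewrite exprMn (sqr_sqrtr S0) !vnorm_sqr mulr_suml; apply: ler_sum => i _.
rewrite mxE; apply: le_trans (real_CauchySchwarz _ _).
rewrite ler_pXn2r ?nnegrE ?modulus_ge0//; last first.
  by apply: sumr_ge0 => j _; rewrite mulr_ge0 ?modulus_ge0.
apply: (le_trans (modulus_sum _ _ _)); apply: ler_sum => j _.
by rewrite modulusM.
Qed.

(** Means act on real functions of the line: hence the separate real and imaginary parts, and the
    extension beyond [0,1] by [clamp]. *)
Definition reT f : R -> R := fun x => complex.Re (ntr (f (clamp x))).
Definition imT f : R -> R := fun x => complex.Im (ntr (f (clamp x))).

Lemma reT_continuous f : continuous (reT f).
Proof.
apply: (@cm_lip_continuous _ (fun A => complex.Re (ntr A)) 1) => // A B.
by rewrite mul1r -raddfB/= -ntrB; apply: le_trans (modulus_ntr _); exact: modulus_Re.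
Qed.

Lemma imT_continuous f : continuous (imT f).
Proof.
apply: (@cm_lip_continuous _ (fun A => complex.Im (ntr A)) 1) => // A B.
by rewrite mul1r -raddfB/= -ntrB; apply: le_trans (modulus_ntr _); exact: modulus_Im.
Qed.

Lemma delta_mul3 A (i j k l : 'I_n.+1) :
  delta_mx i j *m A *m delta_mx k l = A j k *: delta_mx i l.
Proof.
apply/matrixP => a b; rewrite mxE (bigD1 k)//= [X in _ + X]big1 ?addr0; last first.
  by move=> k' /negbTE kk; rewrite [delta_mx k l _ _]mxE kk mulr0.
rewrite mxE (bigD1 j)//= [X in _ + X]big1 ?addr0; last first.
  by move=> j' /negbTE jj; rewrite mxE jj andbF mul0r.
rewrite !mxE !eqxx andbT /=.
by case: (a == i); case: (b == l); rewrite /= ?(mulr0,mulr1,mul1r,mul0r).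
Qed.

End cm_elements.

Section traces_and_means.
Variable R : realType.
Implicit Types (h : R -> R) (mu : (R -> R) -> R).

Lemma Cx_eqP (z w : Cx R) :
  complex.Re z = complex.Re w -> complex.Im z = complex.Im w -> z = w.
Proof. by case: z w => [a b] [c d] /= -> ->. Qed.

Lemma Cx_real_add_le (x y z : R) :
  ((x%:C)%C : Cx R) = (y%:C)%C + (z%:C)%C -> 0 <= z -> y <= x.
Proof.
have reD : complex.Re ((y%:C)%C + (z%:C)%C : Cx R) = y + z by [].
by move=> /(congr1 (@complex.Re R)); rewrite reD /= => ->; rewrite lerDl.
Qed.

Lemma Cx_ReM (z w : Cx R) : complex.Re (z * w) =
  complex.Re z * complex.Re w - complex.Im z * complex.Im w.
Proof. by case: z w => [? ?] [? ?]. Qed.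

Lemma Cx_ImM (z w : Cx R) : complex.Im (z * w) =
  complex.Re z * complex.Im w + complex.Im z * complex.Re w.
Proof. by case: z w => [? ?] [? ?]. Qed.

Section mean_to_trace.
Variables (mu : (R -> R) -> R) (mmu : mean mu) (n : nat).
Implicit Types f g : contMx R n.

(* The unused argument [m] lets the linear structure be inferred. *)
Definition mean_trace (m : mean mu) f : Cx R := (mu (reT f) +i* mu (imT f))%C.

Lemma mean_trace_linear : linear_for *%R (mean_trace mmu).
Proof.
move=> c f g.
have cr : continuous (reT f) by exact: reT_continuous.
have ci : continuous (imT f) by exact: imT_continuous.
have crg : continuous (reT g) by exact: reT_continuous.
have cig : continuous (imT g) by exact: imT_continuous.
have E x : ntr ((c *: f + g) (clamp x)) = c * ntr (f (clamp x)) + ntr (g (clamp x)).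
  by rewrite contMxD contMxZ ntrD ntrZ.
have reE : reT (c *: f + g) =
    fun x => complex.Re c * reT f x + (- complex.Im c) * imT f x + reT g x.
  apply/funext => x; rewrite /reT /imT E.
  by rewrite raddfD /= Cx_ReM mulNr.
have imE : imT (c *: f + g) =
    fun x => complex.Re c * imT f x + complex.Im c * reT f x + imT g x.
  apply/funext => x; rewrite /reT /imT E.
  by rewrite raddfD /= Cx_ImM.
rewrite /mean_trace reE imE (mean_lincomb mmu _ _ cr ci crg).
rewrite (mean_lincomb mmu _ _ ci cr cig) {reE imE E}.
by case: c => a b; apply: Cx_eqP => /=; rewrite ?mulNr.
Qed.

HB.instance Definition _ := GRing.isLinear.Build (Cx R) (contMx R n) (Cx R) *%R
  (mean_trace mmu) mean_trace_linear.

Lemma mean_trace_star_mul f :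
  mean_trace mmu (star f * f) = ((mu (fun x => hs (f (clamp x))))%:C)%C.
Proof.
have E x : ntr ((star f * f) (clamp x)) = ((hs (f (clamp x)))%:C)%C.
  by rewrite -ntr_adjoint_mul.
apply: Cx_eqP => /=; first by congr mu; apply/funext => x; rewrite /reT E.
by rewrite -[RHS](mean_cst mmu); congr mu; apply/funext => x; rewrite /imT E.
Qed.

Lemma hs_continuous f : continuous (fun x => hs (f (clamp x))).
Proof.
have -> : (fun x => hs (f (clamp x))) = reT (star f * f).
  apply/funext => x; rewrite /reT.
  have -> : ntr ((star f * f) (clamp x)) = ((hs (f (clamp x)))%:C)%C.
    by rewrite -ntr_adjoint_mul.
  by [].
exact: reT_continuous.
Qed.

Lemma mean_trace_trace : is_trace (mean_trace mmu : {scalar contMx R n}).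
Proof.
split => /=.
- move=> f; rewrite mean_trace_star_mul lecR; apply: (mean_ge0 mmu).
    exact: hs_continuous.
  by move=> x _; exact: hs_ge0.
- have E x : ntr ((1 : contMx R n) (clamp x)) = 1 by rewrite (ntr_scalar _ 1).
  apply: Cx_eqP => /=.
    by rewrite -[RHS](mean_cst mmu); congr mu; apply/funext => x; rewrite /reT E.
  by rewrite -[RHS](mean_cst mmu); congr mu; apply/funext => x; rewrite /imT E.
- move=> f g; have E x : ntr ((f * g) (clamp x)) = ntr ((g * f) (clamp x)).
    by rewrite !contMxM ntr_mulC.
  by congr (mu _ +i* mu _)%C; apply/funext => x; rewrite /reT /imT E.
Qed.

Lemma mean_trace_faithful : faithful_mean mu ->
  faithful (mean_trace mmu : {scalar contMx R n}).
Proof.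
move=> fmu f; rewrite /= mean_trace_star_mul => /(@complexI R) f0.
apply: contMxP => t; apply: opnorm0_eq0; apply/eqP.
rewrite -sqrf_eq0 eq_le sqr_ge0 andbT; apply: (le_trans (opnorm_hs _)).
have := fmu _ (@hs_continuous f) _ f0 (set_val t) (I01_itv t).
by rewrite clampK => -> => [|x _]; rewrite ?mulr0// hs_ge0.
Qed.

End mean_to_trace.

Section trace_to_mean.
Variables (n : nat) (tau : {scalar contMx R n}) (htau : is_trace tau).
Implicit Types f g : contMx R n.

Definition trace_mean h : R := complex.Re (tau (scal n h)).

(** Positivity of a trace is given on elements [star a * a] only; the square root puts nonnegative
    functions into this form. *)
Lemma scal_sqrt h : continuous h -> (forall x, 0 <= x <= 1 -> 0 <= h x) ->
  scal n h = star (scal n (fun x => Num.sqrt (h x))) * scal n (fun x => Num.sqrt (h x)).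
Proof.
move=> ch h0; have cs : continuous (fun x => Num.sqrt (h x)).
  by move=> x; apply: continuous_comp; [exact: ch|exact: sqrt_continuous].
apply: contMxP => t; rewrite contMxM cm_starE (scalE _ ch) (scalE _ cs).
rewrite /adjoint tr_scalar_mx map_scalar_mx -scalar_mxM; congr (_%:M).
rewrite sqr_modulus modulus_real ger0_norm ?sqrtr_ge0// sqr_sqrtr//.
exact/h0/I01_itv.
Qed.

Lemma trace_scal_ge0 h : continuous h -> (forall x, 0 <= x <= 1 -> 0 <= h x) ->
  0 <= tau (scal n h).
Proof. by move=> ch h0; rewrite scal_sqrt//; exact: (trace_ge0 htau). Qed.

Lemma scalD h1 h2 : continuous h1 -> continuous h2 ->
  scal n (fun x => h1 x + h2 x) = scal n h1 + scal n h2.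
Proof.
move=> c1 c2; apply: contMxP => t; rewrite contMxD.
by rewrite (scalE _ c1) (scalE _ c2) (scalE _ (continuous_add c1 c2)) rmorphD raddfD.
Qed.

Lemma scalZ (c : R) h : continuous h ->
  scal n (fun x => c * h x) = (c%:C)%C *: scal n h.
Proof.
move=> ch; apply: contMxP => t; rewrite contMxZ.
by rewrite (scalE _ ch) (scalE _ (continuous_scale (c := c) ch)) rmorphM scale_scalar_mx.
Qed.

Lemma scalB h1 h2 : continuous h1 -> continuous h2 ->
  scal n (fun x => h1 x - h2 x) = scal n h1 - scal n h2.
Proof.
move=> c1 c2; have c3 := continuous_scale (c := -1) c2.
under eq_fun do rewrite -mulN1r.
by rewrite scalD// scalZ// rmorphN1 scaleN1r.
Qed.

(** The positive and negative parts of h have nonnegative, hence real, traces. *)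
Lemma trace_scal_real h : continuous h -> tau (scal n h) = ((trace_mean h)%:C)%C.
Proof.
move=> ch; pose p x := Num.max 0 (h x); pose m x := Num.max 0 (- h x).
have cp : continuous p.
  by move=> x; apply: (@continuous_max R R (fun=> 0) h); [exact: cst_continuous|exact: ch].
have cm : continuous m.
  move=> x; apply: (@continuous_max R R (fun=> 0) (fun x => - h x)); first exact: cst_continuous.
  by apply: continuousN; exact: ch.
have E : h = fun x => p x - m x.
  by apply/funext => x; rewrite /p /m; rewrite !maxEle; case: (leP 0 (h x)); case: (leP 0 (- h x)); lra.
have p0 : 0 <= tau (scal n p) by apply: trace_scal_ge0 => // x _; rewrite /p le_max lexx.
have m0 : 0 <= tau (scal n m) by apply: trace_scal_ge0 => // x _; rewrite /m le_max lexx.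
apply: Cx_eqP => //=; rewrite E scalB// linearB /=.
by move: p0 m0; case: (tau (scal n p)) => a b; case: (tau (scal n m)) => c d;
   rewrite !lecE /= => /andP[/eqP -> _] /andP[/eqP -> _]; rewrite subrr.
Qed.

Lemma trace_mean_mean : mean trace_mean.
Proof.
split.
- move=> f g cf cg; rewrite /trace_mean scalD// linearD/=.
  by case: (tau _) => ? ?; case: (tau _) => ? ?.
- move=> c f cf; rewrite /trace_mean scalZ// linearZ/= trace_scal_real//=.
  by rewrite mul0r subr0.
- move=> f cf f0; have := trace_scal_ge0 cf f0.
  by rewrite trace_scal_real// lecR.
- rewrite /trace_mean (_ : scal n _ = 1) ?(trace1 htau)//.
  by apply: contMxP => t; rewrite scalE; [|exact: cst_continuous].
Qed.

Lemma trace_mean_faithful : faithful tau -> faithful_mean trace_mean.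
Proof.
move=> ft h ch h0 mh x x01; have cs : continuous (fun x => Num.sqrt (h x)).
  by move=> y; apply: continuous_comp; [exact: ch|exact: sqrt_continuous].
set s := scal n (fun x => Num.sqrt (h x)).
have E : scal n h = star s * s by exact: scal_sqrt.
have : s = 0 by apply: ft; rewrite -E trace_scal_real// mh.
move=> /(congr1 (fun f : contMx R n => f (clamp x) 0 0)).
rewrite (scalE _ cs) !mxE eqxx mulr1n => /(@complexI R) /eqP.
by rewrite sqrtr_eq0 clampE// => hx; apply/eqP; rewrite eq_le hx h0.
Qed.

(** By traciality the term of index i, j has the trace of [cmat (delta_mx i i) * f]. The averaged
    element is central, so the trace is determined by its values on scalar functions. *)
Lemma trace_centre f : tau f = n.+1%:R^-1 *
  tau (\sum_i \sum_j cmat (delta_mx j i) * f * cmat (delta_mx i j)).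
Proof.
rewrite linear_sum /= (eq_bigr (fun i => n.+1%:R * tau (cmat (delta_mx i i) * f))); last first.
  move=> i _; rewrite linear_sum /= (eq_bigr (fun=> tau (cmat (delta_mx i i) * f))).
    by rewrite sumr_const card_ord mulr_natl.
  move=> j _; rewrite (trace_mulC htau) mulrA; congr (tau (_ * _)).
  by apply: contMxP => t; rewrite contMxM /= /cst mul_delta_mx.
rewrite -mulr_sumr mulKf ?pnatr_eq0// -linear_sum /= -mulr_suml -[LHS](congr1 _ (mul1r f)).
congr (tau (_ * _)); apply: contMxP => t.
have -> : (\sum_i cmat (delta_mx i i) : contMx R n) t = \sum_i delta_mx i i.
  by elim/big_rec2: _ => // i x y _ <-.
exact: mx1_sum_delta.
Qed.

Lemma trace_meanE f : tau f = mean_trace trace_mean_mean f.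
Proof.
rewrite trace_centre.
have -> : \sum_i \sum_j cmat (delta_mx j i) * f * cmat (delta_mx i j) =
   n.+1%:R *: (scal n (reT f) + 'i%C *: scal n (imT f)).
  apply: contMxP => t.
  have -> : (\sum_i \sum_j cmat (delta_mx j i) * f * cmat (delta_mx i j) : contMx R n) t =
     \sum_i \sum_j delta_mx j i *m f t *m delta_mx i j.
    elim/big_rec2: _ => // i x y _ <-; rewrite contMxD; congr (_ + _).
    by elim/big_rec2: _ => // j u v _ <-.
  rewrite contMxZ contMxD contMxZ !scalE; [|exact: imT_continuous|exact: reT_continuous].
  rewrite /reT /imT clampK scale_scalar_mx -raddfD scale_scalar_mx /=.
  have -> : ((complex.Re (ntr (f t)))%:C)%C + 'i%C * ((complex.Im (ntr (f t)))%:C)%C = ntr (f t) :> R[i].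
    by rewrite -complexE.
  rewrite [ntr]unlock mulrA divff ?mul1r ?pnatr_eq0// /mxtrace raddf_sum.
  apply: eq_bigr => i _; transitivity (scalar_mx (f t i i) : 'M[Cx R]_n.+1) => [|//].
  by rewrite scalar_mx_sum_delta; apply: eq_bigr => j _; rewrite delta_mul3.
rewrite linearZ/= mulKf ?pnatr_eq0// linearD linearZ /= !trace_scal_real.
- by rewrite /mean_trace [RHS]complexE.
- exact: imT_continuous.
- exact: reT_continuous.
Qed.

End trace_to_mean.

End traces_and_means.

(** * Diagonal embeddings *)

Section unitary.
Variables (R : realType) (n : nat).
Implicit Types (U V A : 'M[Cx R]_n.+1).

Definition unitary U := adjoint U *m U = 1%:M.

Lemma unitaryC U : unitary U -> U *m adjoint U = 1%:M.
Proof. exact: mulmx1C. Qed.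

Lemma unitary_adjoint U : unitary U -> unitary (adjoint U).
Proof. by move=> uU; rewrite /unitary adjointK unitaryC. Qed.

Lemma opnorm_unitary U : unitary U -> opnorm U <= 1.
Proof.
move=> uU; apply: opnorm_le => // v; rewrite mul1r.
rewrite -(ler_pXn2r (ltn0Sn 1)) ?nnegrE ?vnorm_ge0// -lecR -!inner_vnorm.
by rewrite inner_adjoint mulmxA uU mul1mx.
Qed.

Lemma unitary1 : unitary 1%:M.
Proof. by rewrite /unitary mulmx1 /adjoint tr_scalar_mx map_scalar_mx rmorph1. Qed.

Lemma opnorm_conj_le U A : unitary U -> opnorm (U *m A *m adjoint U) <= opnorm A.
Proof.
move=> uU; apply: (le_trans (opnormM _ _)).
apply: (@le_trans _ _ (opnorm (U *m A) * 1)).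
  by rewrite ler_wpM2l ?opnorm_ge0// opnorm_unitary//; exact: unitary_adjoint.
rewrite mulr1; apply: (le_trans (opnormM _ _)).
by rewrite ler_piMl ?opnorm_ge0// opnorm_unitary.
Qed.

End unitary.

Section block_diagonal.
Variables (R : realType) (n M L : nat) (e : 'I_L.+1 -> 'I_M.+1 * 'I_n.+1).
Hypotheses (e_bij : bijective e).
Local Notation Mn := 'M[Cx R]_n.+1.
Implicit Types (F G : 'I_M.+1 -> Mn).

(** A bijection [e] names each index of the large matrix by its block and its position there, which
    avoids casts along the equality of sizes. *)
Definition bdiag F : 'M[Cx R]_L.+1 :=
  \matrix_(a, b) if (e a).1 == (e b).1 then F (e a).1 (e a).2 (e b).2 else 0.

Lemma sum_block (V : nmodType) (g : 'I_M.+1 -> 'I_n.+1 -> V) :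
  \sum_c g (e c).1 (e c).2 = \sum_m \sum_i g m i.
Proof. by rewrite pair_bigA /= (reindex e)//; exact: onW_bij. Qed.

Lemma bdiagD F G : bdiag (fun m => F m + G m) = bdiag F + bdiag G.
Proof.
by apply/matrixP => a b; rewrite !mxE; case: eqP => _; rewrite ?mxE ?addr0.
Qed.

Lemma bdiagZ (c : Cx R) F : bdiag (fun m => c *: F m) = c *: bdiag F.
Proof.
by apply/matrixP => a b; rewrite !mxE; case: eqP => _; rewrite ?mxE ?mulr0.
Qed.

Lemma bdiagB F G : bdiag (fun m => F m - G m) = bdiag F - bdiag G.
Proof.
rewrite -scaleN1r -bdiagZ -bdiagD; congr bdiag; apply/funext => m.
by rewrite scaleN1r.
Qed.

Lemma bdiag1 : bdiag (fun=> 1%:M) = 1%:M.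
Proof.
apply/matrixP => a b; rewrite !mxE -(bij_eq e_bij) -pair_eqE /= /pair_eq.
by case: eqP => _; rewrite ?mxE.
Qed.

Lemma bdiagM F G : bdiag (fun m => F m *m G m) = bdiag F *m bdiag G.
Proof.
apply/matrixP => a b; rewrite !mxE.
rewrite (eq_bigr (fun c => (fun m i => (if (e a).1 == m then F (e a).1 (e a).2 i else 0) *
   (if m == (e b).1 then G m i (e b).2 else 0)) (e c).1 (e c).2)); last first.
  by move=> c _; rewrite !mxE.
rewrite (sum_block (fun m i => (if (e a).1 == m then F (e a).1 (e a).2 i else 0) *
   (if m == (e b).1 then G m i (e b).2 else 0))).
rewrite (bigD1 (e a).1)//= [X in _ + X]big1 ?addr0; last first.
  by move=> m ma; apply: big1 => i _; rewrite eq_sym (negbTE ma) mul0r.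
rewrite eqxx; case: eqP => _; first by [].
by rewrite big1// => i _; rewrite mulr0.
Qed.

Lemma bdiag_adjoint F : bdiag (fun m => adjoint (F m)) = adjoint (bdiag F).
Proof.
apply/matrixP => a b; rewrite !mxE eq_sym; case: eqP => [->|_]; first by [].
by rewrite rmorph0.
Qed.

Lemma bdiag_opnorm F (c : R) : 0 <= c -> (forall m, opnorm (F m) <= c) ->
  opnorm (bdiag F) <= c.
Proof.
move=> c0 Fc; apply: opnorm_le => // v.
have [e' eK e'K] := e_bij.
pose w m : 'cV[Cx R]_n.+1 := \col_i v (e' (m, i)) 0.
have vE : vnorm v ^+ 2 = \sum_m vnorm (w m) ^+ 2.
  rewrite vnorm_sqr (eq_bigr (fun a => (fun m i => modulus (w m i 0) ^+ 2) (e a).1 (e a).2)).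
    rewrite (sum_block (fun m i => modulus (w m i 0) ^+ 2)).
    by apply: eq_bigr => m _; rewrite vnorm_sqr.
  by move=> a _; rewrite mxE -surjective_pairing eK.
have FvE : vnorm (bdiag F *m v) ^+ 2 = \sum_m vnorm (F m *m w m) ^+ 2.
  rewrite vnorm_sqr (eq_bigr (fun a => (fun m i => modulus ((F m *m w m) i 0) ^+ 2) (e a).1 (e a).2)).
    rewrite (sum_block (fun m i => modulus ((F m *m w m) i 0) ^+ 2)).
    by apply: eq_bigr => m _; rewrite vnorm_sqr.
  move=> a _; congr (modulus _ ^+ 2); rewrite !mxE.
  rewrite (eq_bigr (fun b => (fun m i => (if (e a).1 == m then F (e a).1 (e a).2 i else 0) *
     w m i 0) (e b).1 (e b).2)); last first.
    by move=> b _; rewrite !mxE -surjective_pairing eK.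
  rewrite (sum_block (fun m i => (if (e a).1 == m then F (e a).1 (e a).2 i else 0) * w m i 0)).
  rewrite (bigD1 (e a).1)//= [X in _ + X]big1 ?addr0; last first.
    by move=> m ma; apply: big1 => i _; rewrite eq_sym (negbTE ma) mul0r.
  by apply: eq_bigr => i _; rewrite eqxx.
rewrite -(ler_pXn2r (ltn0Sn 1)) ?nnegrE ?mulr_ge0 ?vnorm_ge0//.
rewrite FvE exprMn vE mulr_sumr; apply: ler_sum => m _.
rewrite -exprMn ler_pXn2r ?nnegrE ?mulr_ge0 ?vnorm_ge0//.
by apply: (le_trans (le_opnorm _ _)); rewrite ler_wpM2r ?vnorm_ge0.
Qed.

Lemma bdiag_ntr F : ntr (bdiag F) = M.+1%:R^-1 * \sum_m ntr (F m).
Proof.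
have hL : L.+1 = (M.+1 * n.+1)%N.
  by rewrite -[LHS]card_ord (bij_eq_card e_bij) card_prod !card_ord.
have hV : (L.+1%:R^-1 : Cx R) = M.+1%:R^-1 * n.+1%:R^-1 by rewrite hL natrM invfM.
rewrite unlock hV -mulrA -[in RHS]mulr_sumr; congr (_ * (_ * _)).
rewrite /mxtrace (eq_bigr (fun a => (fun m i => F m i i) (e a).1 (e a).2)).
  exact: (sum_block (fun m i => F m i i)).
by move=> a _; rewrite mxE eqxx.
Qed.

End block_diagonal.

Section diagonal_embedding.
Variables (R : realType) (n M L : nat) (e : 'I_L.+1 -> 'I_M.+1 * 'I_n.+1).
Variables (q : 'I_M.+1 -> R -> R) (U : 'M[Cx R]_L.+1).
Implicit Types (f g : contMx R n) (t : I01 R).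

(** The hypotheses are arguments of the map so that its linear and multiplicative structures can be
    declared as instances. *)
Definition demb (e_bij : bijective e) (cq : forall m, continuous (q m)) (uU : unitary U) f : contMx R L :=
  cm_of (fun t => U *m bdiag e (fun m => f (clamp (q m (set_val t)))) *m adjoint U).

Hypotheses (e_bij : bijective e) (cq : forall m, continuous (q m)) (uU : unitary U).

Lemma dembE f t : demb e_bij cq uU f t =
  U *m bdiag e (fun m => f (clamp (q m (set_val t)))) *m adjoint U.
Proof.
apply: cm_ofE; apply/continuous_mxP/continuous_opnormP => {}t d d0.
have d2 : 0 < d / 2 by rewrite divr_gt0.
have near (x0 : R) : \forall x \near x0, forall m,
    opnorm (f (clamp (q m x)) - f (clamp (q m x0))) < d / 2.
  have F : Filter (nbhs x0) by exact: nbhs_filter.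
  apply: (@filter_forall R _ (fun m x => opnorm (f (clamp (q m x)) - f (clamp (q m x0))) < d / 2) _ F) => m.
  have /continuous_opnormP/(_ (clamp (q m x0)) _ d2)[r r0 fr] := @contMx_continuous _ _ f.
  near=> x; apply: fr; apply: (le_lt_trans (clamp_lip _ _)); rewrite distrC.
  near: x; by have /cvgrPdist_lt := @cq m x0; apply.
have /nbhs_ballP[r /= r0 rU] := near (set_val t); exists r => // s st.
have /rU {}rU : ball (set_val t : R) r (set_val s) by rewrite -ball_normE /= distrC.
apply: le_lt_trans (_ : d / 2 < d); last by rewrite ltr_pdivrMr// ltr_pMr// ltr1n.
rewrite -mulmxBl -mulmxBr -bdiagB; apply: (le_trans (opnorm_conj_le _ uU)).
by apply: bdiag_opnorm => // [|m]; exact: ltW.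
Unshelve. all: by end_near. Qed.

Lemma demb_linear : linear (demb e_bij cq uU).
Proof.
move=> c f g; apply: contMxP => t.
rewrite [LHS]dembE [RHS]contMxD [X in _ = X + _]contMxZ 2!dembE.
rewrite scalemxAl scalemxAr -mulmxDl -mulmxDr -bdiagZ -bdiagD.
by congr (_ *m bdiag _ _ *m _); apply/funext => m; rewrite contMxD contMxZ.
Qed.

Lemma demb_monoid : monoid_morphism (demb e_bij cq uU).
Proof.
split; first by apply: contMxP => t; rewrite dembE (bdiag1 _ e_bij) mulmx1 unitaryC.
move=> f g; apply: contMxP => t; rewrite [LHS]dembE [RHS]contMxM 2!dembE.
set D1 := bdiag e (fun m => f _); set D2 := bdiag e (fun m => g _).
transitivity (U *m (D1 *m D2) *m adjoint U); first by rewrite -bdiagM.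
by rewrite -!mulmxA (mulmxA (adjoint U) U) uU mul1mx.
Qed.

HB.instance Definition _ :=
  GRing.isLinear.Build (Cx R) (contMx R n) (contMx R L) *:%R (demb e_bij cq uU) demb_linear.
HB.instance Definition _ :=
  GRing.isMonoidMorphism.Build (contMx R n) (contMx R L) (demb e_bij cq uU) demb_monoid.

Lemma demb_star f : demb e_bij cq uU (star f) = star (demb e_bij cq uU f).
Proof.
apply: contMxP => t; rewrite cm_starE !dembE !adjointM adjointK mulmxA.
by rewrite -bdiag_adjoint.
Qed.

Lemma reT_imT_demb f x : 0 <= x <= 1 -> (forall m, 0 <= q m x <= 1) ->
  reT (demb e_bij cq uU f) x = M.+1%:R^-1 * \sum_m reT f (q m x) /\
  imT (demb e_bij cq uU f) x = M.+1%:R^-1 * \sum_m imT f (q m x).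
Proof.
move=> x01 q01; rewrite /reT /imT dembE clampE//.
rewrite -mulmxA ntr_mulC -mulmxA uU mulmx1 bdiag_ntr//.
have -> : (M.+1%:R^-1 : Cx R) = ((M.+1%:R^-1)%:C)%C by rewrite fmorphV rmorph_nat.
by rewrite Cx_ReM Cx_ImM /= !mul0r subr0 addr0 !raddf_sum.
Qed.

Lemma demb_mean_trace (mu nu : (R -> R) -> R) (mmu : mean mu) (mnu : mean nu) :
  (forall m (x : R), 0 <= x <= 1 -> 0 <= q m x <= 1) ->
  (forall h, continuous h -> mu h = M.+1%:R^-1 * \sum_m nu (h \o q m)) ->
  forall f, mean_trace mnu (demb e_bij cq uU f) = mean_trace mmu f.
Proof.
move=> q01 munu f.
have key (h h' : R -> R) : continuous h -> continuous h' ->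
    (forall x : R, 0 <= x <= 1 -> h' x = M.+1%:R^-1 * \sum_m h (q m x)) -> nu h' = mu h.
  move=> ch ch' hE; have cc m : continuous (h \o q m).
    by move=> x; apply: continuous_comp; [exact: cq|exact: ch].
  rewrite munu// -(mean_sum mnu) // -(meanZ mnu); last exact: continuous_sum.
  by apply: (mean_ext mnu) => //; apply: continuous_scale; exact: continuous_sum.
rewrite /mean_trace (key (reT f) (reT (demb e_bij cq uU f))) ?(key (imT f) (imT (demb e_bij cq uU f)))//.
- exact: imT_continuous.
- exact: imT_continuous.
- by move=> x x01; have [] := reT_imT_demb f x01 (fun m => q01 m x x01).
- exact: reT_continuous.
- exact: reT_continuous.
- by move=> x x01; have [] := reT_imT_demb f x01 (fun m => q01 m x x01).
Qed.

End diagonal_embedding.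

Section lebesgue_algebra.
Variables (R : realType).

Definition lebesgue_alg (L : nat) : tracialAlg R :=
  TracialAlg (mean_trace_trace (lam_mean R) L).

Lemma lebesgue_alg_class (nu : exponents) (L : nat) :
  formally_divides L.+1 nu -> class_nu nu (lebesgue_alg L).
Proof.
move=> hL; exists L, (mean_trace (lam_mean R) : {scalar contMx R L}).
exists (mean_trace_trace (lam_mean R) L); split => //.
by apply: mean_trace_faithful; exact: lam_faithful.
Qed.

(** Injectivity follows from trace preservation and faithfulness, applied to the star square of a
    difference. The free unitary U is what amalgamation adjusts later. *)
Lemma diagonal_embedding (n M L : nat) (e : 'I_L.+1 -> 'I_M.+1 * 'I_n.+1)
    (q : 'I_M.+1 -> R -> R) (U : 'M[Cx R]_L.+1)
    (tau : {scalar contMx R n}) (htau : is_trace tau) :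
  bijective e -> unitary U -> faithful tau ->
  (forall m, continuous (q m)) -> (forall m (x : R), 0 <= x <= 1 -> 0 <= q m x <= 1) ->
  (forall h, continuous h -> trace_mean tau h = M.+1%:R^-1 * \sum_m lam (h \o q m)) ->
  exists psi : embedding (TracialAlg htau) (lebesgue_alg L),
    forall (f : contMx R n) t, (psi f : contMx R L) t =
      U *m bdiag e (fun m => f (clamp (q m (set_val t)))) *m adjoint U.
Proof.
move=> be uU ft cq q01 hq.
pose psi : {lrmorphism (contMx R n) -> (contMx R L)} := demb be cq uU.
have psi_tr (f : contMx R n) : mean_trace (lam_mean R) (psi f) = tau f.
  by rewrite (trace_meanE htau); exact: demb_mean_trace.
have psi_star (f : contMx R n) : psi (star f) = star (psi f) by exact: demb_star.
have psi_inj : injective psi.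
  move=> f g fg; apply/eqP; rewrite -subr_eq0; apply/eqP; apply: ft.
  rewrite -psi_tr rmorphM raddfB /= fg subrr mulr0.
  exact: (linear0 (mean_trace (lam_mean R) : {scalar contMx R L})).
exists (@Embedding R (TracialAlg htau) (lebesgue_alg L) psi psi_star psi_tr psi_inj).
by move=> f t; exact: dembE.
Qed.

End lebesgue_algebra.

(** * Joint embedding, Cauchy continuity and separability *)

Section joint_embedding.
Variable R : realType.

Lemma block_bijection (L M n : nat) : L.+1 = (M.+1 * n.+1)%N ->
  exists e : 'I_L.+1 -> 'I_M.+1 * 'I_n.+1, bijective e.
Proof.
move=> hL; have E : L.+1 = #|{: 'I_M.+1 * 'I_n.+1}| by rewrite card_prod !card_ord.
exists (fun a => enum_val (cast_ord E a)); apply: bij_comp; first exact: enum_val_bij.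
by exists (cast_ord (esym E)); [exact: cast_ordK|exact: cast_ordKV].
Qed.

(** No small oscillation is required here, so every block carries the same quantile map, which
    already pulls the trace back to the Lebesgue mean. *)
Lemma lebesgue_embedding (n L : nat) (tau : {scalar contMx R n}) (htau : is_trace tau) :
  faithful tau -> (n.+1 %| L.+1)%N ->
  inhabited (embedding (TracialAlg htau) (lebesgue_alg R L)).
Proof.
move=> ft /dvdnP[[//|M] hL]; have [e be] := block_bijection hL.
have mmu := trace_mean_mean htau; have fmu := trace_mean_faithful htau ft.
have [|||psi _] := @diagonal_embedding R n M L e (fun=> quantile (trace_mean tau)) _ tau htau
    be (unitary1 R L) ft.
- by move=> _; exact: quantile_continuous.
- by move=> _ x _; exact: quantile_itv.
- move=> h ch; rewrite (lam_quantile mmu fmu ch) sumr_const card_ord -[trace_mean tau h *+ _]mulr_natl.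
  by rewrite mulrA mulVf ?mul1r// pnatr_eq0.
- by split.
Qed.

Lemma formally_divides_lcm (nu : exponents) (a b : nat) : (0 < a)%N -> (0 < b)%N ->
  formally_divides a nu -> formally_divides b nu -> formally_divides (lcmn a b) nu.
Proof.
move=> a0 b0 ha hb p; have := ha p; have := hb p.
by case: (nu p) => // k bk ak; rewrite logn_lcm// geq_max ak bk.
Qed.

Lemma class_nu_JEP (nu : exponents) : JEP (@class_nu R nu).
Proof.
move=> A B [n [tau [htau [hn ft ->]]]] [m [sigma [hsigma [hm fs ->]]]].
pose L := (lcmn n.+1 m.+1).-1.
have LE : L.+1 = lcmn n.+1 m.+1 by rewrite /L prednK// lcmn_gt0.
exists (lebesgue_alg R L); split.
- by apply: lebesgue_alg_class; rewrite LE; exact: formally_divides_lcm.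
- by apply: lebesgue_embedding => //; rewrite LE dvdn_lcml.
- by apply: lebesgue_embedding => //; rewrite LE dvdn_lcmr.
Qed.

End joint_embedding.

Section cstar_facts.
Variables (R : realType) (A : cstarAlgType R).
Implicit Types a b : A.

Lemma cnorm0 : cnorm (0 : A) = 0.
Proof. by rewrite -(scale0r (0 : A)) cnormZ modulus0 mul0r. Qed.

Lemma cnormN a : cnorm (- a) = cnorm a.
Proof. by rewrite -scaleN1r cnormZ modulusN modulus1 mul1r. Qed.

Lemma cnorm_ge0 a : 0 <= cnorm a.
Proof.
have := cnormD a (- a); rewrite subrr cnorm0 cnormN; lra.
Qed.

Lemma cnorm_distC a b : cnorm (a - b) = cnorm (b - a).
Proof. by rewrite -cnormN opprB. Qed.

Lemma cnorm_star a : cnorm (star a) = cnorm a.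
Proof.
have le b : cnorm b <= cnorm (star b).
  have [->|b0] := eqVneq (cnorm b) 0; first exact: cnorm_ge0.
  have b_gt0 : 0 < cnorm b by rewrite lt_def b0 cnorm_ge0.
  by rewrite -(ler_pM2r b_gt0) -expr2 -cnorm_star_mul cnormM.
by apply/eqP; rewrite eq_le le andbT; have := le (star a); rewrite starK.
Qed.

Lemma cnorm_dist_le a b : `|cnorm a - cnorm b| <= cnorm (a - b).
Proof.
have := cnormD (a - b) b; have := cnormD (b - a) a; rewrite !subrK (cnorm_distC b a).
by rewrite ler_norml; lra.
Qed.

(** For r >= 1 this is the power of [star a * a] with exponent 2^(r-1); the C*-identity gives its
    norm without spectral theory. *)
Fixpoint star_power a (r : nat) : A :=
  if r is r'.+1 then star (star_power a r') * star_power a r' else a.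

Lemma cnorm_star_power a r : cnorm (star_power a r) = cnorm a ^+ (2 ^ r).
Proof. by elim: r => [//|r IH]; rewrite /= cnorm_star_mul IH -exprM -expnSr. Qed.

End cstar_facts.

(** * Norms recovered from moments of the trace *)

Section isometry.
Variable R : realType.

Lemma embedding_star_power (X Y : tracialAlg R) (phi : embedding X Y) (a : X) r :
  phi (star_power a r) = star_power (phi a) r.
Proof. by elim: r => [//|r IH] ; rewrite [LHS]rmorphM /= emb_star IH. Qed.

Variable (nu : exponents).

Lemma modulus_trace (X : tracialAlg R) (a : X) : class_nu nu X ->
  modulus (tr X a) <= cnorm a.
Proof.
move=> [n [tau [htau [_ _ EX]]]]; move: EX a => -> f.
change (modulus (tau f) <= cm_norm f).
(* rotate the trace of f to be real *)
have mmu := trace_mean_mean htau.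
set z := tau f; have [->|z0] := eqVneq z 0; first by rewrite modulus0 cm_norm_ge0.
have mz0 : modulus z != 0 by apply: contra_neq z0 => /modulus0_eq0.
pose c : Cx R := z^* * (((modulus z)^-1)%:C)%C.
have mc : modulus c = 1.
  by rewrite modulusM modulusC modulus_real ger0_norm ?invr_ge0 ?modulus_ge0// divff.
have E : tau (c *: f) = ((modulus z)%:C)%C.
  rewrite linearZ /= -/z /c mulrAC sqr_modulus -rmorphM /= expr2 mulfK//.
have -> : modulus z = complex.Re (tau (c *: f)) by rewrite E.
rewrite (trace_meanE htau) /=.
rewrite -(mean_cst mmu (cm_norm f)); apply: (mean_le mmu).
- exact: reT_continuous.
- exact: cst_continuous.
move=> x _; rewrite /reT; apply: (le_trans (ler_norm _)).
apply: (le_trans (modulus_Re _)); apply: (le_trans (modulus_ntr _)).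
by rewrite contMxZ opnormZ mc mul1r opnorm_le_cm_norm.
Qed.

Lemma opnorm_star_power (n : nat) (f : contMx R n) r t :
  opnorm (star_power f r t) = opnorm (f t) ^+ (2 ^ r).
Proof.
elim: r => [//|r IH].
have E (g : contMx R n) :
    @contMx_fun R n (@GRing.mul (contMx R n : cstarAlgType R) (star g) g) t = adjoint (g t) *m g t by [].
by rewrite [star_power f r.+1]/= E opnorm_adjoint_mul IH -exprM -expnSr.
Qed.

(* For a faithful trace the norm is detected by the moments
   [tr ((a^* a) ^ (2 ^ r))]. *)
Lemma moment_lower (X : tracialAlg R) (a : X) (c : R) : class_nu nu X ->
  0 < c -> c < cnorm a ->
  exists2 d : R, 0 < d & forall r, d * c ^+ (2 ^ r.+1) <= modulus (tr X (star_power a r.+1)).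
Proof.
move=> [n [tau [htau [_ ft EX]]]]; move: EX a => -> f c0.
change (c < cm_norm f -> exists2 d : R, 0 < d & forall r, d * c ^+ (2 ^ r.+1) <=
  modulus (tau (star_power f r.+1))) => cf.
have mmu := trace_mean_mean htau; have fmu := trace_mean_faithful htau ft.
set mu := trace_mean tau in mmu fmu.
have [t0 ct] : exists t, c < opnorm (f t).
  apply/not_existsP => h; move: cf; rewrite ltNge => /negP; apply.
  by apply: cm_norm_le => t; rewrite leNgt; apply/negP; exact: h.
(* A nonnegative function supported where the norm of f exceeds c; faithfulness makes its mean
   positive. *)
pose b (x : R) := Num.max 0 (opnorm (f (clamp x)) - c).
have cb : continuous b.
  move=> x; apply: (@continuous_max R R (fun=> 0) (fun x => opnorm (f (clamp x)) - c)).
    exact: cst_continuous.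
  apply: continuousB; last exact: cst_continuous.
  apply: (@cm_lip_continuous R n f (fun A => opnorm A) 1) => // A B.
  rewrite mul1r; have := opnormD (A - B) B; have := opnormD (B - A) A.
  by rewrite !subrK -(opnormN (B - A)) opprB ler_norml; lra.
have b0 x : 0 <= b x by rewrite le_max lexx.
have N0 : 0 < cm_norm f by exact: lt_trans cf.
have mub : 0 < mu b.
  rewrite lt_def (mean_ge0 mmu cb) ?andbT; last by move=> x _; exact: b0.
  apply/eqP => /(fmu _ cb (fun x _ => b0 x))/(_ (set_val t0) (I01_itv t0)).
  by rewrite /b clampK => /eqP; rewrite gt_eqF// lt_max subr_gt0 ct orbT.
(* The factor n + 1 is the loss in [opnorm_hs]; dividing by the norm of f makes [b] at most 1. *)
exists (mu b / (cm_norm f * n.+1%:R)); first by rewrite divr_gt0// mulr_gt0// ltr0n.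
move=> r; rewrite (trace_meanE htau) -/mu.
rewrite [star_power f r.+1]/= mean_trace_star_mul modulus_real.
apply: le_trans (ler_norm _).
have -> : mu b / (cm_norm f * n.+1%:R) * c ^+ (2 ^ r.+1) =
   (c ^+ (2 ^ r.+1) / (cm_norm f * n.+1%:R)) * mu b by ring.
rewrite -(meanZ mmu)//; apply: (mean_le mmu); [exact: continuous_scale|exact: hs_continuous|].
move=> x _; rewrite invfM mulrA mulrAC ler_pdivrMr ?ltr0n// [leRHS]mulrC.
apply: le_trans (opnorm_hs _); rewrite opnorm_star_power -exprM -expnSr.
rewrite mulrAC ler_pdivrMr// /b.
have [h|h] := leP (opnorm (f (clamp x)) - c) 0.
  by rewrite mulr0 mulr_ge0 ?exprn_ge0 ?opnorm_ge0// ltW.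
have h1 : opnorm (f (clamp x)) - c <= cm_norm f.
  by rewrite lerBlDr ler_wpDr ?opnorm_le_cm_norm// ltW.
apply: ler_pM => //; rewrite ?exprn_ge0 ?(ltW c0) ?(ltW h)//.
by rewrite lerXn2r ?nnegrE ?opnorm_ge0 ?(ltW c0)//; move: h; rewrite subr_gt0 => /ltW.
Qed.

(** If c lay strictly between the two norms, the moments would be at least d c^(2^r) by
    [moment_lower] and at most [cnorm b] to the same power, which is impossible for large r. *)
Lemma norm_le_of_moments (X Y : tracialAlg R) (a : X) (b : Y) :
  class_nu nu X -> class_nu nu Y ->
  (forall r, tr X (star_power a r) = tr Y (star_power b r)) -> cnorm a <= cnorm b.
Proof.
move=> hX hY hab; rewrite leNgt; apply/negP => ba.
pose c := (cnorm a + cnorm b) / 2.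
have b0 := cnorm_ge0 b; have bc : cnorm b < c by rewrite /c; lra.
have ca : c < cnorm a by rewrite /c; lra.
have c0 : 0 < c := le_lt_trans b0 bc.
have [d d0 hd] := moment_lower hX c0 ca.
pose q := cnorm b / c.
have q0 : 0 <= q by apply: divr_ge0 => //; exact: ltW.
have q1 : `|q| < 1.
  by rewrite ger0_norm// /q ltr_pdivrMr// mul1r.
have /cvgrPdist_lt/(_ d d0)[N _ hN] := cvg_expr q1.
have := hN (2 ^ N.+1)%N (ltnW (leq_trans (ltnSn N) (ltnW (ltn_expl N.+1 (ltnSn 1))))).
rewrite /= sub0r normrN normrX (ger0_norm q0) ltNge => /negP; apply.
rewrite /q expr_div_n ler_pdivlMr ?exprn_gt0//; apply: (le_trans (hd N)).
by rewrite hab -cnorm_star_power; apply: modulus_trace.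
Qed.

Lemma embedding_isometry (X Y : tracialAlg R) (phi : embedding X Y) (a : X) :
  class_nu nu X -> class_nu nu Y -> cnorm (phi a) = cnorm a.
Proof.
move=> hX hY; apply/eqP; rewrite eq_le.
rewrite (norm_le_of_moments hY hX) ?(norm_le_of_moments hX hY)// => r.
  by rewrite -embedding_star_power emb_tr.
by rewrite -embedding_star_power emb_tr.
Qed.

End isometry.

Section distances.
Variables (R : realType) (K : tracialAlg R -> Prop).

Lemma dist_class_le n (x y : pointed R n) (Z : tracialAlg R)
    (f : embedding x Z) (g : embedding y Z) (r : R) : K Z -> 0 <= r ->
  (forall i, cnorm (f (tnth (pt_tuple x) i) - g (tnth (pt_tuple y) i)) <= r) ->
  dist_class K x y <= r.
Proof.
move=> KZ r0 fg; apply: (@le_trans _ _ (\big[Num.max/0]_(i < n)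
    cnorm (f (tnth (pt_tuple x) i) - g (tnth (pt_tuple y) i)))).
  apply: ge_inf; last by exists Z, f, g.
  exists 0 => _ [Z' [f' [g' [_ ->]]]].
  by elim/big_rec: _ => // i u _ u0; rewrite le_max u0 orbT.
by elim/big_rec: _ => // i u _ u0; rewrite ge_max fg.
Qed.

(** Joint embedding makes the set under the infimum nonempty, so a small infimum really provides a
    common extension and is not the default value of [inf]. *)
Lemma dist_class_lt n (x y : pointed R n) (r : R) : JEP K -> K x -> K y ->
  dist_class K x y < r -> exists (Z : tracialAlg R) (f : embedding x Z) (g : embedding y Z),
    K Z /\ forall i, cnorm (f (tnth (pt_tuple x) i) - g (tnth (pt_tuple y) i)) < r.
Proof.
move=> jep Kx Ky; apply: contraPP => h; apply/negP; rewrite -leNgt.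
apply: lb_le_inf.
  have [Z [KZ [f] [g]]] := jep _ _ Kx Ky.
  by eexists; exists Z, f, g; split.
move=> _ [Z [f [g [KZ ->]]]]; rewrite leNgt; apply/negP => lt.
apply: h; exists Z, f, g; split=> // i; apply: le_lt_trans lt.
by rewrite (bigD1 i)//= le_max lexx.
Qed.

End distances.

Section cauchy_continuity.
Variables (R : realType) (nu : exponents).
Local Notation K := (@class_nu R nu).

Lemma class_nu_CCP_pred : CCP_pred K.
Proof.
have jep : JEP K := @class_nu_JEP R nu.
move=> P m u hu cu e e0; have e2 : 0 < e / 2 by rewrite divr_gt0.
have [N hN] := cu _ e2; exists N => i j Ni Nj.
have [Z [f [g [KZ fg]]]] := dist_class_lt jep (hu i).1 (hu j).1 (hN i j Ni Nj).
case: P u hu {cu hN} f g fg => u hu f g fg; rewrite /pred_interp /first_block !tnth_mktuple.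
  set x0 := tnth _ _; set x1 := tnth _ _; set y0 := tnth _ _; set y1 := tnth _ _.
  rewrite -rmorphB modulus_real.
  rewrite -(embedding_isometry f _ (hu i).1 KZ) -(embedding_isometry g _ (hu j).1 KZ).
  apply: (le_lt_trans (cnorm_dist_le _ _)).
  have -> : f (x0 - x1) - g (y0 - y1) = (f x0 - g y0) - (f x1 - g y1).
    have fB a b : f (a - b) = f a - f b by exact: raddfB.
    have gB a b : g (a - b) = g a - g b by exact: raddfB.
    by rewrite fB gB opprD addrACA -opprD.
  apply: (le_lt_trans (cnormD _ _)); rewrite cnormN (splitr e).
  by apply: ltrD; exact: fg.
rewrite -(emb_tr f) -(emb_tr g) -raddfB /=.
apply: (le_lt_trans (modulus_trace _ KZ)); apply: lt_trans (fg _) _.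
by rewrite ltr_pdivrMr// ltr_pMr// ltr1n.
Qed.

Lemma emb_fun_interp (X Y : tracialAlg R) (f : embedding X Y) (F : fun_symbol R)
    (a : (fun_arity F).-tuple X) :
  f (fun_interp a) = fun_interp [tuple f (tnth a k) | k < fun_arity F].
Proof.
case: F a => [||c|||] a /=; rewrite ?tnth_mktuple.
- exact: raddfD.
- exact: rmorphM.
- exact: linearZ.
- exact: emb_star.
- exact: raddf0.
- exact: rmorph1.
Qed.

Lemma fun_interp_uniform (F : fun_symbol R) (C e : R) : 0 < e -> 0 <= C ->
  exists2 d : R, 0 < d & forall (Z : tracialAlg R) (a b : (fun_arity F).-tuple Z),
    (forall k, cnorm (tnth a k) <= C) -> (forall k, cnorm (tnth b k) <= C) ->
    (forall k, cnorm (tnth a k - tnth b k) <= d) ->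
    cnorm (fun_interp a - fun_interp b) <= e.
Proof.
move=> e0 C0; case: F => [||c|||] /=.
- exists (e / 2); rewrite ?divr_gt0// => Z a b _ _ ab.
  by rewrite opprD addrACA (splitr e); apply: (le_trans (cnormD _ _)); exact: lerD.
- have C1 : 0 < 2 * (C + 1) by rewrite mulr_gt0// ltr_wpDl.
  exists (e / (2 * (C + 1))); rewrite ?divr_gt0// => Z a b aC bC ab.
  set a0 := tnth a _; set a1 := tnth a _; set b0 := tnth b _; set b1 := tnth b _.
  have -> : a0 * a1 - b0 * b1 = a0 * (a1 - b1) + (a0 - b0) * b1.
    by rewrite mulrBr mulrBl subrKA.
  apply: (le_trans (cnormD _ _)).
  have h1 : cnorm (a0 * (a1 - b1)) <= (C + 1) * (e / (2 * (C + 1))).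
    apply: (le_trans (cnormM _ _)); apply: ler_pM; rewrite ?cnorm_ge0//; last exact: ab.
    by apply: (le_trans (aC _)); rewrite lerDl.
  have h2 : cnorm ((a0 - b0) * b1) <= (e / (2 * (C + 1))) * (C + 1).
    apply: (le_trans (cnormM _ _)); apply: ler_pM; rewrite ?cnorm_ge0//; first exact: ab.
    by apply: (le_trans (bC _)); rewrite lerDl.
  apply: (le_trans (lerD h1 h2)); rewrite le_eqVlt; apply/orP; left; apply/eqP.
  by field; rewrite gt_eqF// ltr_wpDl.
- have c0 := modulus_ge0 c; have c1 : 0 < modulus c + 1 by rewrite ltr_wpDl.
  exists (e / (modulus c + 1)); rewrite ?divr_gt0// => Z a b _ _ ab.
  rewrite -scalerBr cnormZ; apply: (@le_trans _ _ ((modulus c + 1) * (e / (modulus c + 1)))).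
    by apply: ler_pM => //; rewrite ?cnorm_ge0// lerDl.
  by rewrite mulrC divfK// gt_eqF.
- exists e => // Z a b _ _ ab; have -> : star (tnth a ord0) - star (tnth b ord0) =
      star (tnth a ord0 - tnth b ord0).
    by rewrite starD -[in RHS]scaleN1r starZ rmorphN1 scaleN1r.
  by rewrite cnorm_star.
- by exists 1 => // Z a b _ _ _; rewrite subrr cnorm0 ltW.
- by exists 1 => // Z a b _ _ _; rewrite subrr cnorm0 ltW.
Qed.

Lemma tnth_rcons_last (T : Type) (n : nat) (s : n.-tuple T) (x : T) :
  tnth [tuple of rcons s x] ord_max = x.
Proof. by rewrite (tnth_nth x) /= nth_rcons size_tuple ltnn eqxx. Qed.

Lemma tnth_rcons_widen (T : Type) (n : nat) (s : n.-tuple T) (x : T) (i : 'I_n) :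
  tnth [tuple of rcons s x] (widen_ord (leqnSn n) i) = tnth s i.
Proof. by rewrite !(tnth_nth x) /= nth_rcons size_tuple ltn_ord. Qed.

Lemma class_nu_CCP_fun : CCP_fun K.
Proof.
have jep : JEP K := @class_nu_JEP R nu.
move=> F m u hu cu e e0; have e2 : 0 < e / 2 by rewrite divr_gt0.
have [N1 hN1] := cu 1 ltr01.
(* From [N1] on the tuples are within 1 of that of [u N1], so [C] bounds all their entries.
   Multiplication is uniformly continuous only on bounded sets. *)
pose C := 1 + \sum_k cnorm (tnth (pt_tuple (u N1)) k).
have C0 : 0 <= C by rewrite addr_ge0// sumr_ge0// => k _; exact: cnorm_ge0.
have bound i k : (N1 <= i)%N -> cnorm (tnth (pt_tuple (u i)) k) <= C.
  move=> Ni; have [Z [f [g [KZ fg]]]] :=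
    dist_class_lt jep (hu i).1 (hu N1).1 (hN1 i N1 Ni (leqnn _)).
  rewrite -(embedding_isometry f _ (hu i).1 KZ).
  have := cnormD (f (tnth (pt_tuple (u i)) k) - g (tnth (pt_tuple (u N1)) k))
                 (g (tnth (pt_tuple (u N1)) k)).
  rewrite subrK => /le_trans; apply; apply: lerD; first exact: ltW (fg k).
  rewrite (embedding_isometry g _ (hu N1).1 KZ) (bigD1 k)//= lerDl sumr_ge0// => j _.
  exact: cnorm_ge0.
have [d d0 hd] := fun_interp_uniform F e2 C0.
have m0 : 0 < Num.min d (e / 2) by rewrite lt_min d0.
have [N2 hN2] := cu _ m0.
exists (maxn N1 N2) => i j; rewrite !geq_max => /andP[i1 i2] /andP[j1 j2].
have [Z [f [g [KZ fg]]]] := dist_class_lt jep (hu i).1 (hu j).1 (hN2 i j i2 j2).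
apply: (@le_lt_trans _ _ (e / 2)); last by rewrite ltr_pdivrMr// ltr_pMr// ltr1n.
apply: (@dist_class_le R K _ (append_fun (u i)) (append_fun (u j)) Z f g) => //; first exact: ltW.
move=> k; have [ek|] := eqVneq k ord_max.
  rewrite ek !tnth_rcons_last !emb_fun_interp; apply: hd => l; rewrite !tnth_mktuple.
  - by rewrite (embedding_isometry f _ (hu i).1 KZ) bound.
  - by rewrite (embedding_isometry g _ (hu j).1 KZ) bound.
  - by apply: ltW; apply: lt_le_trans (fg _) _; rewrite ge_min lexx.
move=> kmax; have kn : (k < fun_arity F + m)%N.
  by rewrite ltn_neqAle -ltnS ltn_ord andbT; apply: contra_neq kmax => h; exact: val_inj.
have -> : k = widen_ord (leqnSn _) (Ordinal kn) by exact: val_inj.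
rewrite !tnth_rcons_widen; apply: ltW; apply: lt_le_trans (fg _) _.
by rewrite ge_min lexx orbT.
Qed.

End cauchy_continuity.

(** * Separability through finite samples *)

Section separability.
Variables (R : realType) (nu : exponents).
Local Notation K := (@class_nu R nu).

(** Rounded real and imaginary parts of all entries at the nodes j / (N + 1), j <= N + 1. The scale
    (k + 1)(L + 1)^2 absorbs the sum over the (L + 1)^2 entries that bounds the operator norm. *)
Definition sample (n L k N : nat) (a : n.-tuple (contMx R L)) : seq int :=
  [seq let f := tnth a p.1.1.1 in
       let z := f (clamp ((nat_of_ord p.1.1.2)%:R / N.+1%:R)) p.1.2.1 p.1.2.2 in
       Num.floor ((if p.2 then complex.Re z else complex.Im z) *
                  (k.+1 * (L.+1 * L.+1))%:R)
   | p <- enum {: 'I_n * 'I_N.+2 * ('I_L.+1 * 'I_L.+1) * bool}].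

Definition oscillation_le (n L k N : nat) (a : n.-tuple (contMx R L)) : Prop :=
  forall i (s t : I01 R), `|set_val s - set_val t : R| <= N.+1%:R^-1 ->
    opnorm (tnth a i s - tnth a i t) <= k.+1%:R^-1.

Lemma floor_eq_dist (x y : R) : Num.floor x = Num.floor y -> `|x - y| <= 1.
Proof.
move=> xy; have := floor_itv x; have := floor_itv y; rewrite xy intrD.
by rewrite ler_norml; lra.
Qed.

(** The constant is 1 + 2 + 1: the oscillation of each tuple between t and the nearest node, and at
    the node one unit each for real and imaginary parts. *)
Lemma sample_near (n L k N : nat) (a b : n.-tuple (contMx R L)) :
  oscillation_le k N a -> oscillation_le k N b -> sample k N a = sample k N b ->
  forall i, cm_norm (tnth a i - tnth b i) <= 4 * k.+1%:R^-1.
Proof.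
move=> oa ob ab i; apply: cm_norm_le => t.
have [j tj] := node_near N (I01_itv t).
pose s := clamp (j%:R / N.+1%:R) : I01 R.
have sE : set_val s = j%:R / N.+1%:R :> R by apply: clampE; apply: node_itv; rewrite -ltnS.
have st : `|set_val t - set_val s : R| <= N.+1%:R^-1 by rewrite sE.
have h1 := oa i _ _ st; have h2 := ob i _ _ st.
have h3 : opnorm (tnth a i s - tnth b i s) <= 2 * k.+1%:R^-1.
  apply: (le_trans (opnorm_le_sum _)).
  have D0 : 0 < (k.+1 * (L.+1 * L.+1))%:R :> R by rewrite ltr0n.
  apply: (@le_trans _ _ (\sum_(c < L.+1) \sum_(l < L.+1) 2 * (k.+1 * (L.+1 * L.+1))%:R^-1)).
    apply: ler_sum => c _; apply: ler_sum => l _.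
    have ent (v : bool) : `|(if v then complex.Re (tnth a i s c l) else complex.Im (tnth a i s c l)) -
        (if v then complex.Re (tnth b i s c l) else complex.Im (tnth b i s c l))| <=
        (k.+1 * (L.+1 * L.+1))%:R^-1.
      move/eq_in_map: ab => /(_ (i, j, (c, l), v)); rewrite mem_enum => /(_ isT) /=.
      move=> /floor_eq_dist; rewrite -mulrBl normrM (gtr0_norm D0) -ler_pdivlMr// mul1r.
      by [].
    apply: (le_trans (modulus_le _)).
    rewrite !mxE !raddfB /= mulr_natl mulr2n; apply: lerD; [exact: (ent true)|exact: (ent false)].
  rewrite !sumr_const !card_ord -!mulrnA -[_ *+ _]mulr_natr -mulrA ler_wpM2l//.
  by rewrite natrM invfM -mulrA mulVf ?mulr1// pnatr_eq0 muln_eq0.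
have -> : (tnth a i - tnth b i : contMx R L) t =
    (tnth a i t - tnth a i s) + (tnth a i s - tnth b i s) - (tnth b i t - tnth b i s).
  by rewrite subrKA opprB subrKA.
apply: (le_trans (opnormD _ _)); rewrite opnormN.
have := opnormD (tnth a i t - tnth a i s) (tnth a i s - tnth b i s).
by move: h1 h2 h3; move: (k.+1%:R^-1) => w; lra.
Qed.

Lemma oscillation_exists (n L k : nat) (a : n.-tuple (contMx R L)) :
  exists N, oscillation_le k N a.
Proof.
have k0 : 0 < k.+1%:R^-1 :> R by rewrite invr_gt0 ltr0n.
have hd i : exists N : nat, forall M : nat, (N <= M)%N ->
    forall s t : I01 R, `|set_val s - set_val t : R| <= M.+1%:R^-1 ->
    opnorm (tnth a i s - tnth a i t) <= k.+1%:R^-1.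
  have [d d0 hd] := cm_uniform (tnth a i) k0.
  have [N hN] := archi_inv d0; exists N => M NM s t st.
  by apply: hd; apply: (le_trans st); exact: hN.
have [N hN] := choice hd.
exists (\max_i N i) => i; apply: hN; exact: leq_bigmax.
Qed.

(** A code retains only the Lebesgue target and finite data, so codes form a countable type;
    structures sharing a code embed into the same target, where their generators are close. *)
Definition coded n (x : pointed R n) (c : nat * nat * nat * seq int) : Prop :=
  let: (L, k, N, s) := c in
  exists2 f : embedding x (lebesgue_alg R L), formally_divides L.+1 nu &
    let a : n.-tuple (contMx R L) := [tuple (f (tnth (pt_tuple x) i) : contMx R L) | i < n] in
    oscillation_le k N a /\ sample k N a = s.

Lemma coded_near n (x y : pointed R n) L k N s :
  coded x (L, k, N, s) -> coded y (L, k, N, s) -> dist_class K x y <= 4 * k.+1%:R^-1.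
Proof.
move=> [f hL [of_ sf]] [g _ [og sg]].
apply: (dist_class_le (f := f) (g := g)); first exact: lebesgue_alg_class.
  by rewrite mulr_ge0// invr_ge0.
move=> i; have := sample_near of_ og (etrans sf (esym sg)) i.
by rewrite !tnth_mktuple.
Qed.

Lemma coded_exists n (x : pointed R n) k : K x -> exists L N s, coded x (L, k, N, s).
Proof.
case: x => X a /= [L [tau [htau [hL ft EX]]]]; move: EX a => -> a.
have [f] := lebesgue_embedding htau ft (dvdnn L.+1).
pose b : n.-tuple (contMx R L) := [tuple (f (tnth a i) : contMx R L) | i < n].
have [N hN] := oscillation_exists k b.
by exists L, N, (sample k N b), f.
Qed.

Lemma class_nu_WPP : WPP K.
Proof.
(* For each code realized in the class one realizing structure is chosen, so the dense sequence
   stays in the class; other codes give [None]. *)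
move=> n; pose pick (c : nat * nat * nat * seq int) : option (pointed R n) :=
  if pselect (exists x, pointed_class K x /\ coded x c) is left h
  then Some (projT1 (cid h)) else None.
exists (fun j => obind pick (unpickle j)); split.
  move=> j y; case: (unpickle j) => //= c; rewrite /pick.
  by case: pselect => // h [<-]; case: (cid h) => z [].
(* The bound used is e / 8, so that 4 / (k + 1) is at most e / 2. *)
move=> x hx e e0; have [k /(_ k (leqnn _)) hk] := archi_inv (divr_gt0 e0 (ltr0Sn R 7)).
have [L [N [s cx]]] := coded_exists k hx.1.
exists (pickle (L, k, N, s)); rewrite pickleK /= /pick.
case: pselect => [h|]; last by case; exists x.
exists (projT1 (cid h)); split=> //; case: (cid h) => y [_ cy] /=.
apply: (le_lt_trans (coded_near cx cy)).
by move: hk; move: (k.+1%:R^-1) => w; lra.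
Qed.

End separability.

(** * Finite generation *)

Section bernstein.
Variables (R : realType).
Implicit Types (x c d : R) (g : nat -> R).

(* The n-th Bernstein polynomial of the sequence [g] of nodal values, computed
   by conditioning on the first of n Bernoulli trials. *)
Fixpoint bern (k : nat) g x : R :=
  if k is k'.+1 then x * bern k' (fun i => g i.+1) x + (1 - x) * bern k' g x else g 0%N.

Lemma bern_le k g1 g2 x : 0 <= x <= 1 -> (forall i, g1 i <= g2 i) ->
  bern k g1 x <= bern k g2 x.
Proof.
move=> /andP[x0 x1]; elim: k g1 g2 => [|k IH] g1 g2 g12 /=; first exact: g12.
by apply: lerD; apply: ler_wpM2l; rewrite ?subr_ge0//; exact: IH.
Qed.

Lemma bern_affine k g x c d : bern k (fun i => c + d * g i) x = c + d * bern k g x.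
Proof.
elim: k g => [//|k IH] g /=; rewrite !IH; ring.
Qed.

(** The second moment of a binomial variable about -c. The shift varies along the induction; c = -k
    x leaves the variance. *)
Lemma bern_variance k x c :
  bern k (fun i => (i%:R + c) ^+ 2) x = k%:R * x * (1 - x) + (k%:R * x + c) ^+ 2.
Proof.
elim: k c => [|k IH] c; first by rewrite /= !mul0r !add0r.
have E : (fun i : nat => (i.+1%:R + c) ^+ 2) = (fun i : nat => (i%:R + (1 + c)) ^+ 2).
  by apply/funext => i; rewrite -natr1 addrA.
rewrite /= E !IH -natr1; ring.
Qed.

Variable n : nat.

Definition coordinate : contMx R n := scal n id.

Lemma coordinateE t : coordinate t = ((set_val t)%:C)%C%:M.
Proof. by rewrite scalE// => x; exact: cvg_id. Qed.

Fixpoint bern_cm (k : nat) (g : nat -> 'M[Cx R]_n.+1) : contMx R n :=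
  if k is k'.+1 then coordinate * bern_cm k' (fun i => g i.+1) +
                     (1 - coordinate) * bern_cm k' g
  else cmat (g 0%N).

(** Each step of the recursion is a convex combination with weights x and 1 - x, so the matrix
    polynomial is controlled by the scalar one of the distances to B. *)
Lemma bern_cm_near k (g : nat -> 'M[Cx R]_n.+1) B t :
  opnorm (bern_cm k g t - B) <= bern k (fun i => opnorm (g i - B)) (set_val t).
Proof.
have /andP[x0 x1] := I01_itv t; elim: k g => [|k IH] g; first exact: lexx.
have E : bern_cm k.+1 g t - B =
    ((set_val t)%:C)%C *: (bern_cm k (fun i => g i.+1) t - B) +
    ((1 - set_val t)%:C)%C *: (bern_cm k g t - B).
  rewrite [bern_cm k.+1 g]/= contMxD !contMxM.
  have -> : (1 - coordinate : contMx R n) t = ((1 - set_val t)%:C)%C%:M.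
    rewrite -[RHS](_ : 1%:M - ((set_val t)%:C)%C%:M = _); last by rewrite rmorphB raddfB rmorph1.
    by rewrite -coordinateE.
  rewrite coordinateE !mul_scalar_mx !scalerBr addrACA -opprD -scalerDl -rmorphD /=.
  by rewrite [set_val t + _]addrC subrK scale1r.
rewrite E; apply: (le_trans (opnormD _ _)); rewrite !opnormZ !modulus_real.
by rewrite !ger0_norm ?subr_ge0// lerD// ler_wpM2l ?subr_ge0.
Qed.

Lemma bernstein_dense (f : contMx R n) (e : R) : 0 < e ->
  exists k, cm_norm (f - bern_cm k (fun i => f (clamp (i%:R / k%:R)))) <= e.
Proof.
move=> e0; have e2 : 0 < e / 2 by rewrite divr_gt0.
have [d d0 fd] := cm_uniform f e2.
(* Chebyshev's estimate: farther than d from x, the crude bound by twice the norm of f is at most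
   [C] times the squared distance, whose mean is a binomial variance. *)
pose C := 2 * cm_norm f / d ^+ 2.
have C0 : 0 <= C by rewrite divr_ge0 ?sqr_ge0// mulr_ge0 ?cm_norm_ge0.
have C1 : 0 < C + 1 by rewrite ltr_wpDl.
have [N /(_ N (leqnn _)) hN] := archi_inv (divr_gt0 e2 C1).
exists N.+1; apply: cm_norm_le => t.
have N0 : 0 < N.+1%:R :> R by rewrite ltr0n.
have /andP[x0 x1] := I01_itv t; set x : R := set_val t in x0 x1.
have nodes (i : nat) : opnorm (f (clamp (i%:R / N.+1%:R)) - f t) <=
    e / 2 + C / N.+1%:R ^+ 2 * (i%:R + (- (N.+1%:R * x))) ^+ 2.
  have -> : C / N.+1%:R ^+ 2 * (i%:R + (- (N.+1%:R * x))) ^+ 2 = C * (i%:R / N.+1%:R - x) ^+ 2.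
    by field; rewrite gt_eqF.
  have [h|h] := leP `|set_val (clamp (i%:R / N.+1%:R)) - x| d.
    by apply: (le_trans (fd _ _ h)); rewrite lerDl mulr_ge0// sqr_ge0.
  have h1 : d ^+ 2 <= (i%:R / N.+1%:R - x) ^+ 2.
    rewrite -[leRHS]real_normK ?num_real// ler_pXn2r ?nnegrE ?(ltW d0)//.
    apply: (le_trans (ltW h)); rewrite -{1}[x](clampE (I01_itv t)).
    exact: clamp_lip.
  have h2 : opnorm (f (clamp (i%:R / N.+1%:R)) - f t) <= C * d ^+ 2.
    rewrite /C divfK ?gt_eqF ?exprn_gt0//.
    have -> : 2 * cm_norm f = cm_norm f + cm_norm f by ring.
    apply: (le_trans (opnormD _ _)); rewrite opnormN.
    by apply: lerD; exact: opnorm_le_cm_norm.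
  apply: (le_trans h2); apply: (@le_trans _ _ (C * (i%:R / N.+1%:R - x) ^+ 2)).
    by rewrite ler_wpM2l.
  by rewrite lerDr ltW.
have := bern_cm_near N.+1 (fun i => f (clamp (i%:R / N.+1%:R))) (f t) t.
have x01 : 0 <= x <= 1 by rewrite x0.
move=> /le_trans /(_ (bern_le N.+1 x01 nodes)).
rewrite bern_affine bern_variance subrr expr0n addr0 => h.
have -> : (f - bern_cm N.+1 (fun i => f (clamp (i%:R / N.+1%:R))) : contMx R n) t =
    - (bern_cm N.+1 (fun i => f (clamp (i%:R / N.+1%:R))) t - f t).
  by rewrite opprB.
rewrite opnormN; apply: (le_trans h).
have -> : C / N.+1%:R ^+ 2 * (N.+1%:R * x * (1 - x)) = C * (x * (1 - x)) * N.+1%:R^-1.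
  by field; rewrite gt_eqF.
have xx : x * (1 - x) <= 1 by nra.
have xx0 : 0 <= x * (1 - x) by rewrite mulr_ge0// subr_ge0.
have : C * (x * (1 - x)) * N.+1%:R^-1 <= (C + 1) * (e / 2 / (C + 1)).
  apply: ler_pM => //; first by rewrite mulr_ge0.
  by rewrite (@le_trans _ _ (C * 1)) ?ler_wpM2l// mulr1 lerDl.
by rewrite [(C + 1) * _]mulrC divfK ?gt_eqF//; move: (C * _ * _) => w; lra.
Qed.

End bernstein.

Section finite_generation.
Variables (R : realType) (n : nat).

Definition generators : seq (contMx R n) :=
  coordinate R n :: [seq cmat (delta_mx p.1 p.2) | p <- enum {: 'I_n.+1 * 'I_n.+1}].

Lemma generates_contMx : @generates R (contMx R n) _ (in_tuple generators).
Proof.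
rewrite /generates predeqE => f; split=> // _ S [Ssub Sgen].
have gen x : x \in generators -> S x by exact: Sgen.
have S0 : S 0 by rewrite -(scale0r 1); apply: (csubZ Ssub); exact: csub1.
have Ssum (I : Type) (r : seq I) (F : I -> contMx R n) : (forall i, S (F i)) ->
    S (\sum_(i <- r) F i).
  by move=> SF; elim/big_rec: _ => // i x _ Sx; exact: (csubD Ssub).
have Sc A : S (cmat A).
  have -> : cmat A = \sum_i \sum_j A i j *: cmat (delta_mx i j).
    apply: contMxP => t; rewrite cmatE [LHS]matrix_sum_delta.
    elim/big_rec2: _ => // i x y _ ->; rewrite contMxD; congr (_ + _).
    by elim/big_rec2: _ => // j u v _ ->.
  apply: (Ssum) => i; apply: (Ssum) => j; apply: (csubZ Ssub); apply: gen.
  rewrite inE; apply/orP; right; apply/mapP.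
  by exists (i, j) => //; rewrite mem_enum.
have SX : S (coordinate R n) by apply: gen; rewrite inE eqxx.
have Sb k g : S (bern_cm k g).
  elim: k g => [|k IH] g /=; first exact: Sc.
  apply: (csubD Ssub); apply: (csubM Ssub) => //.
  by rewrite -scaleN1r; apply: (csubD Ssub); [exact: csub1|exact: (csubZ Ssub)].
apply: (csub_closed Ssub) => e e0.
have [k hk] := bernstein_dense f (divr_gt0 e0 (ltr0Sn R 1)).
exists (bern_cm k (fun i => f (clamp (i%:R / k%:R)))); first exact: Sb.
by apply: le_lt_trans hk _; rewrite ltr_pdivrMr// ltr_pMr// ltr1n.
Qed.

End finite_generation.

Lemma class_nu_finitely_generated (R : realType) (nu : exponents) (X : tracialAlg R) :
  class_nu nu X -> finitely_generated X.
Proof.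
move=> [n [tau [htau [_ _ ->]]]].
exists (size (generators R n)), (in_tuple (generators R n)).
exact: generates_contMx.
Qed.

(** * Representations and eigenvalues *)

Section hermitian.
Variables (R : realType) (N : nat).
Local Notation MN := 'M[Cx R]_N.+1.
Implicit Types (Y U : MN).

Lemma hermitian_diagonalization Y : adjoint Y = Y -> exists (U : MN) (d : 'I_N.+1 -> R),
  unitary U /\ Y = U *m diag_mx (\row_i ((d i)%:C)%C) *m adjoint U.
Proof.
move=> hY; have hh : Y \is hermsymmx.
  by apply/is_hermitianmxP; rewrite expr0 scale1r -[in LHS]hY.
have Pu := spectral_unitarymx Y.
have /orthomx_spectralP E := hermitian_normalmx hh.
have /mxOverP hr := hermitian_spectral_diag_real hh.
exists (adjoint (spectralmx Y)), (fun i => complex.Re (spectral_diag Y 0 i)); split.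
  by rewrite /unitary adjointK; apply/unitarymxP.
have iP : invmx (spectralmx Y) = adjoint (spectralmx Y) by exact: invmx_unitary.
have dE : spectral_diag Y = \row_i ((complex.Re (spectral_diag Y 0 i))%:C)%C.
  by apply/rowP => i; rewrite mxE; apply/esym/RRe_real; exact: hr.
by rewrite adjointK -iP -dE; exact: E.
Qed.

Lemma sorting_perm (d : 'I_N.+1 -> R) :
  exists s : {perm 'I_N.+1}, forall i j : 'I_N.+1, (i <= j)%N -> d (s i) <= d (s j).
Proof.
pose t := [tuple d i | i < N.+1].
have /tuple_permP[s sE] : perm_eq (sort <=%R t) t by rewrite perm_sort.
exists s => i j ij.
have sz : size (sort <=%R t) = N.+1 by rewrite size_sort size_tuple.
have nthE (k : 'I_N.+1) : d (s k) = nth 0 (sort <=%R t) k.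
  by rewrite sE -(tnth_nth 0 [tuple of [seq tnth t (s i) | i <- _]]) !tnth_mktuple.
rewrite !nthE; apply: (sorted_leq_nth (@le_trans _ R) (@le_refl _ R)) => //.
- by apply: sort_sorted; exact: le_total.
- by rewrite inE sz.
- by rewrite inE sz.
Qed.

Lemma sorted_eigenbasis Y : adjoint Y = Y -> exists (U : MN) (d : 'I_N.+1 -> R),
  [/\ unitary U, forall i, Y *m col i U = ((d i)%:C)%C *: col i U &
      forall i j : 'I_N.+1, (i <= j)%N -> d i <= d j].
Proof.
move=> /hermitian_diagonalization[U [d [uU E]]].
have [s hs] := sorting_perm d.
exists (col_perm s U), (d \o s); split => //.
  rewrite /unitary; apply/matrixP => i j; rewrite !mxE.
  have /matrixP/(_ (s i) (s j)) := uU; rewrite !mxE (inj_eq perm_inj) => <-.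
  by apply: eq_bigr => k _; rewrite !mxE.
move=> i; have -> : col i (col_perm s U) = col (s i) U.
  by apply/matrixP => a b; rewrite !mxE.
have YU : Y *m U = U *m diag_mx (\row_i ((d i)%:C)%C).
  by rewrite E -[_ *m adjoint U *m U]mulmxA uU mulmx1.
rewrite {1}colE mulmxA YU -colE; apply/matrixP => a b; rewrite !mxE (bigD1 (s i))//= big1 ?addr0.
  by rewrite !mxE eqxx mulr1n mulrC.
by move=> k ki; rewrite !mxE (negbTE ki) mulr0n mulr0.
Qed.

Lemma opnorm_diag_le (v : 'rV[Cx R]_N.+1) (c : R) : 0 <= c ->
  (forall i, modulus (v 0 i) <= c) -> opnorm (diag_mx v) <= c.
Proof.
move=> c0 vc; apply: opnorm_le => // x.
rewrite -(ler_pXn2r (ltn0Sn 1)) ?nnegrE ?mulr_ge0 ?vnorm_ge0//.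
rewrite exprMn !vnorm_sqr mulr_sumr; apply: ler_sum => i _.
rewrite mul_diag_mx mxE modulusM exprMn ler_wpM2r ?sqr_ge0//.
by rewrite ler_pXn2r ?nnegrE ?modulus_ge0.
Qed.

Lemma eigenbasis_diag (X U : MN) (v : 'I_N.+1 -> Cx R) : unitary U ->
  (forall i, X *m col i U = v i *: col i U) -> X = U *m diag_mx (\row_i v i) *m adjoint U.
Proof.
move=> uU XU; have E : X *m U = U *m diag_mx (\row_i v i).
  apply/matrixP => a b; have /matrixP/(_ a 0) := XU b; rewrite {1}colE mulmxA -colE !mxE => ->.
  rewrite (bigD1 b)//= big1 ?addr0 => [|k kb]; first by rewrite !mxE eqxx mulr1n mulrC.
  by rewrite !mxE (negbTE kb) mulr0n mulr0.
by rewrite -E -mulmxA (unitaryC uU) mulmx1.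
Qed.

Lemma vnorm_col (U : MN) i : unitary U -> vnorm (col i U) = 1.
Proof.
move=> uU; have : inner (col i U) (col i U) = 1.
  have /matrixP/(_ i i) := uU; rewrite !mxE eqxx /= mulr1n => <-.
  by apply: eq_bigr => k _; rewrite !mxE.
rewrite inner_vnorm => /(@complexI R) /eqP; rewrite sqrp_eq1 ?vnorm_ge0// => /eqP.
by [].
Qed.

End hermitian.

Section matrix_representations.
Variables (R : realType) (n L : nat).
Local Notation A := (contMx R n).

Record matrix_rep (pi : A -> 'M[Cx R]_L.+1) : Prop := MatrixRep {
  repD : forall f g, pi (f + g) = pi f + pi g;
  repZ : forall (c : Cx R) f, pi (c *: f) = c *: pi f;
  repM : forall f g, pi (f * g) = pi f *m pi g;
  rep1 : pi 1 = 1%:M;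
  rep_star : forall f, pi (cm_star f) = adjoint (pi f) }.

Definition munit (i j : 'I_n.+1) : A := cmat (delta_mx i j).

Lemma munitM i j k l : munit i j * munit k l = if j == k then munit i l else 0.
Proof.
apply: contMxP => t; rewrite contMxM /munit !cmatE mul_delta_mx_cond.
by case: (j == k); rewrite ?mulr1n ?mulr0n.
Qed.

Lemma munit_star i j : cm_star (munit i j) = munit j i.
Proof.
apply: contMxP => t; rewrite cm_starE /munit !cmatE.
by apply/matrixP => a b; rewrite !mxE andbC rmorph_nat.
Qed.

Lemma munit_sum : \sum_i munit i i = 1.
Proof.
apply: contMxP => t.
have -> : (\sum_i munit i i : A) t = \sum_i delta_mx i i.
  by elim/big_rec2: _ => // i x y _ <-.
exact/esym/mx1_sum_delta.
Qed.

(* Elements of the corner [e_00 A e_00], which is a copy of C([0,1]). *)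
Definition corner (b : A) := forall t, b t = b t 0 0 *: delta_mx 0 0.

Definition corner_of (h : R -> R) : A := scal n h * munit 0 0.

Lemma corner_ofE h t : continuous h -> corner_of h t = ((h (set_val t))%:C)%C *: delta_mx 0 0.
Proof. by move=> ch; rewrite contMxM scalE// mul_scalar_mx. Qed.

Lemma corner_of_corner h : continuous h -> corner (corner_of h).
Proof.
move=> ch t; rewrite corner_ofE//; congr (_ *: _).
by rewrite !mxE !eqxx mulr1.
Qed.

Lemma corner_compress (f : A) i j : corner (munit 0 i * f * munit j 0).
Proof.
move=> t; rewrite !contMxM /munit !cmatE delta_mul3; congr (_ *: _).
by rewrite !mxE !eqxx mulr1.
Qed.

Lemma corner_star_mul (b : A) t : corner b ->
  (cm_star b * b) t = ((modulus (b t 0 0) ^+ 2)%:C)%C *: delta_mx 0 0.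
Proof.
move=> cb; rewrite contMxM cm_starE {1 2}(cb t) adjointZ -scalemxAl -scalemxAr scalerA.
rewrite sqr_modulus; congr (_ *: _).
have -> : adjoint (delta_mx 0 0) = delta_mx 0 0 :> 'M[Cx R]_n.+1.
  by apply/matrixP => a b'; rewrite !mxE andbC rmorph_nat.
by rewrite mul_delta_mx.
Qed.

Section one_representation.
Variables (pi : A -> 'M[Cx R]_L.+1) (hpi : matrix_rep pi).
Implicit Types (xi : 'cV[Cx R]_L.+1) (b : A).

Lemma rep0 : pi 0 = 0.
Proof. by rewrite -(scale0r 0) (repZ hpi) scale0r. Qed.

Lemma repN f : pi (- f) = - pi f.
Proof. by rewrite -scaleN1r (repZ hpi) scaleN1r. Qed.

Lemma repB f g : pi (f - g) = pi f - pi g.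
Proof. by rewrite (repD hpi) repN. Qed.

Lemma rep_sum (I : Type) (r : seq I) (F : I -> A) :
  pi (\sum_(i <- r) F i) = \sum_(i <- r) pi (F i).
Proof.
elim: r => [|i r IH]; first by rewrite !big_nil rep0.
by rewrite !big_cons (repD hpi) IH.
Qed.

Lemma innerDr (u v w : 'cV[Cx R]_L.+1) : inner u (v + w) = inner u v + inner u w.
Proof.
by rewrite /inner -big_split; apply: eq_bigr => i _; rewrite mxE mulrDr.
Qed.

Lemma vnorm_rep b xi :
  ((vnorm (pi b *m xi) ^+ 2)%:C)%C = inner xi (pi (cm_star b * b) *m xi).
Proof.
by rewrite -inner_vnorm inner_adjoint (repM hpi) (rep_star hpi) mulmxA.
Qed.

(** The difference of the two star squares is itself a star square [w^* w] in the corner, with w the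
    square root of h^2 - |b|^2, and a representation preserves this form. *)
Lemma rep_domination b h xi : corner b -> continuous h ->
  (forall t, modulus (b t 0 0) <= `|h (set_val t)|) ->
  vnorm (pi b *m xi) <= vnorm (pi (corner_of h) *m xi).
Proof.
move=> cb ch bh.
pose k x := h x ^+ 2 - modulus (b (clamp x) 0 0) ^+ 2.
have ck : continuous k.
  apply: continuous_sub; apply: continuous_sqr => //.
  apply: (@cm_lip_continuous R n b (fun B => modulus (B 0 0)) 1) => // B C.
  rewrite mul1r; have := modulus_le_opnorm (B - C) 0 0; rewrite !mxE.
  have := modulusD (B 0 0 - C 0 0) (C 0 0); have := modulusD (C 0 0 - B 0 0) (B 0 0).
  by rewrite !subrK -(modulusN (C 0 0 - _)) opprB ler_norml; lra.
have csk : continuous (fun x => Num.sqrt (k x)).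
  by move=> x; apply: continuous_comp; [exact: ck|exact: sqrt_continuous].
set w := corner_of (fun x => Num.sqrt (k x)).
have E : cm_star (corner_of h) * corner_of h = cm_star b * b + cm_star w * w.
  apply: contMxP => t; rewrite contMxD (corner_star_mul _ (corner_of_corner ch)).
  rewrite (corner_star_mul _ cb) (corner_star_mul _ (corner_of_corner csk)).
  rewrite -scalerDl -rmorphD !corner_ofE// !mxE !eqxx !mulr1 !modulus_real.
  congr ((_%:C)%C *: _); rewrite !real_normK ?num_real// sqr_sqrtr.
    by rewrite /k clampK; ring.
  rewrite /k clampK subr_ge0 -[leRHS]real_normK ?num_real//.
  by rewrite ler_pXn2r ?nnegrE ?modulus_ge0.
suff : vnorm (pi b *m xi) ^+ 2 <= vnorm (pi (corner_of h) *m xi) ^+ 2.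
  by rewrite ler_pXn2r ?nnegrE ?vnorm_ge0.
have innerD P Q : inner xi (pi (P + Q) *m xi) = inner xi (pi P *m xi) + inner xi (pi Q *m xi).
  by rewrite (repD hpi) mulmxDl innerDr.
apply: (Cx_real_add_le _ (sqr_ge0 (vnorm (pi w *m xi)))).
exact: etrans (etrans (vnorm_rep _ xi) (congr1 (fun P => inner xi (pi P *m xi)) E))
  (etrans (innerD _ _) (esym (f_equal2 +%R (vnorm_rep b xi) (vnorm_rep w xi)))).
Qed.

(* The eigenvectors of [x + 1] in the corner diagonalize the whole corner: an
   eigenvalue [l] is either 0 or corresponds to the point evaluation at [l - 1]. *)
Lemma corner_eigenvector (l : R) xi : xi != 0 ->
  pi (corner_of (fun x => x + 1)) *m xi = (l%:C)%C *: xi ->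
  (l = 0 \/ 0 <= l - 1 <= 1) /\
  forall b, corner b ->
    pi b *m xi = (if l == 0 then 0 else b (clamp (l - 1)) 0 0) *: xi.
Proof.
move=> xi0 hl; have c1 : continuous (fun x : R => x + 1).
  by apply: continuous_add => [x|]; [exact: cvg_id|exact: cst_continuous].
have cdist (c : R) : continuous (fun x : R => x - c).
  by apply: continuous_sub => [x|]; [exact: cvg_id|exact: cst_continuous].
have zero (v : 'cV[Cx R]_L.+1) : vnorm v <= 0 -> v = 0.
  by move=> v0; apply: vnorm0_eq0; apply/eqP; rewrite eq_le v0 vnorm_ge0.
have [l0|l0] := eqVneq l 0.
  split=> [|b cb]; first by left.
  rewrite scale0r; apply: zero.
  (* Since x + 1 >= 1 on [0,1], the function B (x + 1) dominates b; a vector killed by the image of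
     x + 1 is thus killed by the whole corner. *)
  pose B := cm_norm b; have B0 : 0 <= B := cm_norm_ge0 b.
  have cB : continuous (fun x : R => B * (x + 1)) by exact: continuous_scale.
  apply: (le_trans (rep_domination _ cb cB _)).
    move=> t; have /andP[t0 _] := I01_itv t.
    rewrite ger0_norm ?mulr_ge0 ?addr_ge0//.
    apply: (le_trans (modulus_le_opnorm _ _ _)); apply: (le_trans (opnorm_le_cm_norm _ _)).
    by rewrite ler_peMr// lerDr.
  have -> : corner_of (fun x : R => B * (x + 1)) = (B%:C)%C *: corner_of (fun x => x + 1).
    apply: contMxP => t; rewrite contMxZ !corner_ofE// scalerA -rmorphM.
    by [].
  by rewrite (repZ hpi) -scalemxAl hl l0 scale0r scaler0 vnorm0.
set t0 := l - 1.
have e00 : pi (munit 0 0) *m xi = xi.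
  have E : munit 0 0 * corner_of (fun x => x + 1) = corner_of (fun x => x + 1).
    apply: contMxP => t; rewrite contMxM corner_ofE// /munit cmatE -scalemxAr.
    by rewrite mul_delta_mx.
  have /(congr1 (fun v => ((l^-1)%:C)%C *: v)) := hl.
  rewrite -E (repM hpi) -mulmxA hl -scalemxAr !scalerA -rmorphM mulVf//.
  by rewrite rmorph1 !scale1r.
have z0 : pi (corner_of (fun x => x - t0)) *m xi = 0.
  have -> : corner_of (fun x => x - t0) = corner_of (fun x => x + 1) - (l%:C)%C *: munit 0 0.
    apply: contMxP => t; rewrite -[in RHS]scaleN1r contMxD !contMxZ !corner_ofE//.
    rewrite /munit cmatE scaleN1r -scalerBl -rmorphB; congr ((_%:C)%C *: _).
    by rewrite /t0; ring.
  by rewrite repB (repZ hpi) mulmxBl hl -scalemxAl e00 subrr.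
(* Otherwise |x - t0| is at least some r > 0 on [0,1] and dominates r times [munit 0 0], which would
   force [xi] to vanish. *)
have t01 : 0 <= t0 <= 1.
  apply/negPn/negP => nt; move/negP: xi0; apply; apply/eqP.
  have [r r0 hr] : exists2 r : R, 0 < r & forall t : I01 R, r <= `|set_val t - t0|.
    have [h|h] := ltP t0 0.
      exists (- t0); rewrite ?oppr_gt0// => t; have /andP[h0 h1] := I01_itv t.
      by rewrite ger0_norm; lra.
    have h' : 1 < t0 by move: nt; rewrite h /= -ltNge.
    exists (t0 - 1); rewrite ?subr_gt0// => t; have /andP[h0 h1] := I01_itv t.
    by rewrite ler0_norm; lra.
  have cm : corner ((r%:C)%C *: munit 0 0).
    by move=> t; rewrite contMxZ /munit cmatE; congr (_ *: _); rewrite !mxE !eqxx mulr1.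
  have := rep_domination xi cm (cdist t0); rewrite z0 vnorm0 (repZ hpi) -scalemxAl e00.
  rewrite vnormZ modulus_real gtr0_norm// => h.
  apply: zero; rewrite -(pmulr_rle0 _ r0); apply: h => t.
  by rewrite contMxZ /munit cmatE !mxE !eqxx mulr1 modulus_real gtr0_norm.
split=> [|b cb]; first by right.
pose beta := b (clamp t0) 0 0; pose b0 := b - beta *: munit 0 0.
have b0E t : b0 t 0 0 = b t 0 0 - beta.
  by rewrite /b0 -scaleN1r contMxD !contMxZ /munit cmatE !mxE !eqxx /= mulr1 mulN1r.
have cb0 : corner b0.
  move=> t; rewrite b0E scalerBl -(cb t).
  have -> : b0 t = b t - (beta *: munit 0 0) t by [].
  by rewrite contMxZ.
suff : pi b0 *m xi = 0.
  move/eqP; rewrite repB (repZ hpi) mulmxBl -scalemxAl e00 subr_eq0 => /eqP ->.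
  by [].
have cabs : continuous (fun x : R => `|x - t0|).
  by move=> x; apply: cvg_norm; exact: cdist.
have zabs : pi (corner_of (fun x => `|x - t0|)) *m xi = 0.
  apply: zero; rewrite -[leRHS](vnorm0 R L) -z0; apply: rep_domination => //.
    exact: corner_of_corner.
  by move=> t; rewrite corner_ofE// !mxE !eqxx mulr1 modulus_real normr_id.
apply: zero; apply/ler_addgt0Pr => e e0; rewrite add0r.
have xp : 0 < vnorm xi.
  by rewrite lt_def vnorm_ge0 andbT; apply: contra_neq xi0 => /vnorm0_eq0.
pose r := e / vnorm xi; have r0 : 0 < r by rewrite divr_gt0.
have [d d0 hd] := cm_uniform b r0.
(* Within d of t0 the entry of [b0] is at most r; farther away C |x - t0| is at least its norm. The
   dominating function C |x - t0| + r maps [xi] to r times [xi], of norm e. *)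
pose C := cm_norm b0 / d; have C0 : 0 <= C by rewrite divr_ge0 ?cm_norm_ge0 ?ltW.
have cC : continuous (fun x : R => C * `|x - t0| + r).
  by apply: continuous_add; [exact: continuous_scale|exact: cst_continuous].
apply: (le_trans (rep_domination xi cb0 cC _)).
  move=> t; rewrite (ger0_norm (addr_ge0 (mulr_ge0 C0 (normr_ge0 _)) (ltW r0))).
  have [h|h] := leP `|set_val t - t0| d.
    apply: (@le_trans _ _ r); last by rewrite lerDr mulr_ge0.
    rewrite b0E /beta; have := hd t (clamp t0); rewrite clampE// => /(_ h).
    by apply: le_trans; have := modulus_le_opnorm (b t - b (clamp t0)) 0 0; rewrite !mxE.
  apply: (@le_trans _ _ (C * `|set_val t - t0|)); last by rewrite lerDl ltW.
  apply: (le_trans (modulus_le_opnorm _ _ _)); apply: (le_trans (opnorm_le_cm_norm _ _)).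
  apply: (@le_trans _ _ (C * d)); first by rewrite /C divfK ?gt_eqF.
  by rewrite ler_wpM2l// ltW.
have -> : corner_of (fun x : R => C * `|x - t0| + r) =
    (C%:C)%C *: corner_of (fun x => `|x - t0|) + (r%:C)%C *: munit 0 0.
  apply: contMxP => t; rewrite contMxD !contMxZ !corner_ofE// /munit cmatE scalerA.
  by rewrite -scalerDl -rmorphM -rmorphD.
rewrite (repD hpi) !(repZ hpi) mulmxDl -!scalemxAl zabs scaler0 add0r e00 vnormZ.
by rewrite modulus_real gtr0_norm// /r divfK// gt_eqF.
Qed.

(** The shift to x + 1 moves the spectrum over [0,1] into [1,2], so that the eigenvalue 0 marks the
    complement of the corner and is not confused with evaluation at 0. *)
Lemma corner_diagonalization : exists (U : 'M[Cx R]_L.+1) (d : 'I_L.+1 -> R),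
  [/\ unitary U, forall i j : 'I_L.+1, (i <= j)%N -> d i <= d j,
      forall i, d i = 0 \/ 0 <= d i - 1 <= 1 &
      forall b, corner b -> pi b = U *m diag_mx (\row_i
        (if d i == 0 then 0 else b (clamp (d i - 1)) 0 0)) *m adjoint U].
Proof.
have c1 : continuous (fun x : R => x + 1).
  by apply: continuous_add => [x|]; [exact: cvg_id|exact: cst_continuous].
have [|U [d [uU hU hd]]] := @sorted_eigenbasis R L (pi (corner_of (fun x => x + 1))).
  rewrite -(rep_star hpi); congr pi; apply: contMxP => t.
  rewrite cm_starE corner_ofE// adjointZ [X in X *: _](conjc_real _); congr (_ *: _).
  by apply/matrixP => a b'; rewrite !mxE andbC rmorph_nat.
have U0 i : col i U != 0.
  apply/eqP => /(congr1 (@vnorm R L)); rewrite vnorm_col// vnorm0 => /eqP.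
  by rewrite oner_eq0.
have key i := corner_eigenvector (U0 i) (hU i).
exists U, d; split => //; first by move=> i; have [] := key i.
by move=> b cb; apply: eigenbasis_diag => // i; have [_ ->] := key i.
Qed.

Lemma rep_munit_norm i j : opnorm (pi (munit i j)) <= 1.
Proof.
have sq : opnorm (pi (munit j j)) ^+ 2 = opnorm (pi (munit j j)).
  by rewrite -opnorm_adjoint_mul -(rep_star hpi) munit_star -(repM hpi) munitM eqxx.
have jj : opnorm (pi (munit j j)) <= 1.
  by have := opnorm_ge0 (pi (munit j j)); move: sq; nra.
have : opnorm (pi (munit i j)) ^+ 2 <= 1.
  by rewrite -opnorm_adjoint_mul -(rep_star hpi) munit_star -(repM hpi) munitM eqxx.
by rewrite expr_le1// opnorm_ge0.
Qed.

(** A scalar function is the sum of n + 1 copies of its corner element, moved by matrix units and of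
    equal trace. *)
Lemma rep_scal_trace h : continuous h ->
  ntr (pi (scal n h)) = n.+1%:R * ntr (pi (corner_of h)).
Proof.
move=> ch.
have -> : scal n h = \sum_i munit i 0 * corner_of h * munit 0 i.
  apply: contMxP => t.
  have -> : (\sum_i munit i 0 * corner_of h * munit 0 i : A) t =
      \sum_i ((h (set_val t))%:C)%C *: delta_mx i i.
    elim/big_rec2: _ => // i x y _ <-; rewrite contMxD contMxM [X in X *m _ + _]contMxM.
    by rewrite corner_ofE// /munit !cmatE -scalemxAr -scalemxAl !mul_delta_mx.
  by rewrite -scaler_sumr -mx1_sum_delta scalemx1 scalE.
rewrite rep_sum.
have -> : ntr (\sum_i pi (munit i 0 * corner_of h * munit 0 i)) =
    \sum_i ntr (pi (munit i 0 * corner_of h * munit 0 i)).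
  elim/big_rec2: _ => [|i x y _ <-]; last by rewrite ntrD.
  by rewrite -(scale0r 0) ntrZ mul0r.
rewrite (eq_bigr (fun=> ntr (pi (corner_of h)))).
  by rewrite sumr_const card_ord mulr_natl.
move=> i _; rewrite !(repM hpi) ntr_mulC mulmxA -!(repM hpi) munitM eqxx.
congr (ntr (pi _)); apply: contMxP => t; rewrite contMxM corner_ofE// /munit cmatE.
by rewrite -scalemxAr mul_delta_mx.
Qed.

End one_representation.

End matrix_representations.

(** * Comparing sorted eigenvalue lists by counting *)

Section eigenvalue_matching.
Variable R : realType.

(** If [d2 i] exceeded [d1 i + r], then at level a = [d1 i] at least i + 1 values of [d1] would be
    counted against at most i values of [d2]. *)
Lemma sorted_counting (N : nat) (d1 d2 : 'I_N -> R) (r : R) :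
  (forall i j : 'I_N, (i <= j)%N -> d1 i <= d1 j) ->
  (forall i j : 'I_N, (i <= j)%N -> d2 i <= d2 j) ->
  (forall a, (#|[pred j | (d1 j <= a)%R]| <= #|[pred j | (d2 j <= a + r)%R]|)%N) ->
  forall i, d2 i <= d1 i + r.
Proof.
move=> s1 s2 h i; rewrite leNgt; apply/negP => lt.
have := h (d1 i); apply/negP; rewrite -ltnNge.
have c (m : nat) : (m <= N)%N -> #|[pred j : 'I_N | (j < m)%N]| = m.
  move=> mN; rewrite -sum1_card (eq_bigl (fun j : 'I_N => (j < m)%N)); last first.
    by move=> j; rewrite inE.
  by rewrite (big_ord_narrow mN) sum1_card card_ord.
apply: (@leq_trans i.+1).
  rewrite ltnS -[leqRHS](c i (ltnW (ltn_ord i))); apply: subset_leq_card; apply/fintype.subsetP => j.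
  rewrite !inE => dj; rewrite ltnNge; apply/negP => ij.
  by have := s2 i j ij; rewrite leNgt (le_lt_trans dj lt).
rewrite -[leqLHS](c i.+1 (ltn_ord i)); apply: subset_leq_card; apply/fintype.subsetP => j.
by rewrite !inE ltnS => ij; exact: s1.
Qed.

Section matching.
Variables (N K : nat).
Local Notation r := (fun i : nat => ramp (i%:R / K.+1%:R) (i.+1%:R / K.+1%:R) : R -> R).

(* [weight d r] sums the values of [r] over the points encoded by the nonzero
   [d j], the point being [d j - 1]. *)
Definition weight (d : 'I_N -> R) (g : R -> R) : R :=
  \sum_j if d j == 0 then 0 else g (d j - 1).

(** Equal weights of the constant 1 mean equally many zeros. The nonzero points are counted by
    ramps, at a cost of three grid steps: rounding a - 1 up to a node, passing to the next ramp, and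
    the width of that ramp. *)
Lemma counting_of_weights (d1 d2 : 'I_N -> R) :
  (forall j, d1 j = 0 \/ 0 <= d1 j - 1 <= 1) ->
  (forall j, d2 j = 0 \/ 0 <= d2 j - 1 <= 1) ->
  weight d1 (fun=> 1) = weight d2 (fun=> 1) ->
  (forall i : nat, (i < K)%N -> weight d1 (r i) <= weight d2 (r i.+1)) ->
  forall a, (#|[pred j | (d1 j <= a)%R]| <= #|[pred j | (d2 j <= a + 3 / K.+1%:R)%R]|)%N.
Proof.
move=> h1 h2 w1 wr a; rewrite -(ler_nat R).
have K0 : 0 < K.+1%:R :> R by rewrite ltr0n.
have K3 : 0 < 3 / K.+1%:R :> R by rewrite divr_gt0.
have cardE (p : pred 'I_N) : #|[pred j | p j]|%:R = \sum_j (p j)%:R :> R.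
  rewrite -sum1_card natr_sum big_mkcond; apply: eq_bigr => j _.
  by rewrite inE; case: (p j).
have zeros : \sum_j (d1 j == 0)%:R = \sum_j (d2 j == 0)%:R :> R.
  have E (d : 'I_N -> R) : \sum_j (d j == 0)%:R = N%:R - weight d (fun=> 1).
    rewrite -[in RHS](card_ord N) -sum1_card natr_sum -sumrB; apply: eq_bigr => j _.
    by case: eqP => _; rewrite ?subr0 ?subrr.
  by rewrite !E w1.
have [a1|a1] := ltP a 1.
  have [a0|a0] := ltP a 0.
    rewrite eq_card0// => j; rewrite !inE; apply/negbTE; rewrite -ltNge.
    by case: (h1 j) => [->//|/andP[h _]]; lra.
  rewrite !cardE (eq_bigr (fun j => (d1 j == 0)%:R)).
    rewrite zeros; apply: ler_sum => j _; rewrite ler_nat; case: eqP => // ->.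
    by rewrite addr_ge0 ?(ltW K3).
  move=> j _; congr (_%:R); case: eqP => [->|/eqP d0]; first by rewrite a0.
  by case: (h1 j) => [d0'|/andP[h _]]; [rewrite d0' eqxx in d0|rewrite leNgt; have -> : a < d1 j by lra].
pose i := (Num.trunc ((a - 1) * K.+1%:R)).+1.
have a10 : 0 <= (a - 1) * K.+1%:R by rewrite mulr_ge0 ?subr_ge0// ltW.
have /andP[i1 i2] := truncn_itv a10.
have {}i1 : i%:R / K.+1%:R <= a - 1 + K.+1%:R^-1.
  by rewrite /i -natr1 mulrDl mul1r lerD2r ler_pdivrMr.
have {}i2 : a - 1 <= i%:R / K.+1%:R by rewrite ler_pdivlMr// ltW.
have rlt (k : nat) : k%:R / K.+1%:R < k.+1%:R / K.+1%:R :> R by exact: node_lt.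
have succ (k : nat) : k.+1%:R / K.+1%:R = k%:R / K.+1%:R + K.+1%:R^-1 :> R.
  by rewrite -natr1 mulrDl mul1r.
(* When i reaches K, the level a + 3 / (K + 1) is beyond 2 and all values of [d2] are counted. *)
have [iK|Ki] := ltnP i K; last first.
  rewrite [X in _ <= X%:R](_ : _ = N).
    by rewrite ler_nat -[leqRHS]card_ord max_card.
  rewrite -[RHS]card_ord; apply: eq_card => j; rewrite !inE.
  have E1 : 1 = K%:R / K.+1%:R + K.+1%:R^-1 :> R by rewrite -succ divff ?lt0r_neq0.
  have : 1 - K.+1%:R^-1 <= i%:R / K.+1%:R :> R.
    by rewrite {1}E1 addrK ler_pM2r ?invr_gt0// ler_nat.
  have w0 : 0 < K.+1%:R^-1 :> R by rewrite invr_gt0.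
  move: i1 w0; move: (K.+1%:R^-1) (i%:R / _) => w u u1 w0 u2.
  by case: (h2 j) => [->|/andP[_ h]]; lra.
apply: (@le_trans _ _ (\sum_j (d1 j == 0)%:R + weight d1 (r i))).
  rewrite cardE -big_split; apply: ler_sum => j _ /=.
  case: eqP => [_|_]; first by rewrite addr0 ler_nat leq_b1.
  rewrite add0r; have [d1a|_] := leP (d1 j) a; last exact: ramp_ge0.
  by rewrite (ramp1 (rlt i))// (le_trans _ i2)// lerD2r.
apply: (@le_trans _ _ (\sum_j (d2 j == 0)%:R + weight d2 (r i.+1))).
  by rewrite zeros lerD2l wr.
rewrite cardE -big_split; apply: ler_sum => j _ /=.
case: eqP => [->|_]; first by rewrite addr0 addr_ge0 ?(ltW K3)// (le_trans ler01).
rewrite add0r; have [h|h] := leP i.+2%:R%R (K.+1%:R * (d2 j - 1)).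
  by rewrite (ramp0 (rlt i.+1)) ?ler0n// ler_pdivrMr// mulrC.
have {}h : d2 j - 1 < i.+2%:R / K.+1%:R by rewrite ltr_pdivlMr// mulrC.
rewrite (_ : d2 j <= a + 3 / K.+1%:R) ?ramp_le1//.
move: h i1; rewrite !succ; move: (K.+1%:R^-1) => w; lra.
Qed.

End matching.

End eigenvalue_matching.

(** * Approximate unitary equivalence *)

Lemma seq_eventually (T : eqType) (s : seq T) (P : T -> nat -> Prop) :
  (forall x, exists N, forall M, (N <= M)%N -> P x M) ->
  exists N, forall M, (N <= M)%N -> forall x, x \in s -> P x M.
Proof.
move=> h; elim: s => [|x s [N IH]]; first by exists 0%N.
have [N' hN'] := h x; exists (maxn N N') => M; rewrite geq_max => /andP[NM N'M] y.
by rewrite inE => /orP[/eqP ->|ys]; [exact: hN'|exact: IH].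
Qed.

Section approximate_equivalence.
Variables (R : realType) (n : nat).
Local Notation A := (contMx R n).
Local Notation e_ := (@munit R n).

Lemma opnorm_sum (L : nat) (I : Type) (s : seq I) (F : I -> 'M[Cx R]_L.+1) :
  opnorm (\sum_(i <- s) F i) <= \sum_(i <- s) opnorm (F i).
Proof.
elim: s => [|i s IH]; last first.
  by rewrite !big_cons; apply: (le_trans (opnormD _ _)); rewrite lerD2l.
by rewrite !big_nil -(scale0r 0) opnormZ modulus0 mul0r.
Qed.

(** A unitary matching only the corners is spread by v = sum of pi2(e_i0) W pi1(e_0i), which
    intertwines all matrix units exactly. The error on f is then a sum over its (n + 1)^2
    compressions to the corner. *)
Lemma intertwiner (L : nat) (pi1 pi2 : A -> 'M[Cx R]_L.+1) (W : 'M[Cx R]_L.+1) (eps : R) :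
  matrix_rep pi1 -> matrix_rep pi2 -> unitary W ->
  W *m pi1 (e_ 0 0) = pi2 (e_ 0 0) *m W ->
  exists2 v : 'M[Cx R]_L.+1, unitary v & forall f,
    (forall i j, opnorm (W *m pi1 (e_ 0 i * f * e_ j 0) - pi2 (e_ 0 i * f * e_ j 0) *m W) <= eps) ->
    opnorm (v *m pi1 f *m adjoint v - pi2 f) <= (n.+1 * n.+1)%:R * eps.
Proof.
move=> r1 r2 uW W00; pose v := \sum_i pi2 (e_ i 0) *m W *m pi1 (e_ 0 i).
have vE : adjoint v = \sum_i pi1 (e_ i 0) *m adjoint W *m pi2 (e_ 0 i).
  rewrite /v; elim/big_rec2: _ => [|i x y _ <-].
    by apply/matrixP => a b; rewrite !mxE rmorph0.
  rewrite adjointD !adjointM -(rep_star r1) -(rep_star r2) !munit_star mulmxA.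
  by [].
have vv : v *m adjoint v = 1%:M.
  rewrite {1}/v vE mulmx_suml.
  rewrite (eq_bigr (fun i => pi2 (e_ i i))) => [|i _].
    by rewrite -(rep_sum r2) munit_sum (rep1 r2).
  rewrite mulmx_sumr (bigD1 i)//= [X in _ + X]big1 ?addr0 => [|j ji]; last first.
    rewrite -!mulmxA [pi1 (e_ 0 i) *m _]mulmxA -(repM r1) munitM eq_sym (negbTE ji).
    by rewrite (rep0 r1) mul0mx !mulmx0.
  rewrite -!mulmxA [pi1 (e_ 0 i) *m _]mulmxA -(repM r1) munitM eqxx.
  (* Here the exact intertwining of [e_00] is used: it moves past W, and W meets its adjoint. *)
  rewrite [W *m _]mulmxA W00 -[pi2 _ *m W *m _]mulmxA [W *m _]mulmxA (unitaryC uW) mul1mx.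
  by rewrite -!(repM r2) !munitM !eqxx.
have uv : unitary v by apply: mulmx1C.
exists v => // f hf.
have E : v *m pi1 f - pi2 f *m v = \sum_i \sum_j
    pi2 (e_ i 0) *m (W *m pi1 (e_ 0 i * f * e_ j 0) - pi2 (e_ 0 i * f * e_ j 0) *m W) *m pi1 (e_ 0 j).
  have E1 : v *m pi1 f = \sum_i \sum_j
      pi2 (e_ i 0) *m (W *m pi1 (e_ 0 i * f * e_ j 0)) *m pi1 (e_ 0 j).
    rewrite mulmx_suml; apply: eq_bigr => i _.
    rewrite [RHS](eq_bigr (fun j => pi2 (e_ i 0) *m W *m pi1 (e_ 0 i * f * e_ j j))).
      rewrite -mulmx_sumr -(rep_sum r1) -mulr_sumr munit_sum mulr1 (repM r1).
      by rewrite !mulmxA.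
    move=> j _; rewrite -!mulmxA -(repM r1) -[_ * e_ j 0 * _]mulrA munitM eqxx.
    by [].
  have E2 : pi2 f *m v = \sum_i \sum_j
      pi2 (e_ i 0) *m (pi2 (e_ 0 i * f * e_ j 0) *m W) *m pi1 (e_ 0 j).
    rewrite exchange_big /= mulmx_sumr; apply: eq_bigr => j _.
    rewrite [RHS](eq_bigr (fun i => pi2 (e_ i i) *m (pi2 (f * e_ j 0) *m W *m pi1 (e_ 0 j)))).
      rewrite -mulmx_suml -(rep_sum r2) munit_sum (rep1 r2) mul1mx (repM r2).
      by rewrite !mulmxA.
    move=> i _; rewrite !mulmxA -!(repM r2) -[e_ 0 i * f * _]mulrA mulrA munitM eqxx.
    by [].
  rewrite E1 E2 -sumrB; apply: eq_bigr => i _; rewrite -sumrB; apply: eq_bigr => j _.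
  by rewrite -mulmxBl -mulmxBr.
have -> : v *m pi1 f *m adjoint v - pi2 f = (v *m pi1 f - pi2 f *m v) *m adjoint v.
  by rewrite mulmxBl -[pi2 f *m v *m _]mulmxA vv mulmx1.
apply: (le_trans (opnormM _ _)).
apply: (@le_trans _ _ (opnorm (v *m pi1 f - pi2 f *m v) * 1)).
  by rewrite ler_wpM2l ?opnorm_ge0// opnorm_unitary//; exact: unitary_adjoint.
rewrite mulr1 E; apply: (le_trans (opnorm_sum _ _)).
apply: (@le_trans _ _ (\sum_(i < n.+1) \sum_(j < n.+1) eps)); last first.
  by rewrite !sumr_const !card_ord -mulrnA mulr_natl.
apply: ler_sum => i _; apply: (le_trans (opnorm_sum _ _)); apply: ler_sum => j _.
apply: (le_trans (opnormM _ _)).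
have h0 := le_trans (opnorm_ge0 _) (hf i j).
apply: (@le_trans _ _ (eps * 1)); last by rewrite mulr1.
apply: ler_pM; rewrite ?opnorm_ge0 ?rep_munit_norm//.
apply: (le_trans (opnormM _ _)); apply: (@le_trans _ _ (1 * eps)); last by rewrite mul1r.
by apply: ler_pM; rewrite ?opnorm_ge0 ?rep_munit_norm.
Qed.

(* Two representations with nearly the same trace on finitely many ramps have
   nearly the same sorted eigenvalues: since the trace is faithful, consecutive
   ramps differ in trace by more than the error. *)
Lemma approximate_unitary_equivalence (tau : {scalar A}) (htau : is_trace tau)
    (G : seq A) (e : R) : faithful tau -> 0 < e ->
  exists (H : seq A) (eta : R), 0 < eta /\
    forall (L : nat) (pi1 pi2 : A -> 'M[Cx R]_L.+1), matrix_rep pi1 -> matrix_rep pi2 ->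
    (forall h, h \in H -> modulus (tau h - ntr (pi1 h)) <= eta) ->
    (forall h, h \in H -> modulus (tau h - ntr (pi2 h)) <= eta) ->
    exists2 v : 'M[Cx R]_L.+1, unitary v &
      forall f, f \in G -> opnorm (v *m pi1 f *m adjoint v - pi2 f) <= e.
Proof.
move=> ft e0; have mmu := trace_mean_mean htau; have fmu := trace_mean_faithful htau ft.
pose eps := e / (n.+1 * n.+1)%:R; have eps0 : 0 < eps by rewrite divr_gt0// ltr0n.
have [K0 hK0] : exists K0 : nat, forall K, (K0 <= K)%N -> forall f, f \in G ->
    forall s t : I01 R, `|set_val s - set_val t : R| <= 3 / K.+1%:R -> opnorm (f s - f t) <= eps.
  apply: (seq_eventually G (P := fun f K => forall s t : I01 R,
     `|set_val s - set_val t : R| <= 3 / K.+1%:R -> opnorm (f s - f t) <= eps)) => f.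
  have [d d0 hd] := cm_uniform f eps0.
  have [N hN] := archi_inv (divr_gt0 d0 (ltr0Sn R 2)).
  exists N => K NK s t st; apply: hd; apply: (le_trans st).
  by have := hN K NK; move: (K.+1%:R^-1) => w; lra.
(* At least 6, so that 3 / (K + 1) is at most 1/2 and a match within this distance never pairs the
   eigenvalue 0 with one in [1, 2]. *)
pose K := maxn K0 6; have hK := hK0 K (leq_maxl _ _).
have K3 : 3 / K.+1%:R <= 1 / 2 :> R.
  have : 7%:R <= K.+1%:R :> R by rewrite ler_nat ltnS leq_maxr.
  have K0' : 0 < K.+1%:R :> R by rewrite ltr0n.
  by move=> h; rewrite ler_pdivrMr//; lra.
pose r (i : nat) : R -> R := ramp (i%:R / K.+1%:R) (i.+1%:R / K.+1%:R).
have cr i : continuous (r i) by exact: ramp_continuous.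
pose mu := trace_mean tau.
have gap (i : 'I_K) : 0 < mu (r i.+1) - mu (r i).
  have l1 : i%:R / K.+1%:R < i.+1%:R / K.+1%:R :> R by exact: node_lt.
  have l2 : i.+1%:R / K.+1%:R < i.+2%:R / K.+1%:R :> R by exact: node_lt.
  have pos x : 0 <= x <= 1 -> 0 <= r i.+1 x - r i x by move=> _; rewrite subr_ge0 ramp_le.
  have cs := continuous_sub (cr i.+1) (cr i).
  rewrite -(meanB mmu)// lt_def (mean_ge0 mmu cs pos) andbT; apply/eqP => z.
  have := fmu _ cs pos z (i.+1%:R / K.+1%:R).
  rewrite node_itv => [|//]; last by rewrite ltnS ltnW.
  move=> /(_ isT); rewrite /r ramp1// ramp0// subr0 => /eqP.
  by rewrite oner_eq0.
(* At most half of every gap: errors of size [eta] in both traces cannot reverse the order between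
   consecutive ramps. *)
pose eta := \big[Num.min/1]_(i < K) ((mu (r i.+1) - mu (r i)) / 2).
have eta0 : 0 < eta.
  by rewrite /eta; elim/big_rec: _ => // i x _ x0; rewrite lt_min x0 divr_gt0.
have eta_le (i : 'I_K) : mu (r i) + eta <= mu (r i.+1) - eta.
  have : eta <= (mu (r i.+1) - mu (r i)) / 2.
    by rewrite /eta (bigD1 i)//= ge_min lexx.
  by lra.
exists [seq scal n (r i) | i <- iota 0 K.+1], eta; split => // L pi1 pi2 r1 r2 h1 h2.
have [U1 [d1 [u1 s1 z1 D1]]] := corner_diagonalization r1.
have [U2 [d2 [u2 s2 z2 D2]]] := corner_diagonalization r2.
have weightE (pi : A -> 'M[Cx R]_L.+1) (rp : matrix_rep pi) U d g : unitary U ->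
    (forall i, d i = 0 \/ 0 <= d i - 1 <= 1) ->
    (forall b, corner b -> pi b = U *m diag_mx (\row_i
        (if d i == 0 then 0 else b (clamp (d i - 1)) 0 0)) *m adjoint U) ->
    continuous g ->
    weight d g = L.+1%:R / n.+1%:R * complex.Re (ntr (pi (scal n g))).
  move=> uU hd hU cg.
  have -> : ntr (pi (scal n g)) = ((n.+1%:R / L.+1%:R * weight d g)%:C)%C.
    rewrite (rep_scal_trace rp cg) (hU _ (@corner_of_corner R n g cg)) -mulmxA ntr_mulC -mulmxA uU mulmx1.
    rewrite [ntr]unlock mxtrace_diag !rmorphM fmorphV !rmorph_nat mulrA; congr (_ * _).
    rewrite rmorph_sum; apply: eq_bigr => i _; rewrite mxE.
    case: eqP => // d0; rewrite corner_ofE// !mxE !eqxx mulr1 clampE//.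
    by case: (hd i).
  have n0 : n.+1%:R != 0 :> R by rewrite pnatr_eq0.
  have L0 : L.+1%:R != 0 :> R by rewrite pnatr_eq0.
  move: n0 L0; rewrite /=; move: (n.+1%:R : R) (L.+1%:R : R) (weight d g) => x y w x0 y0.
  by field; rewrite x0 y0.
have wE1 g := weightE pi1 r1 U1 d1 g u1 z1 D1.
have wE2 g := weightE pi2 r2 U2 d2 g u2 z2 D2.
have c1 : continuous (fun _ : R => (1 : R)) by exact: cst_continuous.
have one : scal n (fun=> 1) = 1 :> A.
  by apply: contMxP => t; rewrite scalE//.
(* The corners have equal rank, since both representations give 1 the trace 1 exactly. *)
have w1 : weight d1 (fun=> 1) = weight d2 (fun=> 1).
  by rewrite wE1// wE2// one (rep1 r1) (rep1 r2).
have c0 : 0 <= L.+1%:R / n.+1%:R :> R by rewrite divr_ge0.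
have inH (i : nat) : (i <= K)%N -> scal n (r i) \in [seq scal n (r i) | i <- iota 0 K.+1].
  by move=> iK; apply/mapP; exists i => //; rewrite mem_iota.
have near (pi : A -> 'M[Cx R]_L.+1) (i : nat) : modulus (tau (scal n (r i)) - ntr (pi (scal n (r i)))) <= eta ->
    mu (r i) - eta <= complex.Re (ntr (pi (scal n (r i)))) <= mu (r i) + eta.
  move=> h; have := le_trans (modulus_Re _) h.
  by rewrite raddfB /= -/(mu (r i)) ler_norml; lra.
have wr12 (i : nat) : (i < K)%N -> weight d1 (r i) <= weight d2 (r i.+1).
  move=> iK; rewrite wE1// wE2// ler_wpM2l//.
  have /andP[_ a1] := near pi1 i (h1 _ (inH i (ltnW iK))).
  have /andP[a2 _] := near pi2 i.+1 (h2 _ (inH i.+1 iK)).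
  by have := eta_le (Ordinal iK); rewrite /=; lra.
have wr21 (i : nat) : (i < K)%N -> weight d2 (r i) <= weight d1 (r i.+1).
  move=> iK; rewrite wE1// wE2// ler_wpM2l//.
  have /andP[_ a1] := near pi2 i (h2 _ (inH i (ltnW iK))).
  have /andP[a2 _] := near pi1 i.+1 (h1 _ (inH i.+1 iK)).
  by have := eta_le (Ordinal iK); rewrite /=; lra.
have d21 := sorted_counting s1 s2 (counting_of_weights z1 z2 w1 wr12).
have d12 := sorted_counting s2 s1 (counting_of_weights z2 z1 (esym w1) wr21).
have dz i : (d1 i == 0) = (d2 i == 0).
  have := d12 i; have := d21 i; move: K3; move: (3 / _) => w.
  case: (z1 i) => [->|z1i]; case: (z2 i) => [->|z2i]; rewrite ?eqxx// => h3 a1 a2.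
  - by exfalso; move/andP: z2i => [? ?]; lra.
  - by exfalso; move/andP: z1i => [? ?]; lra.
  - move/andP: z1i => [? ?]; move/andP: z2i => [? ?].
    by rewrite !gt_eqF//; lra.
(* W sends the i-th eigenvector of the first sorted basis to the i-th of the second. *)
pose W := U2 *m adjoint U1.
have uW : unitary W.
  rewrite /unitary /W adjointM adjointK mulmxA -[_ *m adjoint U2 *m U2]mulmxA u2 mulmx1.
  exact: unitaryC.
pose D (d : 'I_L.+1 -> R) b : 'M[Cx R]_L.+1 := diag_mx (\row_i
   (if d i == 0 then 0 else (b : A) (clamp (d i - 1)) 0 0)).
have WD b : corner b -> W *m pi1 b - pi2 b *m W = U2 *m (D d1 b - D d2 b) *m adjoint U1.
  move=> cb; rewrite (D1 _ cb) (D2 _ cb) -/(D d1 b) -/(D d2 b) /W mulmxBr mulmxBl.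
  congr (_ - _); rewrite !mulmxA.
    by rewrite -[U2 *m adjoint U1 *m U1]mulmxA u1 mulmx1.
  by rewrite -[_ *m adjoint U2 *m U2]mulmxA u2 mulmx1.
have c00 : corner (e_ 0 0).
  by move=> t; rewrite /munit cmatE !mxE !eqxx scale1r.
have W00 : W *m pi1 (e_ 0 0) = pi2 (e_ 0 0) *m W.
  apply/eqP; rewrite -subr_eq0 (WD _ c00) (_ : D d1 _ - D d2 _ = 0) ?mulmx0 ?mul0mx//.
  rewrite /D (_ : (\row_i _) = \row_i (if d2 i == 0 then 0 else (e_ 0 0) (clamp (d2 i - 1)) 0 0)) ?subrr//.
  by apply/rowP => i; rewrite !mxE dz.
have [v uv hv] := intertwiner eps r1 r2 uW W00.
exists v => // f fG; apply: (le_trans (hv f _)); last first.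
  by rewrite /eps mulrC divfK// pnatr_eq0 muln_eq0.
move=> i j; rewrite (WD _ (corner_compress f i j)); set b := (X in D d1 X).
rewrite -[X in D d2 X]/b.
have ent t : b t 0 0 = f t i j.
  by rewrite /b !contMxM /munit !cmatE delta_mul3 !mxE !eqxx mulr1.
move: b ent => b ent.
apply: (le_trans (opnormM _ _)).
have u1' := opnorm_unitary (unitary_adjoint u1).
apply: (@le_trans _ _ (opnorm (U2 *m (D d1 b - D d2 b)))).
  by rewrite ler_piMr ?opnorm_ge0.
apply: (le_trans (opnormM _ _)).
apply: (@le_trans _ _ (opnorm (D d1 b - D d2 b))).
  by rewrite ler_piMl ?opnorm_ge0// opnorm_unitary.
rewrite /D -raddfB /=; apply: opnorm_diag_le => [|k]; first exact: ltW.
rewrite !mxE -dz; have [z|z] := eqVneq (d1 k) 0; first by rewrite subrr modulus0 ltW.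
rewrite !ent; set x1 := clamp (d1 k - 1); set x2 := clamp (d2 k - 1).
apply: le_trans (hK f fG x1 x2 _).
  by have := modulus_le_opnorm (f x1 - f x2) i j; rewrite !mxE.
apply: (le_trans (clamp_lip _ _)).
have := d12 k; have := d21 k; move: (3 / _) => w a1 a2.
by rewrite ler_norml; apply/andP; split; lra.
Qed.

End approximate_equivalence.

(** * Near amalgamation *)

Section large_divisors.
Variable R : realType.

(** Were the admissible multiples of a bounded, the largest one, l, could not be multiplied by any
    prime. Every exponent of nu would then be finite and at most that of l, making their sum
    finite. *)
Lemma large_divisor (nu : exponents) (a B : nat) : supernatural R nu ->
  (0 < a)%N -> formally_divides a nu ->
  exists l, [/\ (0 < l)%N, (a %| l)%N, (B <= l)%N & formally_divides l nu].
Proof.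
move=> hnu a0 ha; apply/not_existsP => h.
pose P l := [&& (0 < l)%N, (a %| l)%N & `[< formally_divides l nu >]].
have Pa : exists l, P l by exists a; rewrite /P a0 dvdnn; exact/asboolP.
have PB l : P l -> (l <= B)%N.
  move=> /and3P[l0 al /asboolP hl]; rewrite leqNgt; apply/negP => lB.
  by apply: (h l); split => //; exact: ltnW.
case: (ex_maxnP Pa PB) => l /and3P[l0 al /asboolP hl] lmax.
have nuE (p : {p : nat | prime p}) : exists2 k, nu p = Some k & (k <= logn (val p) l)%N.
  have p0 := prime_gt0 (valP p).
  apply/not_exists2P => hp; have : P (l * val p)%N.
    rewrite /P muln_gt0 l0 p0 dvdn_mulr//=; apply/asboolP => q.
    have := hl q; have := hp; case E : (nu q) => [k|//] hp' lk.
    rewrite lognM// (logn_prime _ (valP p)).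
    have [qp|_] := eqVneq (val q) (val p); last by rewrite addn0.
    have {}qp : q = p by exact: val_inj.
    case: (hp' k) => [|/negP]; first by rewrite -qp E.
    by rewrite -ltnNge addn1 qp.
  by move=> /lmax; rewrite leqNgt ltn_Pmulr// prime_gt1// (valP p).
(* Only primes p <= l contribute, fewer than l + 1 numbers with exponents at most l each. *)
have : (\esum_(p in [set: {p : nat | prime p}])
     (if nu p is Some k then k%:R%:E else +oo) <= ((l.+1 * l)%:R : R)%:E)%E.
  apply: ge_ereal_sup => _ [X [finX _] <-].
  rewrite fsbig_finite//=.
  set S := (X in (X <= _)%E).
  have hS : (S <= ((\sum_(p <- finmap.enum_fset (fset_set X)) logn (val p) l)%N%:R : R)%:E)%E.
    rewrite /S; elim/big_rec2: _ => // p x y _ xy; have [k -> kl] := nuE p.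
    by rewrite natrD EFinD leeD// lee_fin ler_nat.
  apply: (le_trans hS); rewrite lee_fin ler_nat.
  apply: (@leq_trans (\sum_(p <- finmap.enum_fset (fset_set X) | (val p <= l)%N) l)).
    rewrite [leqRHS]big_mkcond; apply: leq_sum => p _.
    have [_|lp] := leqP (val p) l.
      by apply: ltnW; apply: leq_trans (ltn_expl _ (prime_gt1 (valP p))) _;
         apply: dvdn_leq => //; exact: pfactor_dvdnn.
    by rewrite leqn0 -leqn0 leqNgt logn_gt0 mem_primes (valP p) l0 /=; apply/negP => /(dvdn_leq l0);
       rewrite leqNgt lp.
  rewrite big_const_seq iter_addn_0 mulnC leq_mul2r -size_filter; apply/orP; right.
  rewrite -(size_map val) -[leqRHS](size_iota 0); apply: uniq_leq_size.
    by rewrite map_inj_uniq; [exact/filter_uniq/finmap.fset_uniq|exact: val_inj].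
  by move=> q /mapP[p]; rewrite mem_filter => /andP[pl _] ->; rewrite mem_iota.
by rewrite hnu.
Qed.

End large_divisors.

Section near_amalgamation.
Variables (R : realType).

Lemma path_uniform (n : nat) (f : contMx R n) (Q : R -> R) (eta : R) :
  continuous Q -> 0 < eta -> exists N : nat, forall M : nat, (N <= M)%N ->
    forall (m : 'I_M.+1) (s : R), 0 <= s <= 1 ->
    opnorm (f (clamp (Q ((m%:R + s) / M.+1%:R))) - f (clamp (Q ((m%:R + 0) / M.+1%:R)))) <= eta.
Proof.
move=> cQ eta0.
have [||s e e0|d d0 hd] := @uniform_pdist R (fun s t => opnorm (f (clamp (Q s)) - f (clamp (Q t)))) _ _ _ eta eta0.
- by move=> s t; rewrite -opnormN opprB.
- by move=> s t u; rewrite -(subrKA (f (clamp (Q t)))) opnormD.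
- have /continuous_opnormP/(_ (clamp (Q s)) e e0)[d d0 fd] := @contMx_continuous _ _ f.
  near=> t; rewrite -opnormN opprB; apply: ltW; apply: fd.
  apply: (le_lt_trans (clamp_lip _ _)); rewrite distrC.
  by near: t; have /cvgrPdist_lt := cQ s; apply.
have [N hN] := archi_inv d0; exists N => M NM m s /andP[s0 s1].
have M0 : 0 < M.+1%:R :> R by rewrite ltr0n.
have itv (u : R) : 0 <= u <= 1 -> 0 <= (m%:R + u) / M.+1%:R <= 1.
  move=> /andP[u0 u1]; rewrite divr_ge0 ?addr_ge0//= ler_pdivrMr// mul1r.
  by rewrite (@le_trans _ _ (m%:R + 1))// ?lerD2l// natr1 ler_nat.
apply: hd; rewrite ?itv ?lexx ?ler01 ?s0//.
rewrite -mulrBl addr0 addrAC subrr add0r normrM normfV (gtr0_norm M0) ger0_norm//.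
by apply: le_trans (hN M NM); rewrite ler_piMl// invr_ge0.
Unshelve. all: by end_near. Qed.

Lemma lebesgue_trace_near (L : nat) (f : contMx R L) (B : 'M[Cx R]_L.+1) (eta : R) :
  (forall t, opnorm (f t - B) <= eta) ->
  modulus (mean_trace (lam_mean R) f - ntr B) <= eta.
Proof.
move=> fB; have -> : ntr B = mean_trace (lam_mean R) (cmat B).
  by apply: Cx_eqP => /=; rewrite -[LHS](mean_cst (lam_mean R)).
rewrite -(raddfB (mean_trace (lam_mean R) : {scalar contMx R L})) /=.
(* Exponents all infinite admit every matrix size, so the trace bound for the class applies to any
   L. *)
have K : class_nu (fun=> None) (lebesgue_alg R L) by apply: lebesgue_alg_class.
apply: (le_trans (modulus_trace (f - cmat B : lebesgue_alg R L) K)).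
exact: cm_norm_le.
Qed.

(* Each of the M + 1 diagonal blocks sees [f] only on an interval where it is
   nearly constant. *)
Lemma spread_embedding (n : nat) (tau : {scalar contMx R n}) (htau : is_trace tau)
    (F : seq (contMx R n)) (eta : R) : faithful tau -> 0 < eta ->
  exists N : nat, forall M L : nat, (N <= M)%N -> L.+1 = (M.+1 * n.+1)%N ->
  exists2 rho : contMx R n -> 'M[Cx R]_L.+1, matrix_rep rho &
    (forall f, f \in F -> modulus (tau f - ntr (rho f)) <= eta) /\
    (forall U, unitary U -> exists psi : embedding (TracialAlg htau) (lebesgue_alg R L),
      forall f, f \in F -> forall t,
        opnorm ((psi f : contMx R L) t - U *m rho f *m adjoint U) <= eta).
Proof.
move=> ft eta0; have mmu := trace_mean_mean htau; have fmu := trace_mean_faithful htau ft.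
set Q := quantile (trace_mean tau).
have cQ : continuous Q by exact: quantile_continuous.
have [N hN] := seq_eventually F (fun f => path_uniform f cQ eta0).
exists N => M L NM hL; have [e be] := block_bijection hL.
pose q (m : 'I_M.+1) (s : R) : R := Q ((m%:R + s) / M.+1%:R).
have cq m : continuous (q m).
  move=> s; apply: continuous_comp; last exact: cQ.
  apply: continuousM; [|exact: cst_continuous].
  by apply: continuousD => //; exact: cst_continuous.
have q01 m (x : R) : 0 <= x <= 1 -> 0 <= q m x <= 1 by move=> _; exact: quantile_itv.
have hq h : continuous h -> trace_mean tau h = M.+1%:R^-1 * \sum_m lam (h \o q m).
  move=> ch; rewrite -(lam_quantile mmu fmu ch) (lam_split M) => [|x]; last first.
    by apply: continuous_comp; [exact: cQ|exact: ch].
  by [].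
(* The values of f at the left ends of the pieces. This does not depend on U, so U can be chosen
   after two such representations have been compared. *)
pose rho (f : contMx R n) := bdiag e (fun m => f (clamp (q m 0))).
have emb U : unitary U -> exists psi : embedding (TracialAlg htau) (lebesgue_alg R L),
      forall f, f \in F -> forall t,
        opnorm ((psi f : contMx R L) t - U *m rho f *m adjoint U) <= eta.
  move=> uU; have [psi hpsi] := diagonal_embedding htau be uU ft cq q01 hq.
  exists psi => f fF t; rewrite hpsi -mulmxBl -mulmxBr -bdiagB.
  apply: (le_trans (opnorm_conj_le _ uU)); apply: bdiag_opnorm => // [|m]; first exact: ltW.
  by apply: hN => //; exact: I01_itv.
exists rho; split => //.
- by move=> f g; rewrite /rho -bdiagD.
- by move=> c f; rewrite /rho -bdiagZ.
- by move=> f g; rewrite /rho -bdiagM.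
- exact: bdiag1.
- by move=> f; rewrite /rho -bdiag_adjoint.
- move=> f fF; have [psi hpsi] := emb _ (unitary1 R L).
  rewrite -(emb_tr psi); apply: lebesgue_trace_near => t.
  have := hpsi f fF t; rewrite mul1mx.
  have -> : adjoint 1%:M = 1%:M :> 'M[Cx R]_L.+1.
    by rewrite /adjoint tr_scalar_mx map_scalar_mx rmorph1.
  by rewrite mulmx1.
Qed.

End near_amalgamation.

Lemma class_nu_NAP (R : realType) (nu : exponents) :
  supernatural R nu -> NAP (@class_nu R nu).
Proof.
move=> hnu X Y1 Y2 [n [tau [htau [_ ft ->]]]] [n1 [tau1 [htau1 [hn1 ft1 ->]]]].
move=> [n2 [tau2 [htau2 [hn2 ft2 ->]]]] phi1 phi2 G e /finite_seqP[s ->] e0.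
(* Three errors of e / 4 are added at the end: two from replacing embeddings by constant matrices,
   one from the unitary equivalence. *)
have e3 : 0 < e / 4 by rewrite divr_gt0.
have [H [eta [eta0 hH]]] := approximate_unitary_equivalence htau s ft e3.
pose m : R := Num.min eta (e / 4); have m0 : 0 < m by rewrite lt_min eta0.
(* The images of [H] carry the trace estimates for the equivalence, those of [s] the approximation
   on the given finite set. *)
pose F1 : seq (contMx R n1) := [seq (phi1 h : contMx R n1) | h <- H ++ s].
pose F2 : seq (contMx R n2) := [seq (phi2 h : contMx R n2) | h <- H ++ s].
have [N1 hN1] := spread_embedding htau1 F1 ft1 m0.
have [N2 hN2] := spread_embedding htau2 F2 ft2 m0.
have l0 : (0 < lcmn n1.+1 n2.+1)%N by rewrite lcmn_gt0.
(* A common multiple of both sizes, so large that the numbers of blocks exceed [N1] and [N2]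
   respectively. *)
have [l [lpos dL BL hL]] := large_divisor (maxn (N1.+1 * n1.+1) (N2.+1 * n2.+1)) hnu l0
  (formally_divides_lcm (ltn0Sn n1) (ltn0Sn n2) hn1 hn2).
case: l lpos dL BL hL => [//|L] _ dL BL hL.
have quot (k N : nat) : (k.+1 %| L.+1)%N -> (N.+1 * k.+1 <= L.+1)%N ->
    exists2 M : nat, (N <= M)%N & L.+1 = (M.+1 * k.+1)%N.
  move=> /dvdnP[[//|M] E]; rewrite E leq_pmul2r// => NM.
  by exists M.
move: BL; rewrite geq_max => /andP[B1 B2].
have [M1 NM1 E1] := quot _ _ (dvdn_trans (dvdn_lcml _ _) dL) B1.
have [M2 NM2 E2] := quot _ _ (dvdn_trans (dvdn_lcmr _ _) dL) B2.
have [rho1 r1 [t1 emb1]] := hN1 M1 L NM1 E1.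
have [rho2 r2 [t2 emb2]] := hN2 M2 L NM2 E2.
pose pi1 (f : contMx R n) : 'M[Cx R]_L.+1 := rho1 (phi1 f).
pose pi2 (f : contMx R n) : 'M[Cx R]_L.+1 := rho2 (phi2 f).
have mr k (sigma : {scalar contMx R k}) (hs : is_trace sigma) (rho : contMx R k -> 'M[Cx R]_L.+1)
    (phi : embedding (TracialAlg htau) (TracialAlg hs)) :
    matrix_rep rho -> matrix_rep (fun f : contMx R n => rho (phi f)).
  move=> rr; split.
  - by move=> f g; rewrite (raddfD (emb_fun phi)) (repD rr).
  - by move=> c f; rewrite -(repZ rr); congr rho; exact: (linearZZ (emb_fun phi)).
  - by move=> f g; rewrite (rmorphM (emb_fun phi)) (repM rr).
  - by rewrite (rmorph1 (emb_fun phi)) (rep1 rr).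
  - by move=> f; rewrite (emb_star phi) (rep_star rr).
have inF1 h : h \in H ++ s -> (phi1 h : contMx R n1) \in F1.
  by move=> hh; apply/mapP; exists h.
have inF2 h : h \in H ++ s -> (phi2 h : contMx R n2) \in F2.
  by move=> hh; apply/mapP; exists h.
have [h hh|h hh|v uv hv] := hH L pi1 pi2 (mr _ _ _ _ phi1 r1) (mr _ _ _ _ phi2 r2).
- rewrite -(emb_tr phi1); apply: (le_trans (t1 _ (inF1 h _))); first by rewrite mem_cat hh.
  by rewrite ge_min lexx.
- rewrite -(emb_tr phi2); apply: (le_trans (t2 _ (inF2 h _))); first by rewrite mem_cat hh.
  by rewrite ge_min lexx.
have [psi1 h1] := emb1 v uv; have [psi2 h2] := emb2 _ (unitary1 R L).
exists (lebesgue_alg R L), psi1, psi2; split; first exact: lebesgue_alg_class.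
move=> a /= sa; have sa' : a \in H ++ s by rewrite mem_cat sa orbT.
apply: (@le_lt_trans _ _ (e / 4 + e / 4 + e / 4)); last by lra.
have me : m <= e / 4 by rewrite ge_min lexx orbT.
change (cm_norm ((psi1 (phi1 a) : contMx R L) - (psi2 (phi2 a) : contMx R L)) <= e / 4 + e / 4 + e / 4).
apply: cm_norm_le => t.
have a1 := le_trans (h1 _ (inF1 a sa') t) me.
have a2 := le_trans (h2 _ (inF2 a sa') t) me.
have a3 := hv a sa; move: a2; rewrite mul1mx.
have -> : adjoint 1%:M = 1%:M :> 'M[Cx R]_L.+1.
  by rewrite /adjoint tr_scalar_mx map_scalar_mx rmorph1.
rewrite mulmx1 => a2; move: a1 a2 a3; rewrite /pi1 /pi2.
set B1' := v *m _ *m _; set B2' := rho2 _.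
set g1 : contMx R L := psi1 _; set g2 : contMx R L := psi2 _ => a1 a2 a3.
have -> : (g1 - g2 : contMx R L) t = (g1 t - B1') + (B1' - B2') - (g2 t - B2').
  by rewrite subrKA opprB subrKA.
apply: (le_trans (opnormD _ _)); rewrite opnormN; apply: lerD => //.
by apply: (le_trans (opnormD _ _)); exact: lerD.
Qed.

Theorem theorem3p8 (R : realType) (nu : exponents) (hnu : supernatural R nu) :
  @Fraisse_class R (@class_nu R nu).
Proof.
split.
- exact: class_nu_finitely_generated.
- exact: class_nu_JEP.
- exact: class_nu_NAP.
- exact: class_nu_WPP.
- by split; [exact: class_nu_CCP_pred|exact: class_nu_CCP_fun].
Qed.
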